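(* Let $n\geq 3$ and let $\phi:M_n\to M_n$ be a map (not assumed linear or additive) whose range contains the set $\mathcal{I}_n^{\pm}$. Suppose that $$A\circ B\in\mathcal{I}_n\quad\Longleftrightarrow\quad\phi(A)\circ\phi(B)\in\mathcal{I}_n$$ for every $A,B\in M_n$. Then there exist a field automorphism $\sigma$ of $\mathbb{C}$, a non-singular matrix $T\in M_n$ and $\lambda\in\{1,-1\}$ such that $$\phi([x_{ij}])=\lambda T[\sigma(x_{ij})]^{\diamond}T^{-1}\qquad\text{for every }[x_{ij}]\in M_n,$$ where $\diamond$ denotes one of the following maps on $M_n$ (the same one for all matrices): the identity or the transposition.
   Context: $M_n$ is the algebra of $n\times n$ complex matrices. The Jordan product is $A\circ B=\frac12(AB+BA)$. $\mathcal{I}_n\subseteq M_n$ is the set of all idempotent matrices ($P^2=P$, including $0$). A matrix $P$ is anti-idempotent if $P^2=-P$ and $P\ne0$. $\mathcal{I}_n^{\pm}\subseteq M_n$ is the union of the set of rank-one idempotent matrices and the set of rank-one anti-idempotent matrices. The field automorphism $\sigma$ need not be continuous. *)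

(* Defs.v *)
From mathcomp Require Import all_boot all_algebra.
From mathcomp Require Import classical_sets.

Set Implicit Arguments.
Unset Strict Implicit.
Unset Printing Implicit Defensive.

Import GRing.Theory.
Local Open Scope ring_scope.
Local Open Scope classical_set_scope.

Section Idempotents.
Variables (F : fieldType) (n : nat).
Implicit Types A B P : 'M[F]_n.

Definition jordan_prod A B : 'M[F]_n := 2%:R^-1 *: (A *m B + B *m A).

Definition idempotent_mx P : Prop := P *m P = P.

Definition anti_idempotent_mx P : Prop := P *m P = - P /\ P <> 0.

Definition idempotents : set 'M[F]_n := [set P | idempotent_mx P].

Definition rank1_pm_idempotents : set 'M[F]_n :=
  [set P | idempotent_mx P /\ \rank P = 1%N] `|`
  [set P | anti_idempotent_mx P /\ \rank P = 1%N].

End Idempotents.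
Arguments idempotents : clear implicits.
Arguments rank1_pm_idempotents : clear implicits.

(* Main.v *)
Require Import Defs.
From HB Require Import structures.
From mathcomp Require Import all_boot all_order all_algebra.
From mathcomp Require Import classical_sets boolp reals complex.
From mathcomp Require Import ring zify.

Set Implicit Arguments.
Unset Strict Implicit.
Unset Printing Implicit Defensive.

Import Order.TTheory GRing.Theory Num.Theory.
Local Open Scope ring_scope.

(* Call A and B related when their Jordan product is idempotent. For a rank-one
   idempotent yg, a matrix A is related to yg exactly when Ay = y, or gA = g, or
   Ay = 0 and gA = 0. A family of matrices all related to a preimage of yg and
   forming an affine space must fall entirely under one of the three alternatives,
   since each of them is closed along lines. Applied to the matrices anticommuting
   with a preimage R of yg, this shows that they also anticommute with every
   preimage of -yg, which determines the latter from R up to a nilpotent part.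
   Applied to the families e x f with x an eigenvector of R, it shows that R has
   rank one up to a nilpotent part, with an eigencolumn depending only on y and an
   eigenrow depending only on g (or the other way around, which is the transposed
   case), and finally that R has rank one. The induced map on points preserves
   incidence with hyperplanes, so that after a change of basis it is given by a field
   automorphism. This reduces the theorem to maps fixing every yg and -yg. Such a
   map fixes all matrices of rank one, hence preserves eigenvectors, and the
   generalized eigenvectors are treated with tests of higher rank. *)

(** The map is not known to be injective, and only the matrices [d y g] with [d = 1] or [d = -1] and
    [g y = 1] are known to be values. Affine families are not carried to affine families, so each
    argument keeps one family on one side and rewrites the conditions from the other side as
    relations with all preimages of suitable matrices; in this form they are polynomial along lines.
    The alternative [A y = 0] and [g A = 0] means being related to both [y g] and [-y g], which is
    why opposite matrices appear throughout. Nilpotent parts persist because an anticommutant does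
    not determine the coefficient of [R - R^3]; they are removed later, with orthogonal idempotents
    as tests. In the last reduction rank-one tests are inconclusive in two situations: for a Jordan
    block of size two with nonzero eigenvalue, where [A x] lies in the span of [x] and [A^2 x], and
    on the generalized kernel, where a multiple of [A^2 x] stays undetermined. The tests of higher
    rank must themselves be known to be fixed, which holds for matrices determined by their
    eigenvectors. *)

Section Pairing.
Variables (F : fieldType) (n : nat).
Implicit Types (A B : 'M[F]_n) (x y : 'cV[F]_n) (f g : 'rV[F]_n).

Definition br f x : F := (f *m x) 0 0.

Lemma mul_rc f x : f *m x = (br f x)%:M.
Proof. by apply/matrixP=> i j; rewrite !ord1 /br !mxE eqxx mulr1n. Qed.

Lemma mul_crc x f y : x *m f *m y = br f y *: x.
Proof. by rewrite -mulmxA mul_rc mul_mx_scalar. Qed.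

Lemma mul_rcr f x g : f *m (x *m g) = br f x *: g.
Proof. by rewrite mulmxA mul_rc mul_scalar_mx. Qed.

Lemma mul_crcr x f y g : x *m f *m (y *m g) = br f y *: (x *m g).
Proof. by rewrite mulmxA mul_crc scalemxAl. Qed.

Lemma brDl f g x : br (f + g) x = br f x + br g x.
Proof. by rewrite /br mulmxDl mxE. Qed.
Lemma brDr f x y : br f (x + y) = br f x + br f y.
Proof. by rewrite /br mulmxDr mxE. Qed.
Lemma brNl f x : br (- f) x = - br f x.
Proof. by rewrite /br mulNmx mxE. Qed.
Lemma brNr f x : br f (- x) = - br f x.
Proof. by rewrite /br mulmxN mxE. Qed.
Lemma brZl a f x : br (a *: f) x = a * br f x.
Proof. by rewrite /br -scalemxAl mxE. Qed.
Lemma brZr a f x : br f (a *: x) = a * br f x.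
Proof. by rewrite /br -scalemxAr mxE. Qed.
Lemma br0l x : br 0 x = 0.
Proof. by rewrite /br mul0mx mxE. Qed.
Lemma br0r f : br f 0 = 0.
Proof. by rewrite /br mulmx0 mxE. Qed.
Lemma brA f A x : br (f *m A) x = br f (A *m x).
Proof. by rewrite /br mulmxA. Qed.
Lemma br_tr f x : br x^T f^T = br f x.
Proof. by rewrite /br -trmx_mul mxE. Qed.

Lemma entD m p (A B : 'M[F]_(m, p)) i j : (A + B) i j = A i j + B i j.
Proof. by rewrite mxE. Qed.
Lemma entN m p (A : 'M[F]_(m, p)) i j : (- A) i j = - A i j.
Proof. by rewrite mxE. Qed.
Lemma entZ m p a (A : 'M[F]_(m, p)) i j : (a *: A) i j = a * A i j.
Proof. by rewrite mxE. Qed.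
Lemma ent0 m p i j : (0 : 'M[F]_(m, p)) i j = 0.
Proof. by rewrite mxE. Qed.
Lemma entO x f i j : (x *m f) i j = x i 0 * f 0 j.
Proof. by rewrite mxE big_ord1. Qed.

End Pairing.

Definition brE := (brDl, brDr, brNl, brNr, brZl, brZr, br0l, br0r).
Definition entE := (entD, entN, entZ, ent0).
Lemma lc1_subproof (V : zmodType) (a b l r : V) : l = r -> a - b = l - r -> a = b.
Proof. by move=> ->; rewrite subrr => /eqP; rewrite subr_eq0 => /eqP. Qed.
Lemma lc2_subproof (V : zmodType) (a b l r l' r' : V) :
  l = r -> l' = r' -> a - b = l - r + (l' - r') -> a = b.
Proof. by move=> -> ->; rewrite !subrr addr0 => /eqP; rewrite subr_eq0 => /eqP. Qed.
Lemma lcs3_subproof (V : pzRingType) (c a b l r c' l' r' c'' l'' r'' : V) :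
  l = r -> l' = r' -> l'' = r'' ->
  a - b = c * (l - r) + c' * (l' - r') + c'' * (l'' - r'') -> a = b.
Proof. by move=> -> -> ->; rewrite !subrr !mulr0 !addr0 => /eqP; rewrite subr_eq0 => /eqP. Qed.
Lemma lcs2_subproof (V : pzRingType) (c a b l r c' l' r' : V) : l = r -> l' = r' ->
  a - b = c * (l - r) + c' * (l' - r') -> a = b.
Proof. by move=> -> ->; rewrite !subrr !mulr0 addr0 => /eqP; rewrite subr_eq0 => /eqP. Qed.
Lemma lcs_subproof (V : pzRingType) (c a b l r : V) : l = r -> a - b = c * (l - r) -> a = b.
Proof. by move=> ->; rewrite subrr mulr0 => /eqP; rewrite subr_eq0 => /eqP. Qed.

(* [lc H] proves an equation which is, up to ring normalization, [H] itself;
   [N] reverses [H], a prefix [m] works entrywise on matrices, a suffix [2]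
   adds two hypotheses and [s] takes explicit coefficients. *)
Ltac mring := apply/matrixP=> ? ?; rewrite ?(entD, entN, entZ, ent0); ring.
Ltac moring := apply/matrixP=> ? ?; rewrite ?(entD, entN, entZ, ent0, entO); ring.
Ltac lc H := apply: (lc1_subproof H); ring.
Ltac lcN H := apply: (lc1_subproof (esym H)); ring.
Ltac lc2 H K := apply: (lc2_subproof H K); ring.
Ltac lcs c H := apply: (@lcs_subproof _ c _ _ _ _ H); ring.
Ltac lcs2 c H c' H' := apply: (@lcs2_subproof _ c _ _ _ _ c' _ _ H H'); ring.
Ltac lcs3 c H c' H' c'' H'' :=
  apply: (@lcs3_subproof _ c _ _ _ _ c' _ _ c'' _ _ H H' H''); ring.
Ltac mlc H := apply: (lc1_subproof H); mring.
Ltac mlcN H := apply: (lc1_subproof (esym H)); mring.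
Ltac mlc2 H K := apply: (lc2_subproof H K); mring.

(** * The relation: the Jordan product is idempotent *)

Section Relation.
Variables (F : numClosedFieldType) (n : nat).
Implicit Types (A B T : 'M[F]_n) (x y : 'cV[F]_n) (f g h : 'rV[F]_n) (d : F).

(* Twice the Jordan product: [A o B] is idempotent iff [jp A B] squares to
   twice itself. *)
Definition jp A B : 'M[F]_n := A *m B + B *m A.
Definition jrel A B : Prop := jp A B *m jp A B = 2%:R *: jp A B.
Definition ant A B : Prop := jp A B = 0.
Definition sgn d : Prop := d = 1 \/ d = -1.

Lemma neq0_ent m p (A : 'M[F]_(m, p)) : A != 0 -> exists i, exists j, A i j != 0.
Proof.
move=> A0; apply: contrapT => h; move/eqP: A0; apply; apply/matrixP=> i j.
by rewrite mxE; apply: contrapT => /eqP Aij; apply: h; exists i, j.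
Qed.

Lemma two_neq0 : 2%:R != 0 :> F. Proof. by rewrite pnatr_eq0. Qed.

Lemma sgn_sq d : sgn d -> d * d = 1.
Proof. by case=> ->; rewrite ?mulrNN mulr1. Qed.
Lemma sgn_neq0 d : sgn d -> d != 0.
Proof. by case=> ->; rewrite ?oppr_eq0 oner_eq0. Qed.
Lemma sgnN d : sgn d -> sgn (- d).
Proof. by case=> ->; [right | left; rewrite opprK]. Qed.
Lemma sgn1 : sgn 1. Proof. by left. Qed.
Lemma sgn_opp d : sgn d -> - d != d.
Proof.
move=> sd; rewrite -subr_eq0 -opprD oppr_eq0 -mulr2n -mulr_natl mulf_neq0 //.
  exact: two_neq0.
exact: sgn_neq0.
Qed.

Lemma jpC A B : jp A B = jp B A. Proof. exact: addrC. Qed.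
Lemma jpDr A B T : jp A (B + T) = jp A B + jp A T.
Proof. by rewrite /jp mulmxDr mulmxDl addrACA. Qed.
Lemma jpZr A a B : jp A (a *: B) = a *: jp A B.
Proof. by rewrite /jp -scalemxAr -scalemxAl scalerDr. Qed.
Lemma jpDl A B T : jp (A + B) T = jp A T + jp B T.
Proof. by rewrite !(jpC _ T) jpDr. Qed.
Lemma jpZl A a B : jp (a *: A) B = a *: jp A B.
Proof. by rewrite !(jpC _ B) jpZr. Qed.
Lemma jpNr A B : jp A (- B) = - jp A B.
Proof. by rewrite -scaleN1r jpZr scaleN1r. Qed.
Lemma jpNl A B : jp (- A) B = - jp A B.
Proof. by rewrite -scaleN1r jpZl scaleN1r. Qed.
Lemma jp0r A : jp A 0 = 0. Proof. by rewrite /jp mulmx0 mul0mx addr0. Qed.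
Lemma jp_tr A B : jp A^T B^T = (jp A B)^T.
Proof. by rewrite /jp linearD /= !trmx_mul addrC. Qed.

Lemma relC A B : jrel A B <-> jrel B A.
Proof. by rewrite /jrel jpC. Qed.
Lemma rel_tr A B : jrel A^T B^T <-> jrel A B.
Proof.
rewrite /jrel jp_tr -trmx_mul -[2%:R *: _^T]linearZ /=; split=> [E|->] //.
exact: trmx_inj.
Qed.
Lemma relNN A B : jrel (- A) (- B) <-> jrel A B.
Proof. by rewrite /jrel jpNl jpNr opprK. Qed.
Lemma ant_rel A B : ant A B -> jrel A B.
Proof. by rewrite /jrel => ->; rewrite mulmx0 scaler0. Qed.
Lemma antZ A B a : ant A B -> ant A (a *: B).
Proof. by rewrite /ant jpZr => ->; rewrite scaler0. Qed.

Lemma rel_ant A B : jrel A B -> jrel A (2%:R *: B) -> ant A B.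
Proof.
rewrite /jrel /ant jpZr => E; rewrite -scalemxAl -scalemxAr E => E2.
apply/eqP; move/eqP: E2; rewrite -subr_eq0 !scalerA -scalerBl scaler_eq0.
case/orP=> // /eqP Z; have : 2%:R * 2%:R = 0 :> F by rewrite -Z; ring.
by move/eqP; rewrite mulf_eq0 (negPf two_neq0).
Qed.

Lemma outer_eq0 x f : x *m f = 0 -> x = 0 \/ f = 0.
Proof.
move=> E; have [->|/neq0_ent [i [j0]]] := eqVneq x 0; first by left.
rewrite ord1 => xi; right; apply/rowP=> j; rewrite mxE.
move/matrixP: E => /(_ i j); rewrite entO mxE => /eqP.
by rewrite mulf_eq0 (negPf xi) => /eqP.
Qed.

Lemma ex_br1 x : x != 0 -> exists f, br f x = 1.
Proof.
case/neq0_ent=> i [j]; rewrite ord1 => xi.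
exists ((x i 0)^-1 *: delta_mx 0 i); rewrite brZl /br -rowE mxE.
by rewrite mulVf.
Qed.


Lemma col_ext A B : (forall x, A *m x = B *m x) -> A = B.
Proof.
move=> h; apply/matrixP=> i j.
by have := h (delta_mx j 0); rewrite -!colE => /colP /(_ i); rewrite !mxE.
Qed.
Lemma row_ext A B : (forall f, f *m A = f *m B) -> A = B.
Proof.
move=> h; apply/matrixP=> i j.
by have := h (delta_mx 0 i); rewrite -!rowE => /rowP /(_ j); rewrite !mxE.
Qed.

(** The rows normalized on [y] span all rows: any [f] becomes normalized after adding a multiple of
    a fixed [h0]. *)
Lemma row_ext1 y A B : y != 0 ->
  (forall h, br h y = 1 -> h *m A = h *m B) -> A = B.
Proof.
move=> /ex_br1 [h0 h0y] E; apply: row_ext => f.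
have := E (f + (1 - br f y) *: h0); rewrite brDl brZl h0y mulr1 addrC subrK.
by move=> /(_ erefl); rewrite !mulmxDl -!scalemxAl (E _ h0y) => /addIr.
Qed.

Lemma outer_jp y g B d :
  jp (d *: (y *m g)) B = d *: (y *m (g *m B) + (B *m y) *m g).
Proof. by rewrite jpZl /jp !mulmxA. Qed.

(** The scalar [s = g B y] splits the argument. If [s] differs from [d], both [B y - s y] and
    [g B - s g] vanish, and then [s = 0]. If [s = d], the relation factors as
    [(B y - d y)(g B - d g) = 0], an outer product, so one factor vanishes. *)
Lemma rel_outerP y g B d : br g y = 1 -> sgn d ->
  jrel (d *: (y *m g)) B <->
  [\/ B *m y = d *: y, g *m B = d *: g | B *m y = 0 /\ g *m B = 0].
Proof.
move=> gy sd; have dd := sgn_sq sd; have d0 := sgn_neq0 sd.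
rewrite /jrel outer_jp; set u := B *m y; set k := g *m B.
have ku : br k y = br g u by rewrite /k /u brA.
set s := br g u in ku; set M := y *m k + u *m g.
have MM : M *m M = s *: (y *m k) + br k u *: (y *m g) + u *m k + s *: (u *m g).
  rewrite /M mulmxDl !mulmxDr !mul_crcr ku gy scale1r -/s.
  by rewrite !addrA.
have -> : (d *: M) *m (d *: M) = M *m M.
  by rewrite -scalemxAl -scalemxAr scalerA dd scale1r.
rewrite scalerA MM; split; last first.
  case=> [uE|kE|[uE kE]].
  - have sE : s = d by rewrite /s uE brZr gy mulr1.
    rewrite /M uE brZr ku sE dd scale1r.
    apply/matrixP=> i j; rewrite !(entO, entE); lcs (- (y i 0 * g 0 j)) dd.
  - have sE : s = d by rewrite -ku kE brZl gy mulr1.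
    rewrite /M kE brZl -/s sE dd scale1r.
    apply/matrixP=> i j; rewrite !(entO, entE); lcs (- (y i 0 * g 0 j)) dd.
  - by rewrite /M uE kE !(mulmx0, mul0mx, br0r, br0l, scaler0, scale0r, addr0).
move=> E.
have Ey : (s * s + br k u) *: y + (2%:R * s) *: u = (2%:R * d) *: (s *: y + u).
  have E' := congr1 (mulmx^~ y) E; move: E'; rewrite /M.
  rewrite -!(scalemxAl, mulmxDl) !mulmxDl -!scalemxAl !mul_crc ku gy => E'.
  mlc E'.
have Eg : (s * s + br k u) *: g + (2%:R * s) *: k = (2%:R * d) *: (k + s *: g).
  have := congr1 (mulmx g) E; rewrite /M.
  rewrite !mulmxDr -!scalemxAr !mulmxDr !mul_rcr gy -/s => E'.
  mlc E'.
have Es : br k u = 4%:R * d * s - 3%:R * s * s.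
  by move: (congr1 (br g) Ey); rewrite !brE gy -/s => Es; lc Es.
have E1 : (2%:R * (d - s)) *: (u - s *: y) = 0.
  by move: Ey; rewrite Es => Ey; mlcN Ey.
have E2 : (2%:R * (d - s)) *: (k - s *: g) = 0.
  by move: Eg; rewrite Es => Eg; mlcN Eg.
have [sE|sd'] := eqVneq s d; last first.
  have c0 : 2%:R * (d - s) != 0.
    by rewrite mulf_neq0 ?two_neq0 // subr_eq0 eq_sym.
  move/eqP: E1; rewrite scaler_eq0 (negPf c0) /= subr_eq0 => /eqP uE.
  move/eqP: E2; rewrite scaler_eq0 (negPf c0) /= subr_eq0 => /eqP kE.
  have s0 : s = 0.
    move: Es; rewrite kE brZl -/s => Es.
    have /eqP : (4%:R * s) * (s - d) = 0 by lc Es.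
    by rewrite !mulf_eq0 pnatr_eq0 /= subr_eq0 (negPf sd') orbF => /eqP.
  by apply: Or33; rewrite uE kE s0 !scale0r.
rewrite sE in E Es.
have Es1 : br k u = 1 by rewrite Es; lc dd.
have : (u - d *: y) *m (k - d *: g) = 0.
  rewrite mulmxDl !mulmxDr !mulNmx !mulmxN -!scalemxAl -!scalemxAr scalerA dd.
  move: E; rewrite Es1 /M => E; mlc E.
case/outer_eq0 => /eqP; rewrite subr_eq0 => /eqP; [exact: Or31 | exact: Or32].
Qed.

End Relation.

(** * Consequences of the trichotomy, and irreducibility of affine families *)

Section Basics.
Variables (F : numClosedFieldType) (n : nat).
Implicit Types (A B T M : 'M[F]_n) (x y z : 'cV[F]_n) (f g h : 'rV[F]_n) (d : F).

Lemma br1_neq0r f x : br f x = 1 -> x != 0.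
Proof. by apply: contra_eq_neq => ->; rewrite br0r eq_sym oner_neq0. Qed.
Lemma br1_neq0l f x : br f x = 1 -> f != 0.
Proof. by apply: contra_eq_neq => ->; rewrite br0l eq_sym oner_neq0. Qed.


Lemma ex_br1l f : f != 0 -> exists x, br f x = 1.
Proof.
move=> f0; have [|x hx] := @ex_br1 F n f^T; first by rewrite trmx_eq0.
by exists x^T; rewrite -br_tr trmxK.
Qed.

Lemma scale_eq (d : F) x y : d != 0 -> d *: x = d *: y -> x = y.
Proof. by move=> d0 /(congr1 (fun z => d^-1 *: z)); rewrite !scalerA mulVf // !scale1r. Qed.

(** The alternative of [rel_outerP] may vary with [h]. If [B y = 0], only [h B = 0] is possible, for
    every [h]. If [B y] is neither [0] nor [d y], only [h B = d h] remains, so [B] is the scalar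
    [d], which contradicts [B y <> d y]. *)
Lemma rel_row y B d : y != 0 -> sgn d ->
  (forall h, br h y = 1 -> jrel (d *: (y *m h)) B) -> B *m y = d *: y \/ B = 0.
Proof.
move=> y0 sd H; have d0 := sgn_neq0 sd.
have [|/eqP By] := eqVneq (B *m y) (d *: y); first by left.
right; have [By0|/eqP By0] := eqVneq (B *m y) 0.
- apply: (row_ext1 y0) => h hy; rewrite mulmx0.
  case/(rel_outerP _ hy sd): (H h hy) => [//|hB|[]//].
  have : br (h *m B) y = 0 by rewrite brA By0 br0r.
  by rewrite hB brZl hy mulr1 => /eqP; rewrite (negPf d0).
- suff E : B = d%:M by case: By; rewrite E mul_scalar_mx.
  apply: (row_ext1 y0) => h hy; rewrite mul_mx_scalar.
  by case/(rel_outerP _ hy sd): (H h hy) => [//|//|[]//].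
Qed.

Lemma rel_rowP y B d h : sgn d -> br h y = 1 -> B *m y = d *: y ->
  jrel (d *: (y *m h)) B.
Proof. by move=> sd hy E; apply/rel_outerP => //; apply: Or31. Qed.
Lemma rel_colP y B d h : sgn d -> br h y = 1 -> h *m B = d *: h ->
  jrel (d *: (y *m h)) B.
Proof. by move=> sd hy E; apply/rel_outerP => //; apply: Or32. Qed.

Lemma outer_tr y g d : (d *: (y *m g))^T = d *: (g^T *m y^T) :> 'M[F]_n.
Proof. by rewrite linearZ /= trmx_mul. Qed.

Lemma rel_col g B d : g != 0 -> sgn d ->
  (forall y, br g y = 1 -> jrel (d *: (y *m g)) B) -> g *m B = d *: g \/ B = 0.
Proof.
move=> g0 sd H; have [||h hy|E|E] := @rel_row g^T B^T d.
- by rewrite trmx_eq0.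
- by [].
- rewrite -[h]trmxK -outer_tr; apply/rel_tr; apply: H.
  by rewrite -br_tr trmxK.
- by left; apply: trmx_inj; rewrite trmx_mul E linearZ.
- by right; apply: trmx_inj; rewrite E trmx0.
Qed.

Lemma rel_orth d d' y g z h : sgn d -> br g y = 1 -> br h y = 0 -> br g z = 0 ->
  jrel (d *: (y *m g)) (d' *: (z *m h)).
Proof.
move=> sd gy hy gz; apply/rel_outerP => //; apply: Or33.
by rewrite -scalemxAl mul_crc hy -scalemxAr mul_rcr gz !scale0r !scaler0.
Qed.

(** With opposite signs the first alternative gives [y = -(h y) z]; applying [h] yields [h y = 0],
    hence [y = 0]. The second is excluded symmetrically, so only orthogonality remains. *)
Lemma rel_opp d y g z h : sgn d -> br g y = 1 -> br h z = 1 ->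
  jrel (d *: (y *m g)) (- d *: (z *m h)) -> br h y = 0 /\ br g z = 0.
Proof.
move=> sd gy hz; have d0 := sgn_neq0 sd; case/(rel_outerP _ gy sd).
- rewrite -scalemxAl mul_crc => E; exfalso.
  have E1 : y = - br h y *: z.
    by apply: (scale_eq d0); rewrite -E; mring.
  have : br h y = 0.
    have := congr1 (br h) E1; rewrite brZr hz mulr1 => /eqP.
    by rewrite -subr_eq0 opprK -mulr2n mulrn_eq0 => /eqP.
  by move=> hy; move: gy; rewrite E1 hy oppr0 scale0r br0r => /eqP; rewrite eq_sym oner_eq0.
- rewrite -scalemxAr mul_rcr => E; exfalso.
  have E1 : g = - br g z *: h.
    by apply: trmx_inj; apply: (scale_eq d0); rewrite -!linearZ /= -E; congr (_^T); mring.
  have : br g z = 0.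
    have := congr1 (fun k : 'rV_n => br k z) E1; rewrite brZl hz mulr1 => /eqP.
    by rewrite -subr_eq0 opprK -mulr2n mulrn_eq0 => /eqP.
  by move=> gz; move: gy; rewrite E1 gz oppr0 scale0r br0l => /eqP; rewrite eq_sym oner_eq0.
- rewrite -scalemxAl -scalemxAr mul_crc mul_rcr => -[/eqP E1 /eqP E2].
  move: E1 E2; rewrite !scaler_eq0 !oppr_eq0 (negPf d0) /= (negPf (br1_neq0r hz)) (negPf (br1_neq0l hz)) !orbF.
  by move=> /eqP-> /eqP->.
Qed.

(* Weak form of Zariski closedness, along lines. *)
Definition lclosed (P : 'M[F]_n -> Prop) :=
  forall A B, (forall t, P (A + t *: B)) \/
    exists s : seq F, forall t, P (A + t *: B) -> t \in s.

Lemma ex_notin (s : seq F) : exists t, t \notin s.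
Proof.
apply: contrapT => h.
have sub : {subset [seq i%:R | i <- iota 0 (size s).+1] <= s}.
  by move=> t _; apply: contrapT => /negP ts; apply: h; exists t.
have := uniq_leq_size _ sub; rewrite size_map size_iota ltnn map_inj_uniq ?iota_uniq.
  by move=> /(_ isT).
by move=> i j /eqP; rewrite eqr_nat => /eqP.
Qed.

Lemma roots_finite (p : {poly F}) : p != 0 -> exists s : seq F, forall t, root p t -> t \in s.
Proof.
move=> p0; have [s E] := closed_field_poly_normal p; exists s => t.
rewrite E rootZ ?lead_coef_eq0 // root_prod_XsubC //.
Qed.

(** Along a line the relation is a system of equations of degree at most two in [t]: either all of
    them are trivial or one of them has finitely many roots. *)
Lemma lclosed_rel T : lclosed (jrel T).
Proof.
move=> A B; pose a := jp T A; pose b := jp T B.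
pose p i j : {poly F} := ((a *m a - 2%:R *: a) i j)%:P
  + ((a *m b + b *m a - 2%:R *: b) i j)%:P * 'X + ((b *m b) i j)%:P * ('X * 'X).
have pE i j t : (p i j).[t] = (jp T (A + t *: B) *m jp T (A + t *: B) - 2%:R *: jp T (A + t *: B)) i j.
  rewrite jpDr jpZr /p -/a -/b !(hornerD, hornerM, hornerC, hornerX); clearbody a b; rewrite !mulmxDl !mulmxDr -!scalemxAl -!scalemxAr.
  by rewrite !entE; ring.
have [h|h] := pselect (forall i j, p i j = 0).
  left=> t; rewrite /jrel; apply/eqP; rewrite -subr_eq0; apply/eqP/matrixP=> i j.
  by rewrite -pE h horner0 mxE.
right; have [i [j pij]] : exists i, exists j, p i j != 0.
  by apply: contrapT => h'; apply: h => i j; apply: contrapT => /eqP ?; apply: h'; exists i, j.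
have [s hs] := roots_finite pij; exists s => t ht; apply: hs.
by rewrite /root pE ht subrr mxE.
Qed.

Lemma lclosed_all I (P : I -> 'M[F]_n -> Prop) :
  (forall i, lclosed (P i)) -> lclosed (fun A => forall i, P i A).
Proof.
move=> h A B; have [H|H] := pselect (forall i t, P i (A + t *: B)).
  by left=> t i.
right; have [i Hi] : exists i, ~ forall t, P i (A + t *: B).
  by apply: contrapT => H'; apply: H => i; apply: contrapT => ?; apply: H'; exists i.
by case: (h i A B) => [//|[s hs]]; exists s => t /(_ i); apply: hs.
Qed.

Lemma lclosed_imp (Q : Prop) (P : 'M[F]_n -> Prop) :
  (Q -> lclosed P) -> lclosed (fun A => Q -> P A).
Proof.
move=> h A B; have [q|q] := pselect Q; last by left.
by case: (h q A B) => [H|[s hs]]; [left|right; exists s => t /(_ q); apply: hs].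
Qed.

Definition affine (U : 'M[F]_n -> Prop) :=
  forall A B t, U A -> U B -> U (A + t *: (B - A)).

(** On the line joining a point outside [P1] to a point outside [P2], all but finitely many points
    avoid both; the line from such a point [D] to a point outside [P3] then contains a point
    avoiding all three. *)
Lemma irreducible (U P1 P2 P3 : 'M[F]_n -> Prop) : affine U ->
  lclosed P1 -> lclosed P2 -> lclosed P3 ->
  (forall A, U A -> [\/ P1 A, P2 A | P3 A]) ->
  [\/ forall A, U A -> P1 A, forall A, U A -> P2 A | forall A, U A -> P3 A].
Proof.
move=> aU c1 c2 c3 H; apply: contrapT => no.
have n1 : ~ forall A, U A -> P1 A by move=> h; apply: no; apply: Or31.
have n2 : ~ forall A, U A -> P2 A by move=> h; apply: no; apply: Or32.
have n3 : ~ forall A, U A -> P3 A by move=> h; apply: no; apply: Or33.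
have ex (P : 'M[F]_n -> Prop) : ~ (forall A, U A -> P A) -> exists A, U A /\ ~ P A.
  move=> nP; apply: contrapT => h; apply: nP => A UA; apply: contrapT => ?.
  by apply: h; exists A.
have [A [UA nA]] := ex _ n1; have [B [UB nB]] := ex _ n2; have [C [UC nC]] := ex _ n3.
have fin0 (P : 'M[F]_n -> Prop) (X Y : 'M[F]_n) : lclosed P -> ~ P X ->
    exists s : seq F, forall t, P (X + t *: (Y - X)) -> t \in s.
  move=> cP nX; case: (cP X (Y - X)) => // /(_ 0); rewrite scale0r addr0 //.
have fin1 (P : 'M[F]_n -> Prop) (X Y : 'M[F]_n) : lclosed P -> ~ P Y ->
    exists s : seq F, forall t, P (X + t *: (Y - X)) -> t \in s.
  by move=> cP nX; case: (cP X (Y - X)) => // /(_ 1); rewrite scale1r addrC subrK.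
have [s1 h1] := fin0 P1 A B c1 nA; have [s2 h2] := fin1 P2 A B c2 nB.
have [t] := ex_notin (s1 ++ s2); rewrite mem_cat negb_or => /andP [t1 t2].
set D := A + t *: (B - A) in h1 h2.
have nD1 : ~ P1 D by move/h1; apply/negP.
have nD2 : ~ P2 D by move/h2; apply/negP.
have UD : U D by apply: aU.
have [r1 k1] := fin0 P1 D C c1 nD1; have [r2 k2] := fin0 P2 D C c2 nD2.
have [r3 k3] := fin1 P3 D C c3 nC.
have [u] := ex_notin (r1 ++ r2 ++ r3); rewrite !mem_cat !negb_or => /and3P [u1 u2 u3].
by case: (H _ (aU D C u UD UC)) => [/k1|/k2|/k3]; apply/negP.
Qed.

Definition lin (U : 'M[F]_n -> Prop) := forall A B t, U A -> U B -> U (A + t *: B).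

Lemma affine_row (e : F) y : affine (fun A => exists2 h, br h y = 1 & A = e *: (y *m h)).
Proof.
move=> A B t [h hy ->] [k ky ->]; exists (h + t *: (k - h)); first by rewrite !brE hy ky; ring.
by moring.
Qed.
Lemma affine_col (e : F) g : affine (fun A => exists2 y, br g y = 1 & A = e *: (y *m g)).
Proof.
move=> A B t [y yg ->] [z zg ->]; exists (y + t *: (z - y)); first by rewrite !brE yg zg; ring.
by moring.
Qed.
Lemma antD A B C : ant A B -> ant A C -> ant A (B + C).
Proof. by rewrite /ant jpDr => -> ->; rewrite addr0. Qed.
Lemma affine_ant A : affine (ant A).
Proof. by move=> B C t hB hC; apply: antD => //; apply: antZ; apply: antD => //; rewrite -scaleN1r; apply: antZ. Qed.
End Basics.

(** * Preservers *)

Section Preservers.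
Variables (F : numClosedFieldType) (n : nat).
Implicit Types (A B T M : 'M[F]_n) (x y z : 'cV[F]_n) (f g h : 'rV[F]_n) (d : F).
Implicit Types phi : 'M[F]_n -> 'M[F]_n.

(** Nothing is said about uniqueness of preimages, so later statements quantify over every [R] with
    [phi R = d y g]. *)
Definition pres phi :=
  (forall A B, jrel A B <-> jrel (phi A) (phi B)) /\
  (forall d y g, sgn d -> br g y = 1 -> exists A, phi A = d *: (y *m g)).

Lemma pres_trl phi : pres phi -> pres (fun X => (phi X)^T).
Proof.
move=> [h1 h2]; split=> [A B|d y g sd gy]; first by rewrite rel_tr.
have [|A E] := h2 d g^T y^T sd; first by rewrite br_tr.
by exists A; rewrite E outer_tr !trmxK.
Qed.
Lemma pres_trr phi : pres phi -> pres (fun X => phi X^T).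
Proof.
move=> [h1 h2]; split=> [A B|d y g sd gy]; first by rewrite -h1 rel_tr.
by have [A E] := h2 d y g sd gy; exists A^T; rewrite trmxK.
Qed.
Lemma pres_oppr phi : pres phi -> pres (fun X => phi (- X)).
Proof.
move=> [h1 h2]; split=> [A B|d y g sd gy]; first by rewrite -h1 relNN.
by have [A E] := h2 d y g sd gy; exists (- A); rewrite opprK.
Qed.

Lemma nilpotent_of_eigen A : (forall x a, x != 0 -> A *m x = a *: x -> a = 0) ->
  exists k, A ^+ k = 0.
Proof.
case: n A => [|k] A h; first by exists 0%N; apply/matrixP=> -[].
(* [eigenvalue] speaks of row vectors, hence the transpose. *)
pose B := A^T.
have trX j : (B ^+ j)^T = A ^+ j.
  by elim: j => [|j IH]; [rewrite trmx1 | rewrite exprSr exprS -mulmxE trmx_mul IH trmxK].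
have [s E] := closed_field_poly_normal (char_poly B).
have s0 a : a \in s -> a = 0.
  move=> as_; have : root (char_poly B) a.
    by rewrite E rootZ ?lead_coef_eq0 ?monic_neq0 ?char_poly_monic // root_prod_XsubC.
  rewrite -eigenvalue_root_char => /eigenvalueP [v vA v0].
  apply: (h v^T); first by rewrite trmx_eq0.
  by apply: trmx_inj; rewrite trmx_mul trmxK vA linearZ /= trmxK.
exists (size s); rewrite -trX; have := Cayley_Hamilton B; rewrite E.
rewrite (monicP (char_poly_monic _)) scale1r.
have -> : \prod_(z <- s) ('X - z%:P) = 'X^(size s).
  rewrite (eq_big_seq (fun _ => 'X)) ?big_const_seq ?count_predT ?iter_mulr_1 //.
  by move=> a /s0 ->; rewrite subr0.
by rewrite rmorphXn /= horner_mx_X => ->; rewrite trmx0.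
Qed.

Lemma ex_square0 A : A != 0 -> (exists k, A ^+ k = 0) ->
  exists x, A *m x != 0 /\ A *m (A *m x) = 0.
Proof.
move=> A0 [k Ak].
have [v Av] : exists v : 'cV[F]_n, A *m v != 0.
  apply: contrapT => h; move/eqP: A0; apply; apply: col_ext => v.
  by rewrite mul0mx; apply: contrapT => /eqP ?; apply: h; exists v.
have ex : exists k, (A ^+ k *m v == 0) by exists k; rewrite Ak mul0mx.
case: (ex_minnP ex) => [[|[|j]] /eqP Ej minj].
- by move: Av; rewrite -[v]mul1mx Ej mulmx0 eqxx.
- by move: Av; rewrite -[A]expr1 Ej eqxx.
have step i : A *m (A ^+ i *m v) = A ^+ i.+1 *m v by rewrite mulmxA exprS.
exists (A ^+ j *m v); rewrite !step; split=> //.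
by apply/negP=> /minj; rewrite ltnn.
Qed.

Lemma mul_rowsub0 x y z : y != 0 ->
  (forall f, br f x = 0 -> br f z = 0 -> br f y = 0) -> exists a b, y = a *: x + b *: z.
Proof.
move=> y0 h; pose S := row_mx x z.
have [sub|nsub] := boolP (y^T <= S^T)%MS.
  have [w E] := submxP sub.
  exists (w 0 (lshift 1 0)), (w 0 (rshift 1 0)); apply: trmx_inj; rewrite E tr_row_mx.
  rewrite -[w in LHS]hsubmxK mul_row_col linearD /= !linearZ /=.
  congr (_ + _); apply/rowP=> j; rewrite !mxE big_ord1 !mxE //.
exfalso; move/negP: nsub; apply; rewrite submxE; apply/eqP.
apply/matrixP=> i j; rewrite [RHS]mxE.
pose f := (cokermx S^T *m delta_mx j (0 : 'I_1))^T.
have fS : f *m S = 0.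
  by apply: trmx_inj; rewrite trmx_mul /f trmxK mulmxA mulmx_coker mul0mx trmx0.
have fx : br f x = 0 /\ br f z = 0.
  move: fS; rewrite /S mul_mx_row -[0]hsubmxK => /eq_row_mx [E1 E2].
  by rewrite /br E1 E2 !mxE.
have := h f fx.1 fx.2.
by rewrite -br_tr /f trmxK /br mulmxA -colE mxE ord1 => ->.
Qed.

(** By [rel_ant] such an [X] is related to [A] while [2X] is not, so only [0] is related to
    everything. A nonzero eigenvalue gives [X = a^-1 x f], with [jp A X] of rank one and trace [2].
    A nilpotent [A] needs [X = x f] with [A x <> 0], [A^2 x = 0], [f x = 0] and [f A x = 2]. *)
Lemma rel_witness A : A != 0 -> exists X, jp A X != 0 /\ jrel A X.
Proof.
move=> A0.
have [h|h] := pselect (forall x a, x != 0 -> A *m x = a *: x -> a = 0); last first.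
  have [x [a [x0 Ax a0]]] : exists x a, [/\ x != 0, A *m x = a *: x & a != 0].
    apply: contrapT => h'; apply: h => x a x0 Ax; apply: contrapT => /eqP a0.
    by apply: h'; exists x, a.
  have [f fx] := ex_br1 x0.
  have E : jp A (a^-1 *: (x *m f)) = x *m (f + a^-1 *: (f *m A)).
    rewrite jpZr /jp !mulmxA Ax mulmxDr -!scalemxAl scalerDr scalerA mulVf // scale1r.
    by rewrite -scalemxAr mulmxA.
  have b2 : br (f + a^-1 *: (f *m A)) x = 2%:R.
    by rewrite !brE brA Ax brZr fx mulr1 mulVf.
  exists (a^-1 *: (x *m f)); rewrite /jrel E mul_crcr b2; split=> //.
  apply/eqP=> /(congr1 (mulmx^~ x)); rewrite mul_crc mul0mx b2 => /eqP.
  by rewrite scaler_eq0 (negPf x0) pnatr_eq0.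
have [x [Ax AAx]] := ex_square0 A0 (nilpotent_of_eigen h).
have [f [fx fAx]] : exists f, br f x = 0 /\ br f (A *m x) = 2%:R.
  apply: contrapT => hf.
  have [|a [b E]] := @mul_rowsub0 x (A *m x) 0 Ax.
    move=> f fx _; apply: contrapT => /eqP fAx; apply: hf.
    exists ((2%:R / br f (A *m x)) *: f); rewrite !brZl fx mulr0 divfK //.
  have /eqP := congr1 (mulmx A) E.
  rewrite AAx scaler0 addr0 -scalemxAr eq_sym scaler_eq0 (negPf Ax) orbF => /eqP a0.
  by move: Ax; rewrite E a0 scale0r scaler0 addr0 eqxx.
have jE : jp A (x *m f) = (A *m x) *m f + x *m (f *m A) by rewrite /jp !mulmxA.
exists (x *m f); rewrite /jrel jE; split.
  apply/eqP=> /(congr1 (mulmx^~ (A *m x))); rewrite mul0mx mulmxDl !mul_crc.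
  rewrite fAx brA AAx br0r scale0r addr0 => /eqP.
  by rewrite scaler_eq0 (negPf Ax) pnatr_eq0.
rewrite mulmxDl !mulmxDr !mul_crcr !brA fx fAx AAx br0r; mring.
Qed.

Lemma rel0r A : jrel A 0.
Proof. by apply: ant_rel; apply: jp0r. Qed.

Lemma rel_all_eq0 A : (forall X, jrel A X) -> A = 0.
Proof.
move=> h; apply: contrapT => /eqP /rel_witness [X [X0 _]].
by move/eqP: X0; apply; apply: rel_ant.
Qed.

Section Fixed.
Variable phi : 'M[F]_n -> 'M[F]_n.
Hypothesis hphi : pres phi.

Lemma relE A B : jrel A B <-> jrel (phi A) (phi B).
Proof. by case: hphi. Qed.
Lemma rel_im A B : jrel A B -> jrel (phi A) (phi B).
Proof. by rewrite -relE. Qed.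
Lemma rel_pre A B : jrel (phi A) (phi B) -> jrel A B.
Proof. by rewrite -relE. Qed.
Lemma onto d y g : sgn d -> br g y = 1 -> exists A, phi A = d *: (y *m g).
Proof. by case: hphi => _; apply. Qed.

Lemma rel0_eq0 B : (forall d y g, sgn d -> br g y = 1 -> jrel (d *: (y *m g)) B) -> B = 0.
Proof.
move=> h; apply: contrapT => /eqP B0.
have [y By] : exists y : 'cV[F]_n, B *m y != 0.
  apply: contrapT => h'; move/eqP: B0; apply; apply: col_ext => v.
  by rewrite mul0mx; apply: contrapT => /eqP ?; apply: h'; exists v.
have y0 : y != 0 by apply: contraNneq By => ->; rewrite mulmx0.
have e (d : F) : sgn d -> B *m y = d *: y.
  by move=> sd; case: (@rel_row F n y B d y0 sd) => // [k ky|E]; [apply: h|move: B0; rewrite E eqxx].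
have := e 1 (sgn1 F); rewrite (e (-1) (sgnN (sgn1 F))) => /eqP.
by rewrite -subr_eq0 -scalerBl scaler_eq0 (negPf y0) orbF -opprD oppr_eq0 -mulr2n mulrn_eq0 oner_eq0.
Qed.

Lemma pres0 : phi 0 = 0.
Proof.
apply: rel0_eq0 => d y g sd gy; have [A <-] := onto sd gy.
by apply: rel_im; apply: rel0r.
Qed.

Lemma pres_eq0 A : phi A = 0 -> A = 0.
Proof.
move=> E; apply: rel_all_eq0 => X; apply: rel_pre; rewrite E.
by apply/relC; apply: rel0r.
Qed.

Lemma pres_neq0 A : A != 0 -> phi A != 0.
Proof. by move=> A0; apply/eqP=> /pres_eq0 E; rewrite E eqxx in A0. Qed.

(** For nonzero [A] this is the condition that [phi A] has eigenvector [y] for [d], rewritten as an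
    intersection of relations on [A] itself. Only in this form is it visibly closed along lines in
    the source, since [phi] is not linear. *)
Definition row_rel d y A := forall h R, br h y = 1 -> phi R = d *: (y *m h) -> jrel R A.
Definition col_rel d g A := forall z R, br g z = 1 -> phi R = d *: (z *m g) -> jrel R A.

Lemma row_relE d y A : sgn d -> y != 0 -> A != 0 -> row_rel d y A <-> phi A *m y = d *: y.
Proof.
move=> sd y0 A0; split=> [H|E h R hy RE]; last by apply: rel_pre; rewrite RE; apply: rel_rowP.
case: (@rel_row F n y (phi A) d y0 sd) => // [h hy|/eqP E]; last by move: (pres_neq0 A0); rewrite E.
by have [R RE] := onto sd hy; rewrite -RE; apply: rel_im; apply: H hy RE.
Qed.
Lemma col_relE d g A : sgn d -> g != 0 -> A != 0 -> col_rel d g A <-> g *m phi A = d *: g.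
Proof.
move=> sd g0 A0; split=> [H|E y R hy RE]; last by apply: rel_pre; rewrite RE; apply: rel_colP.
case: (@rel_col F n g (phi A) d g0 sd) => // [h hy|/eqP E]; last by move: (pres_neq0 A0); rewrite E.
by have [R RE] := onto sd hy; rewrite -RE; apply: rel_im; apply: H hy RE.
Qed.

Lemma lclosed_row_rel d y : lclosed (row_rel d y).
Proof. by do 2!(apply: lclosed_all => ?); do 2!(apply: lclosed_imp => ?); apply: lclosed_rel. Qed.
Lemma lclosed_col_rel d g : lclosed (col_rel d g).
Proof. by do 2!(apply: lclosed_all => ?); do 2!(apply: lclosed_imp => ?); apply: lclosed_rel. Qed.

(** Encodes the third alternative for [d y g], with [B = -d y g]: a matrix annihilating [y] and
    annihilated by [g] is also related to the opposite matrix. *)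
Definition opp_rel B A := forall C, phi C = B -> jrel C A.
Lemma lclosed_opp_rel B : lclosed (opp_rel B).
Proof. by apply: lclosed_all => ?; apply: lclosed_imp => ?; apply: lclosed_rel. Qed.

Lemma rel_tri d y g R A : sgn d -> br g y = 1 -> phi R = d *: (y *m g) -> jrel R A ->
  [\/ row_rel d y A, col_rel d g A | opp_rel (- d *: (y *m g)) A].
Proof.
move=> sd gy RE; move/rel_im; rewrite RE => /(rel_outerP _ gy sd) [E|E|E].
- by apply: Or31 => h R' hy R'E; apply: rel_pre; rewrite R'E; apply: rel_rowP.
- by apply: Or32 => h R' hy R'E; apply: rel_pre; rewrite R'E; apply: rel_colP.
- apply: Or33 => C CE; apply: rel_pre; rewrite CE; apply/rel_outerP; [by []|exact: sgnN|exact: Or33].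
Qed.

Lemma rel_irr d y g R (U : 'M[F]_n -> Prop) : sgn d -> br g y = 1 ->
  phi R = d *: (y *m g) -> affine U -> (forall A, U A -> jrel R A) ->
  [\/ forall A, U A -> row_rel d y A, forall A, U A -> col_rel d g A |
      forall A, U A -> opp_rel (- d *: (y *m g)) A].
Proof.
move=> sd gy RE aU H; apply: irreducible => //.
- exact: lclosed_row_rel.
- exact: lclosed_col_rel.
- exact: lclosed_opp_rel.
- by move=> A /H; apply: rel_tri.
Qed.

Definition subA (R R' : 'M[F]_n) := forall Z, ant R Z -> ant R' Z.

(** The anticommutant of [R] is stable under doubling, and being related to both [Z] and [2Z] forces
    anticommutation. *)
Lemma sub_of_rel R R' : (forall Z, ant R Z -> jrel R' Z) -> subA R R'.
Proof. by move=> H Z hZ; apply: rel_ant; apply: H => //; apply: antZ. Qed.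

Lemma ant_tri d y g R : sgn d -> br g y = 1 -> phi R = d *: (y *m g) ->
  [\/ forall h R', br h y = 1 -> phi R' = d *: (y *m h) -> subA R R',
      forall z R', br g z = 1 -> phi R' = d *: (z *m g) -> subA R R' |
      forall C, phi C = - d *: (y *m g) -> subA R C].
Proof.
move=> sd gy RE.
case: (@rel_irr d y g R (ant R) sd gy RE (@affine_ant F n R) (@ant_rel F n R)) => H.
- by apply: Or31 => h R' hy R'E; apply: sub_of_rel => Z hZ; apply: H hZ _ _ hy R'E.
- by apply: Or32 => h R' hy R'E; apply: sub_of_rel => Z hZ; apply: H hZ _ _ hy R'E.
- by apply: Or33 => C CE; apply: sub_of_rel => Z hZ; apply: H hZ _ CE.
Qed.

End Fixed.
End Preservers.

(** * Anticommutants *)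

Section Anticommutant.
Variables (F : numClosedFieldType) (n : nat).
Implicit Types (A B C D M N R Z p q : 'M[F]_n) (k x y z : 'cV[F]_n) (l f g h : 'rV[F]_n).

Lemma mul_delta A B i j (k l : 'I_n) : (A *m delta_mx i j *m B) k l = A k i * B j l.
Proof.
by rewrite -(mul_delta_mx (0 : 'I_1)) !mulmxA -colE -mulmxA -rowE mxE big_ord1 !mxE.
Qed.

(** The hypothesis is an equality of the tensors [A] by [B] and [C] by [D]; matrix units in place of
    [M] isolate products of single entries. *)
Lemma tensor_eq A B C D : B != 0 -> C != 0 ->
  (forall M, A *m M *m B = C *m M *m D) -> exists c, A = c *: C /\ D = c *: B.
Proof.
move=> /neq0_ent [j [l Bjl]] /neq0_ent [k [i Cki]] H.
have E i1 i2 i3 i4 : A i3 i1 * B i2 i4 = C i3 i1 * D i2 i4.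
  by rewrite -!mul_delta H.
have AE : A = (D j l / B j l) *: C.
  by apply/matrixP=> a b; rewrite mxE mulrAC -[D j l * _]mulrC -E mulfK.
exists (D j l / B j l); split=> //; apply/matrixP=> a b; rewrite mxE.
apply: (mulfI Cki); rewrite -E {1}AE mxE; ring.
Qed.

Lemma sandwich_eq0 A B : (forall M, A *m M *m B = 0) -> A = 0 \/ B = 0.
Proof.
move=> H; have [->|/neq0_ent [j [l Bjl]]] := eqVneq B 0; first by right.
left; apply/matrixP=> a b; rewrite mxE; apply: (mulIf Bjl).
by rewrite mul0r -mul_delta H mxE.
Qed.

Lemma addrr_inj0 (V : lmodType F) (Z : V) : Z + Z = 0 -> Z = 0.
Proof.
move=> E; have : 2%:R *: Z = 0 by rewrite scaler_nat.
by move/eqP; rewrite scaler_eq0 pnatr_eq0 => /eqP.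
Qed.


Section Cubic.
Variable R : 'M[F]_n.
Hypothesis R4 : R *m R *m (R *m R) = R *m R.
Let R2 := R *m R.
Let R3 := R *m R *m R.
Let p := R2 + R3.
Let q := R2 - R3.

Lemma cub_RR3 : R *m R3 = R2. Proof. by rewrite /R3 /R2 -[RHS]R4 !mulmxA. Qed.
Lemma cub_R3R : R3 *m R = R2. Proof. by rewrite /R3 /R2 -[RHS]R4 !mulmxA. Qed.
Lemma cub_R2R : R2 *m R = R3. Proof. by []. Qed.
Lemma cub_RR2 : R *m R2 = R3. Proof. by rewrite /R2 mulmxA. Qed.
Lemma cub_Rp : R *m p = p. Proof. by rewrite mulmxDr cub_RR2 cub_RR3 addrC. Qed.
Lemma cub_pR : p *m R = p. Proof. by rewrite mulmxDl cub_R2R cub_R3R addrC. Qed.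
Lemma cub_Rq : R *m q = - q. Proof. by rewrite mulmxBr cub_RR2 cub_RR3 opprB. Qed.
Lemma cub_qR : q *m R = - q. Proof. by rewrite mulmxBl cub_R2R cub_R3R opprB. Qed.
Lemma cub_pp : p *m p = p + p.
Proof. by rewrite {1}/p mulmxDl /R3 -!mulmxA !cub_Rp. Qed.
Lemma cub_ant_pq M : ant R (p *m M *m q) /\ ant R (q *m M *m p).
Proof.
split; rewrite /ant /jp !mulmxA.
  by rewrite cub_Rp -[p *m M *m q *m R]mulmxA cub_qR mulmxN subrr.
by rewrite cub_Rq -[q *m M *m p *m R]mulmxA cub_pR !mulNmx addNr.
Qed.

(** Anticommuting with every [p M q] is the tensor equality [R' p M q = - p M q R'], so [R' p = c p]
    and [q R' = -c q]. If [c] were zero, [p] would anticommute with [R'], hence with [R], although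
    [R p = p R = p]. *)
Lemma cub_eigen R' : R' *m R' *m (R' *m R') = R' *m R' -> subA R R' -> subA R' R ->
  p != 0 -> q != 0 -> exists c, [/\ sgn c, R' *m p = c *: p, p *m R' = c *: p,
    R' *m q = - c *: q & q *m R' = - c *: q].
Proof.
move=> R'4 s12 s21 p0 q0.
have H1 M : R' *m p *m M *m q = p *m M *m (- (q *m R')).
  have /eqP := s12 _ (cub_ant_pq M).1; rewrite /jp addr_eq0 => /eqP.
  by rewrite !mulmxA => ->; rewrite mulmxN !mulmxA.
have H2 M : R' *m q *m M *m p = q *m M *m (- (p *m R')).
  have /eqP := s12 _ (cub_ant_pq M).2; rewrite /jp addr_eq0 => /eqP.
  by rewrite !mulmxA => ->; rewrite mulmxN !mulmxA.
have [c [Rp qR]] := tensor_eq q0 p0 H1; have [c' [Rq pR]] := tensor_eq p0 q0 H2.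
have cc : c' = - c.
  have : (c + c') *: p = 0.
    have : p *m (R' *m p) = (p *m R') *m p by rewrite mulmxA.
    rewrite Rp -[p *m R']opprK pR -scalemxAr mulNmx -scalemxAl cub_pp => E.
    by apply: addrr_inj0; mlc E.
  by move/eqP; rewrite scaler_eq0 (negPf p0) orbF addr_eq0 => /eqP ->; rewrite opprK.
have pR' : p *m R' = c *: p by rewrite -[LHS]opprK pR cc scaleNr opprK.
have c4 : c * c * (c * c) = c * c.
  have : R' *m R' *m (R' *m R') *m p = R' *m R' *m p by rewrite R'4.
  rewrite -!mulmxA !(Rp, =^~ scalemxAr) !scalerA => /eqP.
  by rewrite -subr_eq0 -scalerBl scaler_eq0 (negPf p0) orbF subr_eq0 => /eqP c4; lc c4.
have c0 : c != 0.
  apply: contra_neq p0 => c0.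
  have : ant R p by apply: s21; rewrite /ant /jp Rp pR' c0 !scale0r addr0.
  by rewrite /ant /jp cub_Rp cub_pR => /addrr_inj0.
exists c; split=> //; last 2 first.
- by rewrite Rq cc.
- by rewrite -[LHS]opprK qR scaleNr.
have : (c - 1) * (c + 1) == 0.
  have cc0 : c * c != 0 by rewrite mulf_neq0.
  by apply/eqP; apply: (mulfI cc0); lc c4.
by rewrite mulf_eq0 subr_eq0 addr_eq0 => /orP [/eqP|/eqP]; [left|right].
Qed.
End Cubic.

(** The matrix [N M P - P M N] anticommutes with [R]: multiplication by [R] on either side leaves
    only [N M N], with opposite signs. The conclusion is what [R'] makes of it. *)
Lemma nil_exchange R R' N P : R *m N = 0 -> N *m R = 0 -> R *m P = N -> P *m R = N ->
  R' *m N = 0 -> N *m R' = 0 -> subA R R' ->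
  forall M, R' *m P *m M *m N = N *m M *m (P *m R').
Proof.
move=> RN NR RP PR R'N NR' s12 M.
have : ant R (N *m M *m P - P *m M *m N).
  rewrite /ant /jp mulmxBr mulmxBl !mulmxA RN RP -[P *m M *m N *m R]mulmxA NR.
  by rewrite -[N *m M *m P *m R]mulmxA PR !(mul0mx, mulmx0); mring.
move/s12; rewrite /ant /jp mulmxBr mulmxBl !mulmxA R'N -[P *m M *m N *m R']mulmxA NR'.
by rewrite !mul0mx !mulmx0 => E; mlcN E.
Qed.

(** In turn [a - a^3], [e - a^2] and [(e + a) M (e - a)] lie in the corner of [e] and anticommute
    with [a], so they vanish; thus [a] is an involution of the corner with a single eigenvalue. *)
Lemma root_of_idem (e a : 'M[F]_n) : e *m e = e -> e *m a = a -> a *m e = a ->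
  a *m a *m (a *m a) = a *m a ->
  (forall Z, e *m Z = Z -> Z *m e = Z -> a *m Z + Z *m a = 0 -> Z = 0) ->
  a = e \/ a = - e.
Proof.
move=> ee ea ae a4 kill.
have a3 : a - a *m a *m a = 0.
  apply: kill; rewrite ?mulmxBr ?mulmxBl.
  - by rewrite ea !mulmxA ea.
  - by rewrite -!mulmxA !ae.
  - by rewrite !mulmxA; move: a4; rewrite !mulmxA => ->; rewrite subrr addr0.
have {}a3 : a *m a *m a = a by move/eqP: a3; rewrite subr_eq0 => /eqP.
have ga : e - a *m a = 0.
  apply: kill; rewrite ?mulmxBr ?mulmxBl ?ee ?ae ?ea.
  - by rewrite mulmxA ea.
  - by rewrite -mulmxA ae.
  - by rewrite !mulmxA a3 subrr addr0.
have {}ga : a *m a = e by move/eqP: ga; rewrite subr_eq0 => /eqP.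
have eu : e *m (e + a) = e + a by rewrite mulmxDr ee ea.
have au : a *m (e + a) = e + a by rewrite mulmxDr ae ga addrC.
have ve : (e - a) *m e = e - a by rewrite mulmxBl ee ae.
have va : (e - a) *m a = - (e - a) by rewrite mulmxBl ea ga opprB.
have uv M : (e + a) *m M *m (e - a) = 0.
  apply: kill; first by rewrite !mulmxA eu.
    by rewrite -mulmxA ve.
  by rewrite !mulmxA au -[(e + a) *m M *m _ *m a]mulmxA va mulmxN subrr.
case: (sandwich_eq0 uv) => E; [right|left]; first by mlc E.
by mlcN E.
Qed.

Section Compare.
Variables R R' : 'M[F]_n.
Hypothesis R4 : R *m R *m (R *m R) = R *m R.
Hypothesis R'4 : R' *m R' *m (R' *m R') = R' *m R'.
Hypothesis s12 : subA R R'.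
Hypothesis s21 : subA R' R.

(** Since [k l] anticommutes with [R], it does with [R'], so [R' k = a k] and [l R' = -a l]. A
    nonzero [a] is [1] or [-1], and then [R'] has both eigenvalues; [cub_eigen] with the roles
    exchanged makes [R] act by a sign on the part of [R'] containing [k], against [R k = 0]. *)
Lemma cub_ker k l : k != 0 -> l != 0 -> R *m k = 0 -> l *m R = 0 ->
  R' *m k = 0 /\ l *m R' = 0.
Proof.
move=> k0 l0 Rk lR; have [v lv] := ex_br1l l0.
have E : (R' *m k) *m l + k *m (l *m R') = 0.
  have : ant R (k *m l) by rewrite /ant /jp mulmxA Rk -mulmxA lR mul0mx mulmx0 addr0.
  by move/s12; rewrite /ant /jp !mulmxA.
pose a := - br (l *m R') v.
have Ek : R' *m k = a *: k.
  have := congr1 (mulmx^~ v) E; rewrite mulmxDl !mul_crc mul0mx lv scale1r => /eqP.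
  by rewrite addr_eq0 => /eqP ->; rewrite scaleNr.
have El : l *m R' = - a *: l.
  have : k *m (l *m R' + a *: l) = 0.
    by rewrite mulmxDr addrC -scalemxAr scalemxAl -Ek.
  case/outer_eq0=> [E0|El]; first by rewrite E0 eqxx in k0.
  mlc El.
have [a0|a0] := eqVneq a 0; first by rewrite Ek El a0 oppr0 !scale0r.
exfalso; have a1 : (a - 1) * (a + 1) = 0.
  have aa0 : a * a != 0 by rewrite mulf_neq0.
  apply: (mulfI aa0).
  have : R' *m R' *m (R' *m R') *m k = R' *m R' *m k by rewrite R'4.
  rewrite -!mulmxA !(Ek, =^~ scalemxAr) !scalerA => /eqP.
  rewrite -subr_eq0 -scalerBl scaler_eq0 (negPf k0) orbF subr_eq0 => /eqP a4.
  by lc a4.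
have n2k (b : F) : b != 0 -> b *: k != 0 by move=> b0; rewrite scaler_eq0 negb_or b0.
have n2l (b : F) : b != 0 -> b *: l != 0 by move=> b0; rewrite scaler_eq0 negb_or b0.
have Rk' : R' *m R' *m k = (a * a) *: k by rewrite -mulmxA !(Ek, =^~ scalemxAr) scalerA.
have Rk3 : R' *m R' *m R' *m k = (a * a * a) *: k.
  by rewrite -!mulmxA !(Ek, =^~ scalemxAr) !scalerA.
have lR' : l *m (R' *m R') = (a * a) *: l.
  by rewrite mulmxA !(El, =^~ scalemxAl) scalerA mulrNN.
have lR3 : l *m (R' *m R' *m R') = - (a * a * a) *: l.
  by rewrite mulmxA lR' -scalemxAl El scalerA; congr (_ *: _); ring.
move/eqP: a1; rewrite mulf_eq0 subr_eq0 addr_eq0 => /orP [] /eqP a1.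
- have pk : (R' *m R' + R' *m R' *m R') *m k = 2%:R *: k.
    by rewrite mulmxDl Rk' Rk3 a1 -scalerDl !mulr1.
  have lq : l *m (R' *m R' - R' *m R' *m R') = 2%:R *: l.
    by rewrite mulmxBr lR' lR3 a1 -scalerBl !mulr1 opprK.
  have [||c [sc Rp _ _ _]] := cub_eigen R'4 R4 s21 s12.
  + by apply: contraTneq (n2k 2%:R (two_neq0 F)) => E0; rewrite -pk E0 mul0mx eqxx.
  + by apply: contraTneq (n2l 2%:R (two_neq0 F)) => E0; rewrite -lq E0 mulmx0 eqxx.
  have := congr1 (mulmx^~ k) Rp; rewrite -mulmxA -scalemxAl pk -scalemxAr Rk scaler0 => /eqP.
  by rewrite eq_sym !scaler_eq0 (negPf k0) (negPf (two_neq0 F)) (negPf (sgn_neq0 sc)).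
- have qk : (R' *m R' - R' *m R' *m R') *m k = 2%:R *: k.
    by rewrite mulmxBl Rk' Rk3 a1 -scalerBl; congr (_ *: _); ring.
  have lpE : l *m (R' *m R' + R' *m R' *m R') = 2%:R *: l.
    by rewrite mulmxDr lR' lR3 a1 -scalerDl; congr (_ *: _); ring.
  have [||c [sc _ _ Rq _]] := cub_eigen R'4 R4 s21 s12.
  + by apply: contraTneq (n2l 2%:R (two_neq0 F)) => E0; rewrite -lpE E0 mulmx0 eqxx.
  + by apply: contraTneq (n2k 2%:R (two_neq0 F)) => E0; rewrite -qk E0 mul0mx eqxx.
  have := congr1 (mulmx^~ k) Rq; rewrite -mulmxA -scalemxAl qk -scalemxAr Rk scaler0 => /eqP.
  by rewrite eq_sym !scaler_eq0 (negPf k0) (negPf (two_neq0 F)) oppr_eq0 (negPf (sgn_neq0 sc)).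
Qed.

Lemma ex_mulr_neq0 A : A != 0 -> exists v : 'cV[F]_n, A *m v != 0.
Proof.
move=> A0; apply: contrapT => h; move/eqP: A0; apply; apply: col_ext => v.
by rewrite mul0mx; apply: contrapT => /eqP ?; apply: h; exists v.
Qed.
Lemma ex_mull_neq0 A : A != 0 -> exists v : 'rV[F]_n, v *m A != 0.
Proof.
move=> A0; apply: contrapT => h; move/eqP: A0; apply; apply: row_ext => v.
by rewrite mulmx0; apply: contrapT => /eqP ?; apply: h; exists v.
Qed.

Lemma cub_kill A : R *m A = 0 -> A *m R = 0 -> R' *m A = 0 /\ A *m R' = 0.
Proof.
move=> RA AR; have [->|A0] := eqVneq A 0; first by rewrite mul0mx mulmx0.
have [v Av] := ex_mulr_neq0 A0; have [u uA] := ex_mull_neq0 A0.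
split; [apply: col_ext => w|apply: row_ext => w]; rewrite ?mul0mx ?mulmx0.
- have [E|Aw] := eqVneq (A *m w) 0; first by rewrite -mulmxA E mulmx0.
  by rewrite -mulmxA; apply: (cub_ker Aw uA _ _).1; rewrite ?mulmxA ?RA ?mul0mx // -mulmxA AR mulmx0.
- have [E|wA] := eqVneq (w *m A) 0; first by rewrite mulmxA E mul0mx.
  by rewrite mulmxA; apply: (cub_ker Av wA _ _).2; rewrite ?mulmxA ?RA ?mul0mx // -mulmxA AR mulmx0.
Qed.

Let R2 := R *m R.
Let R3 := R *m R *m R.
Let N := R - R3.
Let P := 1%:M - R2.

Lemma cub_RN : R *m N = 0.
Proof. by rewrite mulmxBr cub_RR3 // subrr. Qed.
Lemma cub_NR : N *m R = 0.
Proof. by rewrite mulmxBl cub_R3R // subrr. Qed.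
Lemma cub_RP : R *m P = N.
Proof. by rewrite mulmxBr mulmx1 cub_RR2. Qed.
Lemma cub_PR : P *m R = N.
Proof. by rewrite mulmxBl mul1mx. Qed.

Lemma cub_compl : exists b, R' *m P = b *: N /\ P *m R' = b *: N.
Proof.
have [N0|N0] := eqVneq N 0.
  exists 0; rewrite scale0r; apply: cub_kill; rewrite ?cub_RP ?cub_PR //.
have [R'N NR'] := cub_kill cub_RN cub_NR.
have H := nil_exchange cub_RN cub_NR cub_RP cub_PR R'N NR' s12.
have [b [E1 E2]] := tensor_eq N0 N0 H.
by exists b.
Qed.

(** The hypothesis excludes the eigenvalue [-1], so [R] is the identity on the range of the
    idempotent [R^2]. No nonzero matrix of that corner anticommutes with [R], hence none with [R'],
    and [root_of_idem] applies to [R' R^2]. *)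
Lemma cub_core : R2 = R3 -> exists c, sgn c /\ R' *m R2 = c *: R3.
Proof.
move=> R23; have [b [RP PR]] := cub_compl.
have e2 : R2 *m R2 = R2 by exact: R4.
have Re : R *m R2 = R2 by rewrite mulmxA R23.
have eR : R2 *m R = R2 by exact: (esym R23).
pose a := R' *m R2.
have ae : R2 *m R' = a.
  have := RP; rewrite -PR mulmxBr mulmxBl mulmx1 mul1mx => /addrI /oppr_inj.
  by [].
have kill Z : R2 *m Z = Z -> Z *m R2 = Z -> a *m Z + Z *m a = 0 -> Z = 0.
  move=> eZ Ze E.
  have e1 : R' *m Z = a *m Z by rewrite -[in LHS]eZ mulmxA.
  have e3 : Z *m R' = Z *m a by rewrite -[in LHS]Ze -mulmxA ae.
  have : ant R Z by apply: s21; rewrite /ant /jp e1 e3.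
  have e4 : R *m Z = Z by rewrite -[in LHS]eZ mulmxA Re.
  have e5 : Z *m R = Z by rewrite -[in LHS]Ze -mulmxA eR.
  by rewrite /ant /jp e4 e5 => /addrr_inj0.
have ea : R2 *m a = a by rewrite -ae mulmxA e2.
have a_e : a *m R2 = a by rewrite /a -mulmxA e2.
have aR' : a *m R' = R' *m a by rewrite {1}/a -mulmxA ae.
have aa : a *m a = R' *m a by rewrite {1}/a -mulmxA ea.
have a4 : a *m a *m (a *m a) = a *m a.
  rewrite aa -mulmxA [a *m (R' *m a)]mulmxA aR' -[R' *m a *m a]mulmxA aa !mulmxA.
  by have := congr1 (mulmx^~ R2) R'4; rewrite -!mulmxA -/a !mulmxA.
case: (root_of_idem e2 ea a_e a4 kill) => aE.
- by exists 1; split; [left | rewrite -R23 -/a aE scale1r].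
- by exists (-1); split; [right | rewrite -R23 -/a aE scaleN1r].
Qed.
End Compare.

(* The matrices [p = R^2 + R^3] and [q = R^2 - R^3] are the spectral parts of [R]
   for the eigenvalues [1] and [-1], so [p M q] and [q M p] anticommute with [R]
   for every [M]; testing [R'] on them determines it up to the nilpotent part. *)
Lemma cub_structure R R' : R *m R *m (R *m R) = R *m R ->
  R' *m R' *m (R' *m R') = R' *m R' -> subA R R' -> subA R' R ->
  exists c b, sgn c /\ R' = c *: (R *m R *m R) + b *: (R - R *m R *m R).
Proof.
move=> R4 R'4 s12 s21.
have [b [E _]] := cub_compl R4 R'4 s12 s21.
suff [c [sc Ec]] : exists c, sgn c /\ R' *m (R *m R) = c *: (R *m R *m R).
  exists c, b; split=> //; rewrite -Ec -E mulmxBr mulmx1; mring.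
have [q0|q0] := eqVneq (R *m R - R *m R *m R) 0.
  apply: cub_core => //; by move/eqP: q0; rewrite subr_eq0 => /eqP.
have [p0|p0] := eqVneq (R *m R + R *m R *m R) 0.
  have NN : (- R) *m (- R) = R *m R by rewrite mulNmx mulmxN opprK.
  have NNN : (- R) *m (- R) *m (- R) = - (R *m R *m R) by rewrite NN mulmxN.
  have [|||||c [sc Ec]] := @cub_core (- R) R'.
  - by rewrite NN.
  - by [].
  - by move=> Z; rewrite /ant jpNl => /eqP; rewrite oppr_eq0 => /eqP /s12.
  - by move=> Z /s21; rewrite /ant jpNl => ->; rewrite oppr0.
  - by rewrite NNN NN; move/eqP: p0; rewrite addr_eq0 => /eqP.
  by exists (- c); split; [exact: sgnN | move: Ec; rewrite NNN NN scaleNr scalerN].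
have [c [sc Rp _ Rq _]] := cub_eigen R4 R'4 s12 s21 p0 q0.
exists c; split=> //; have : 2%:R *: (R' *m (R *m R)) = 2%:R *: (c *: (R *m R *m R)).
  move: Rp Rq; rewrite mulmxDr mulmxBr => Rp Rq.
  mlc2 Rp Rq.
by apply: scalerI; rewrite two_neq0.
Qed.
End Anticommutant.

(** * From a preimage to the preimages of the opposite matrix *)

Section Theta.
Variables (F : numClosedFieldType) (n : nat).
Hypothesis hn : (2 < n)%N.
Implicit Types (A B C R T M X Z : 'M[F]_n) (x y z : 'cV[F]_n) (f g h : 'rV[F]_n) (d : F).
Implicit Types phi : 'M[F]_n -> 'M[F]_n.

Lemma ex_row_kill x z : exists p : 'rV[F]_n, [/\ p != 0, br p x = 0 & br p z = 0].
Proof.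
pose K := kermx (row_mx x z).
have : K != 0.
  rewrite -mxrank_eq0 mxrank_ker -lt0n subn_gt0.
  by apply: leq_ltn_trans hn; apply: (leq_trans (rank_leq_col _)).
case/rowV0Pn=> p /sub_kermxP pE p0; exists p.
move: pE; rewrite mul_mx_row -[0]hsubmxK => /eq_row_mx [E1 E2].
by split=> //; rewrite /br ?E1 ?E2 !mxE.
Qed.
Lemma ex_col_kill f g : exists p : 'cV[F]_n, [/\ p != 0, br f p = 0 & br g p = 0].
Proof.
have [p [p0 pf pg]] := ex_row_kill f^T g^T.
by exists p^T; rewrite trmx_eq0 -(br_tr f) -(br_tr g) trmxK.
Qed.

Lemma ex_sep x y : (forall a, y <> a *: x) -> exists f, br f x = 0 /\ br f y = 1.
Proof.
move=> yx; apply: contrapT => h.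
have y0 : y != 0 by apply/eqP=> y0; apply: (yx 0); rewrite scale0r.
have [|a [b E]] := @mul_rowsub0 F n x y 0 y0.
  move=> f fx _; apply: contrapT => /eqP fy; apply: h.
  by exists ((br f y)^-1 *: f); rewrite !brZl fx mulr0 mulVf.
by apply: (yx a); rewrite E scaler0 addr0.
Qed.

Lemma ex_row1 y k : y != 0 -> k != 0 -> exists h, br h y = 1 /\ br h k != 0.
Proof.
move=> y0 k0; have [h hy] := ex_br1 y0; have [u uk] := ex_br1 k0.
have [hk|hk] := eqVneq (br h k) 0; last by exists h.
exists (h + (u - br u y *: h)); rewrite !brE hy hk uk; split; first by ring.
by rewrite mulr0 subr0 add0r oner_neq0.
Qed.

Lemma quad3 (a b c s t u : F) : s != 0 -> t != 0 -> s != t -> a = 0 ->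
  a + s * b + s * s * c = 0 -> a + t * b + t * t * c = 0 -> a + u * b + u * u * c = 0.
Proof.
move=> s0 t0 st -> Es Et.
have E1 : b + s * c = 0 by apply: (mulfI s0); rewrite mulr0; lc Es.
have E2 : b + t * c = 0 by apply: (mulfI t0); rewrite mulr0; lc Et.
have c0 : c = 0.
  have /eqP : (s - t) * c = 0 by lc2 E1 (esym E2).
  by rewrite mulf_eq0 subr_eq0 (negPf st) => /eqP.
by move: E1; rewrite c0 mulr0 addr0 => ->; rewrite !mulr0 !addr0.
Qed.

(** Every entry of the relation is a quadratic polynomial in the parameter, with the three distinct
    zeros [0], [s], [t]. *)
Lemma rel_line3 T A B s t u : s != 0 -> t != 0 -> s != t -> jrel T A ->
  jrel T (A + s *: B) -> jrel T (A + t *: B) -> jrel T (A + u *: B).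
Proof.
move=> s0 t0 st; rewrite /jrel !jpDr !jpZr.
set a := jp T A; set b := jp T B; clearbody a b => H0 Hs Ht.
apply/matrixP=> i j.
have e v : ((a + v *: b) *m (a + v *: b)) i j - (2%:R *: (a + v *: b)) i j =
   ((a *m a) i j - 2%:R * a i j) + v * ((a *m b) i j + (b *m a) i j - 2%:R * b i j)
   + v * v * (b *m b) i j.
  by rewrite !mulmxDl !mulmxDr -!scalemxAl -!scalemxAr !entE; ring.
apply/eqP; rewrite -subr_eq0 e; apply/eqP.
have Q := @quad3 _ _ _ s t u s0 t0 st; apply: Q; rewrite -?e ?Hs ?Ht ?subrr //.
by rewrite H0 entE subrr.
Qed.

Lemma rel_self R : jrel R R -> R *m R *m (R *m R) = R *m R.
Proof.
rewrite /jrel /jp => E; have e4 : 2%:R * 2%:R != 0 :> F by rewrite mulf_neq0 ?two_neq0.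
apply: (scalerI e4).
move: E; rewrite !mulmxDl !mulmxDr => E; mlc E.
Qed.

Lemma rel_structure R R' : jrel R R -> jrel R' R' -> jrel R R' -> subA R R' -> subA R' R ->
  exists t, R' = R + t *: (R - R *m R *m R).
Proof.
move=> /rel_self R4 /rel_self R'4 RR' s12 s21.
have [c [b [sc E]]] := cub_structure R4 R'4 s12 s21.
have [R20|R20] := eqVneq (R *m R) 0.
  by exists (b - 1); rewrite E R20 mul0mx; mring.
suff c1 : c = 1 by exists (b - 1); rewrite E c1; mring.
have cc := sgn_sq sc.
have E1 : R *m R' = c *: (R *m R).
  by rewrite E mulmxDr -!scalemxAr mulmxBr cub_RR3 // subrr scaler0 addr0.
have E2 : R' *m R = c *: (R *m R).
  by rewrite E mulmxDl -!scalemxAl mulmxBl cub_R3R // subrr scaler0 addr0.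
move: RR'; rewrite /jrel /jp E1 E2 -scalerDl -scalemxAl -scalemxAr R4 !scalerA => /eqP.
rewrite -subr_eq0 -scalerBl scaler_eq0 (negPf R20) orbF => /eqP Ec.
have /eqP : 2%:R * 2%:R * (1 - c) = 0.
  have -> : 2%:R * 2%:R * (1 - c) = 2%:R * 2%:R * (c * c - c) by rewrite cc.
  lc Ec.
by rewrite !mulf_eq0 !pnatr_eq0 /= subr_eq0 => /eqP ->.
Qed.

(** Equal images would make [Z] and [2Z] related to the same matrices, which a witness from
    [rel_witness] refutes. *)
Lemma scalar_or_double phi Z (d : F) : pres phi -> Z != 0 -> phi Z = d%:M -> phi (2%:R *: Z) <> d%:M.
Proof.
move=> hphi Z0 E1 E2; have [X [XZ rX]] := rel_witness Z0.
have : jrel (2%:R *: Z) X by apply/(rel_pre hphi); rewrite E2 -E1; apply/rel_im.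
have -> : jrel (2%:R *: Z) X <-> jrel Z (2%:R *: X) by rewrite /jrel jpZl jpZr.
by move/(rel_ant rX) => E; move: XZ; rewrite E eqxx.
Qed.

Lemma no_row_type phi d y g R : pres phi -> sgn d -> br g y = 1 -> phi R = d *: (y *m g) ->
  (forall h R', br h y = 1 -> phi R' = d *: (y *m h) -> subA R R') ->
  forall C, phi C = - d *: (y *m g) -> subA R C.
Proof.
move=> hphi sd gy RE yT C CE; apply: contrapT => nsub.
have d0 := sgn_neq0 sd; have y0 := br1_neq0r gy.
have [Z [RZ nCZ]] : exists Z, ant R Z /\ ~ ant C Z.
  apply: contrapT => h; apply: nsub => Z RZ; apply: contrapT => nC; apply: h.
  by exists Z.
have Z0 : Z != 0 by apply/eqP=> E; apply: nCZ; rewrite E /ant jp0r.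
have row_eig X : X != 0 -> ant R X -> phi X *m y = d *: y.
  move=> X0 RX; apply: (row_relE hphi sd y0 X0).1 => h R' hy R'E.
  by apply: ant_rel; apply: yT hy R'E _ RX.
(* As [Z] anticommutes with [R'], the third alternative would relate [Z] to a preimage of [-d y h];
   but [phi Z] has eigenvector [y] for [d], which no matrix related to [-d y h] can have. *)
have not_theta h R' : br h y = 1 -> phi R' = d *: (y *m h) ->
    ~ forall C, phi C = - d *: (y *m h) -> subA R' C.
  move=> hy R'E th; have [Ch ChE] := onto hphi (sgnN sd) hy.
  have R'Z : ant R' Z := yT _ _ hy R'E _ RZ.
  have := rel_im hphi (ant_rel (th _ ChE _ R'Z)); rewrite ChE.
  have Zy := row_eig _ Z0 RZ.
  have bad (e : F) : e *: y = d *: y -> e = d.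
    by move/eqP; rewrite -subr_eq0 -scalerBl scaler_eq0 (negPf y0) orbF subr_eq0 => /eqP.
  have nd := sgn_opp sd.
  case/(rel_outerP _ hy (sgnN sd)) => [|E|[E _]].
  - by rewrite Zy => /esym /bad /eqP; rewrite (negPf nd).
  - have := congr1 (fun k : 'rV[F]_n => br k y) E; rewrite brA Zy brZr brZl hy !mulr1.
    by move/esym/eqP; rewrite (negPf nd).
  - by move: E; rewrite Zy => /eqP; rewrite scaler_eq0 (negPf d0) (negPf y0).
have [Z1 [RZ1 Z10 Z1d]] : exists Z1, [/\ ant R Z1, Z1 != 0 & phi Z1 <> d%:M].
  have [E|E] := pselect (phi Z = d%:M); last by exists Z.
  exists (2%:R *: Z); split; [exact: antZ| |exact: scalar_or_double E].
  by rewrite scaler_eq0 negb_or two_neq0.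
have [k] : exists k : 'cV[F]_n, (phi Z1 - d%:M) *m k != 0.
  by apply: ex_mulr_neq0; rewrite subr_eq0; apply/eqP.
rewrite mulmxBl mul_scalar_mx; set k0 := _ - _ => k00.
(* The second alternative for [R'] would give [h phi(Z1) = d h], that is [h k0 = 0]. Off this
   hyperplane the two anticommutants agree. *)
have same h R' : br h y = 1 -> phi R' = d *: (y *m h) -> br h k0 != 0 -> subA R R' /\ subA R' R.
  move=> hy R'E hk; split; first exact: yT hy R'E.
  case: (ant_tri hphi sd hy R'E) => [H|H|/not_theta []//].
    exact: H gy RE.
  exfalso; move/eqP: hk; apply.
  have : h *m phi Z1 = d *: h.
    apply: (col_relE hphi sd (br1_neq0l hy) Z10).1 => z R1 hz R1E.
    by apply: ant_rel; apply: H hz R1E _ (yT _ _ hy R'E _ RZ1).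
  by move=> E; rewrite /k0 brDr brNr brZr -brA E brZl subrr.
(* The rows [h1], [h1 + p] and [h1 + 2p] will all kill [y'], while [h1 + e q] takes the value [e]
   there; [e] is [1] or [-1], whichever keeps the value on [k0] nonzero. A preimage [X] of [-d y' q]
   then separates the fourth row from the other three. *)
have [h1 [h1y h1k]] := ex_row1 y0 k00.
have [p [p0 py pk]] := ex_row_kill y k0.
have [y' [y'0 h1y' py']] := ex_col_kill h1 p.
have [|q [qy qy']] := @ex_sep y y'.
  move=> a E; move: h1y'; rewrite E brZr h1y mulr1 => a0.
  by move: y'0; rewrite E a0 scale0r eqxx.
have getR h : br h y = 1 -> br h k0 != 0 ->
    exists R', [/\ phi R' = d *: (y *m h), subA R R' & subA R' R].
  move=> hy hk; have [R' R'E] := onto hphi sd hy; exists R'.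
  by have [] := same h R' hy R'E hk.
have [R1 [E1 s1 t1]] := getR h1 h1y h1k.
have relR h h' A B : br h y = 1 -> br h' y = 1 -> phi A = d *: (y *m h) ->
    phi B = d *: (y *m h') -> jrel A B.
  move=> hy h'y EA EB; apply: (rel_pre hphi); rewrite EA EB; apply: rel_rowP => //.
  by rewrite -scalemxAl mul_crc h'y scale1r.
have line h R' : br h y = 1 -> phi R' = d *: (y *m h) -> subA R R' -> subA R' R ->
    exists t, R' = R1 + t *: (R1 - R1 *m R1 *m R1).
  move=> hy R'E s t; apply: rel_structure.
  - exact: (relR h1 h1).
  - exact: (relR h h).
  - exact: (relR h1 h).
  - by move=> W /t1 /s.
  - by move=> W /t /s1.
have h2y : br (h1 + p) y = 1 by rewrite brDl py addr0.
have h3y : br (h1 + 2%:R *: p) y = 1 by rewrite brDl brZl py mulr0 addr0.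
have [R2 [E2 s2 t2]] : exists R', [/\ phi R' = d *: (y *m (h1 + p)), subA R R' & subA R' R].
  by apply: getR => //; rewrite brDl pk addr0.
have [R3 [E3 s3 t3]] : exists R', [/\ phi R' = d *: (y *m (h1 + 2%:R *: p)), subA R R' & subA R' R].
  by apply: getR => //; rewrite brDl brZl pk mulr0 addr0.
have [e [e0 h4k]] : exists e, e != 0 /\ br (h1 + e *: q) k0 != 0.
  have [E|E] := eqVneq (br h1 k0 + br q k0) 0; last first.
    by exists 1; rewrite oner_neq0 scale1r brDl.
  exists (-1); rewrite oppr_eq0 oner_neq0 scaleN1r brDl brNl; split=> //.
  apply: contraNneq h1k => E'; have : br h1 k0 + br h1 k0 = 0 by lc2 E E'.
  by move/eqP; rewrite -mulr2n mulrn_eq0.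
have h4y : br (h1 + e *: q) y = 1 by rewrite brDl brZl qy mulr0 addr0.
have [R4 [E4 s4 t4]] := getR _ h4y h4k.
have [u2 D2] := line _ _ h2y E2 s2 t2; have [u3 D3] := line _ _ h3y E3 s3 t3.
have [u4 D4] := line _ _ h4y E4 s4 t4.
have ne h h' A B : phi A = d *: (y *m h) -> phi B = d *: (y *m h') -> h - h' != 0 -> A <> B.
  move=> EA EB hh AB; move: EB; rewrite -AB EA => E.
  have : y *m (h - h') = 0.
    by rewrite mulmxBr; apply/eqP; rewrite subr_eq0; apply/eqP; apply: (scalerI d0).
  by case/outer_eq0 => /eqP; [rewrite (negPf y0)|rewrite (negPf hh)].
have u20 : u2 != 0.
  apply/eqP=> u0; apply: (ne _ _ _ _ E2 E1); first by rewrite addrC addKr.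
  by rewrite D2 u0 scale0r addr0.
have u30 : u3 != 0.
  apply/eqP=> u0; apply: (ne _ _ _ _ E3 E1); last by rewrite D3 u0 scale0r addr0.
  by rewrite addrC addKr scaler_eq0 negb_or two_neq0.
have u23 : u2 != u3.
  apply/eqP=> u0; apply: (ne _ _ _ _ E3 E2); last by rewrite D2 D3 u0.
  by have -> : h1 + 2%:R *: p - (h1 + p) = p by mring.
have [X XE] := onto hphi (sgnN sd) qy'.
have orth h A : br h y = 1 -> br h y' = 0 -> phi A = d *: (y *m h) -> jrel X A.
  move=> hy hy' AE; apply: (rel_pre hphi); rewrite XE AE; apply: rel_orth => //; exact: sgnN.
have : jrel X R4.
  have L := fun A B (u : F) => @rel_line3 X A B _ _ u u20 u30 u23.
  rewrite D4; apply: L.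
  - exact: (orth h1).
  - by rewrite -D2; apply: (orth _ _ h2y _ E2); rewrite brDl h1y' py' addr0.
  - by rewrite -D3; apply: (orth _ _ h3y _ E3); rewrite brDl brZl h1y' py' mulr0 addr0.
move=> /(rel_im hphi) /relC; rewrite XE E4 => /(rel_opp sd h4y qy') [_].
by rewrite brDl brZl h1y' qy' mulr1 add0r => /eqP; rewrite (negPf e0).
Qed.


(* If the first alternative of [ant_tri] held, the preimages of [d y h] would lie on
   a line [R1 + t N] for generic [h]; a matrix related to three of them would be
   related to all of them. *)
Theorem ant_opp phi d y g R C : pres phi -> sgn d -> br g y = 1 ->
  phi R = d *: (y *m g) -> phi C = - d *: (y *m g) -> subA R C.
Proof.
move=> hphi sd gy RE CE; case: (ant_tri hphi sd gy RE) => H; last exact: H.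
  exact: no_row_type H _ CE.
have hT := pres_trl hphi.
apply: (@no_row_type _ d g^T y^T R hT sd).
- by rewrite br_tr.
- by rewrite RE outer_tr.
- move=> h R' hy R'E; apply: (H h^T); first by rewrite -br_tr trmxK.
  by apply: trmx_inj; rewrite R'E outer_tr trmxK.
- by rewrite CE outer_tr.
Qed.
End Theta.

(** * Preimages of rank-one idempotents *)

Section Eigen.
Variables (F : numClosedFieldType) (n : nat).
Hypothesis hn : (2 < n)%N.
Implicit Types (A B C D R T M X Z : 'M[F]_n) (x y z : 'cV[F]_n) (f g h : 'rV[F]_n) (d e : F).
Implicit Types phi : 'M[F]_n -> 'M[F]_n.

(** The sign left open by [cub_structure] must be [-1]: with [+1] the matrices [R] and [C] would be
    related, which their opposite images are not. The same failure excludes [R^2 = 0]. *)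
Lemma opp_structure phi d y g R C : pres phi -> sgn d -> br g y = 1 ->
  phi R = d *: (y *m g) -> phi C = - d *: (y *m g) ->
  [/\ R *m R *m (R *m R) = R *m R, R *m R != 0 &
    exists b, C = - (R *m R *m R) + b *: (R - R *m R *m R)].
Proof.
move=> hphi sd gy RE CE.
have self d' A : sgn d' -> phi A = d' *: (y *m g) -> A *m A *m (A *m A) = A *m A.
  move=> sd' AE; apply: rel_self; apply: (rel_pre hphi); rewrite AE.
  by apply: rel_rowP => //; rewrite -scalemxAl mul_crc gy scale1r.
have R4 := self _ _ sd RE; have C4 := self _ _ (sgnN sd) CE.
have s12 := ant_opp hn hphi sd gy RE CE.
have s21 : subA C R.
  by apply: (ant_opp hn hphi (sgnN sd) gy CE); rewrite opprK.
have [c [b [sc E]]] := cub_structure R4 C4 s12 s21.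
have nRC : ~ jrel R C.
  move=> /(rel_im hphi); rewrite RE CE => /(rel_opp sd gy gy) [E' _].
  by move: gy; rewrite E' => /eqP; rewrite eq_sym oner_eq0.
have E1 : R *m C = c *: (R *m R).
  by rewrite E mulmxDr -!scalemxAr mulmxBr cub_RR3 // subrr scaler0 addr0.
have E2 : C *m R = c *: (R *m R).
  by rewrite E mulmxDl -!scalemxAl mulmxBl cub_R3R // subrr scaler0 addr0.
have rE : jp R C = (2%:R * c) *: (R *m R) by rewrite /jp E1 E2; mring.
have R20 : R *m R != 0.
  by apply/eqP=> R20; apply: nRC; rewrite /jrel rE R20 scaler0 mulmx0 scaler0.
split=> //; exists b; rewrite E.
case: sc => cE; last by rewrite cE scaleN1r.
exfalso; apply: nRC; rewrite /jrel rE cE mulr1 -scalemxAl -scalemxAr R4 scalerA //.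
Qed.


Lemma eig_sq R x e : sgn e -> R *m x = e *: x -> R *m R *m x = x.
Proof. by move=> se E; rewrite -mulmxA E -scalemxAr E scalerA sgn_sq // scale1r. Qed.

Lemma opp_eig phi d y g R C x e : pres phi -> sgn d -> br g y = 1 ->
  phi R = d *: (y *m g) -> phi C = - d *: (y *m g) -> sgn e -> R *m x = e *: x ->
  C *m x = - e *: x.
Proof.
move=> hphi sd gy RE CE se Rx.
have [_ _ [b ->]] := opp_structure hphi sd gy RE CE.
have R3x : R *m R *m R *m x = e *: x by rewrite -mulmxA Rx -scalemxAr (eig_sq se Rx).
by rewrite mulmxDl -scalemxAl mulmxBl mulNmx R3x Rx subrr scaler0 addr0 scaleNr.
Qed.

(** The eigenvector alternatives for [d] and for [-d] assign the distinct values [d] and [-d] to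
    [g B y], so the third one must occur. *)
Lemma pm_eq0 phi d y g B : pres phi -> sgn d -> br g y = 1 -> jrel (d *: (y *m g)) B ->
  jrel (- d *: (y *m g)) B -> B *m y = 0 /\ g *m B = 0.
Proof.
move=> _ sd gy; have nd := sgn_opp sd.
have y0 := br1_neq0r gy; have g0 := br1_neq0l gy.
have bady e e' : e *: y = e' *: y -> e = e'.
  by move/eqP; rewrite -subr_eq0 -scalerBl scaler_eq0 (negPf y0) orbF subr_eq0 => /eqP.
have badg e e' : e *: g = e' *: g -> e = e'.
  by move/eqP; rewrite -subr_eq0 -scalerBl scaler_eq0 (negPf g0) orbF subr_eq0 => /eqP.
have mix e e' : B *m y = e *: y -> g *m B = e' *: g -> e = e'.
  move=> E1 E2; have : br (g *m B) y = br g (B *m y) by rewrite brA.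
  by rewrite E1 E2 brZl brZr gy !mulr1.
case/(rel_outerP _ gy sd) => [E1|E1|[E1 E1']] //;
case/(rel_outerP _ gy (sgnN sd)) => [E2|E2|[E2 E2']] //; exfalso; move/eqP: nd; apply.
- by apply: bady; rewrite -E1.
- by apply/esym; apply: mix.
- exact: mix.
- by apply: badg; rewrite -E1.
Qed.

Section Fixed.
Variable phi : 'M[F]_n -> 'M[F]_n.
Hypothesis hphi : pres phi.

(* Eigenvectors of the preimages of [d y h] which do not depend on one of the two
   factors: [U] fixes the column [y], [V] the row [g]; the primed versions are
   about row eigenvectors. *)
Definition eigU d e x y := forall h R, br h y = 1 -> phi R = d *: (y *m h) -> R *m x = e *: x.
Definition eigU' d e f y := forall h R, br h y = 1 -> phi R = d *: (y *m h) -> f *m R = e *: f.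
Definition eigV d e x g := forall z R, br g z = 1 -> phi R = d *: (z *m g) -> R *m x = e *: x.
Definition eigV' d e f g := forall z R, br g z = 1 -> phi R = d *: (z *m g) -> f *m R = e *: f.

Lemma eigU_opp d e x y : sgn d -> sgn e -> eigU d e x y -> eigU (- d) (- e) x y.
Proof.
move=> sd se H h R hy RE; have [C CE] := onto hphi sd hy.
by apply: (opp_eig hphi sd hy CE RE se); apply: H hy CE.
Qed.

Lemma sgn_scale_neq0 e x f : sgn e -> br f x = 1 -> e *: (x *m f) != 0.
Proof.
move=> se fx; rewrite scaler_eq0 negb_or sgn_neq0 //=.
apply/eqP=> /outer_eq0 [] E; move: fx; rewrite E brE => /eqP; rewrite eq_sym oner_eq0 //.
Qed.

Lemma eigU_im d e x y f : sgn d -> sgn e -> y != 0 -> br f x = 1 -> eigU d e x y ->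
  phi (e *: (x *m f)) *m y = d *: y.
Proof.
move=> sd se y0 fx H; apply: (row_relE hphi sd y0 (sgn_scale_neq0 se fx)).1 => h R hy RE.
by apply/relC; apply: rel_rowP => //; apply: H hy RE.
Qed.

Lemma eigU_of d e x y : sgn d -> sgn e -> x != 0 ->
  (forall f h, br f x = 1 -> br h y = 1 -> jrel (phi (e *: (x *m f))) (d *: (y *m h))) ->
  eigU d e x y.
Proof.
move=> sd se x0 H h R hy RE; case: (@rel_row F n x R e x0 se) => // [f fx|R0].
  by apply: (rel_pre hphi); rewrite RE; apply: H.
move: RE; rewrite R0 (pres0 hphi) => /esym/eqP.
by rewrite (negPf (sgn_scale_neq0 sd hy)).
Qed.

(** The matrices [e x f] with [f x = 1] form an affine family related to [R]. The third alternative
    would relate all of them to a preimage [C] of [-y g], forcing [C x = e x], whereas [opp_eig]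
    gives [C x = -e x]. *)
Lemma eig_tri y g R x e : sgn e -> br g y = 1 -> phi R = 1 *: (y *m g) -> x != 0 ->
  R *m x = e *: x -> eigU 1 e x y \/ eigV 1 e x g.
Proof.
move=> se gy RE x0 Rx; have s1 := sgn1 F.
case: (rel_irr hphi s1 gy RE (@affine_row F n e x)).
- by move=> A [f fx ->]; apply/relC; apply: rel_rowP.
- move=> H; left; apply: eigU_of => // f h fx hy.
  have [T TE] := onto hphi s1 hy; rewrite -TE; apply: (rel_im hphi); apply/relC.
  by apply: H hy TE; exists f.
- move=> H; right=> z T gz TE; case: (@rel_row F n x T e x0 se) => // [f fx|T0].
    by apply/relC; apply: H gz TE; exists f.
  move: TE; rewrite T0 (pres0 hphi) => /esym/eqP.
  by rewrite (negPf (sgn_scale_neq0 s1 gz)).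
- move=> H; exfalso; have [C CE] := onto hphi (sgnN s1) gy.
  have Cx := opp_eig hphi s1 gy RE CE se Rx.
  case: (@rel_row F n x C e x0 se) => [f fx|E|C0].
  + by apply/relC; apply: H CE; exists f.
  + move/eqP: E; rewrite Cx -subr_eq0 -scalerBl scaler_eq0 (negPf x0) orbF subr_eq0.
    by rewrite (negPf (sgn_opp se)).
  + move: CE; rewrite C0 (pres0 hphi) => /esym/eqP.
    by rewrite (negPf (sgn_scale_neq0 (sgnN s1) gy)).
Qed.

(** Common consequence of [eigU] for [x] and of [eigU'] for [f]: the pair [(x, f)] belongs to the
    column [y], whichever factor is responsible. Used with [trl phi] and [g^T], it says that the
    pair belongs to the row [g]. *)
Definition letter e x f y :=
  forall d, sgn d -> phi ((d * e) *: (x *m f)) *m y = d *: y.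

Lemma letterU e x f y : sgn e -> y != 0 -> br f x = 1 -> eigU 1 e x y -> letter e x f y.
Proof.
move=> se y0 fx H d [] ->.
  by rewrite mul1r; apply: eigU_im => //; apply: sgn1.
rewrite mulN1r; apply: eigU_im => //; [exact: sgnN (sgn1 F)|exact: sgnN|].
by apply: eigU_opp => //; apply: sgn1.
Qed.

(** On the common eigenvector [jp A B] acts by [2ab], and the relation allows only the values [0]
    and [2]. *)
Lemma rel_eig A B y a b : y != 0 -> jrel A B -> A *m y = a *: y -> B *m y = b *: y ->
  a * b != -1.
Proof.
move=> y0 H Ay By; apply/eqP=> ab.
have J : jp A B *m y = (- 2%:R) *: y.
  rewrite /jp mulmxDl -!mulmxA Ay By -!scalemxAr Ay By !scalerA -scalerDl.
  by congr (_ *: _); rewrite [b * a]mulrC ab; ring.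
have := congr1 (mulmx^~ y) H; rewrite -mulmxA -scalemxAl J -scalemxAr J !scalerA => /eqP.
rewrite -subr_eq0 -scalerBl scaler_eq0 (negPf y0) orbF.
have -> : - 2%:R * - 2%:R - 2%:R * - 2%:R = 8%:R :> F by ring.
by rewrite pnatr_eq0.
Qed.

Lemma letter_conflict e x f e' x' f' y : y != 0 -> sgn e -> br f x = 1 ->
  br f x' = 0 -> br f' x = 0 -> letter e x f y -> letter e' x' f' y -> False.
Proof.
move=> y0 se fx fx' f'x L L'.
have := L _ (sgn1 F); rewrite mul1r => E.
have := L' _ (sgnN (sgn1 F)); rewrite mulN1r => E'.
have H : jrel (phi (e *: (x *m f))) (phi (- e' *: (x' *m f'))).
  by apply: (rel_im hphi); apply: rel_orth.
by move: (rel_eig y0 H E E'); rewrite mul1r eqxx.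
Qed.

(** If [y] and [w] were independent, [y h] and [-(e e') w h'] with biorthogonal factors would be
    related, while their preimages share the eigenvector [x] with eigenvalues of product [-1]. *)
Lemma eigU_unique e x y e' w : sgn e -> sgn e' -> x != 0 -> y != 0 -> eigU 1 e x y -> eigU 1 e' x w ->
  w != 0 -> exists a, w = a *: y.
Proof.
move=> se se' x0 y0 H H' w0; apply: contrapT => nw.
have [h' [h'y h'w]] : exists h, br h y = 0 /\ br h w = 1.
  by apply: ex_sep => a E; apply: nw; exists a.
have [h [hw hy]] : exists h, br h w = 0 /\ br h y = 1.
  apply: ex_sep => a E; apply: nw; exists (a^-1).
  rewrite E scalerA mulVf ?scale1r //.
  by apply: contraNneq y0 => a0; rewrite E a0 scale0r.
have s1 := sgn1 F; pose d := - (e * e').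
have sd : sgn d.
  by rewrite /d; case: se => ->; case: se' => ->; rewrite ?mulr1 ?mul1r ?mulrNN ?mulr1 ?opprK; [right|left|left|right].
have [R RE] := onto hphi s1 hy; have [T TE] := onto hphi sd h'w.
have Tx : T *m x = (d * e') *: x.
  case: sd => dE; move: TE; rewrite dE => TE.
    by rewrite mul1r; apply: H' h'w TE.
  by rewrite mulN1r; apply: (eigU_opp s1 se' H') h'w TE.
have RT : jrel R T by apply: (rel_pre hphi); rewrite RE TE; apply: rel_orth.
move: (rel_eig x0 RT (H _ _ hy RE) Tx).
have -> : e * (d * e') = -1.
  by rewrite /d; have := sgn_sq se; have := sgn_sq se' => e1 e2; lcs2 (- (e * e)) e1 (-1 : F) e2.
by rewrite eqxx.
Qed.

Lemma eigU_scale d e x y a : a != 0 -> eigU d e x y -> eigU d e x (a *: y).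
Proof.
move=> a0 H h R hy RE; apply: (H (a *: h)); first by rewrite brZl -brZr.
by rewrite RE -scalemxAl -scalemxAr.
Qed.
Lemma eigU_scaler d e x y a : eigU d e x y -> eigU d e (a *: x) y.
Proof. by move=> H h R hy RE; rewrite -scalemxAr (H h R hy RE) !scalerA mulrC. Qed.

End Fixed.
End Eigen.

(** * Transposition symmetries and the rank of the preimages *)

Section Duality.
Variables (F : numClosedFieldType) (n : nat).
Hypothesis hn : (2 < n)%N.
Implicit Types (A B C D R S T M X Z : 'M[F]_n) (x y z : 'cV[F]_n) (f g h : 'rV[F]_n) (d e : F).
Implicit Types phi : 'M[F]_n -> 'M[F]_n.

(** Transposing the value exchanges the roles of [y] and [g], transposing the argument those of [x]
    and [f]. Thus [eigV], [eigU'] and [eigV'] are [eigU] for [trl phi], [trr phi] and their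
    composite. *)
Definition trl phi := fun X => (phi X)^T.
Definition trr phi := fun X => phi X^T.

Lemma presl phi : pres phi -> pres (trl phi). Proof. exact: pres_trl. Qed.
Lemma presr phi : pres phi -> pres (trr phi). Proof. exact: pres_trr. Qed.

Lemma outer_tr1 y g : (1 *: (y *m g))^T = 1 *: (g^T *m y^T).
Proof. exact: outer_tr. Qed.

Lemma eigV_tr phi e x g : eigV phi 1 e x g <-> eigU (trl phi) 1 e x g^T.
Proof.
split=> H.
- move=> h R hg RE; apply: (H h^T); first by rewrite -br_tr trmxK.
  by apply: trmx_inj; rewrite -[LHS]/(trl phi R) RE outer_tr1 trmxK.
- move=> z R gz RE; apply: (H z^T); first by rewrite br_tr.
  by rewrite /trl RE outer_tr1.
Qed.

Lemma eigU'_tr phi e f y : eigU' phi 1 e f y <-> eigU (trr phi) 1 e f^T y.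
Proof.
split=> H h R hy RE.
- by apply: trmx_inj; rewrite trmx_mul trmxK (H h R^T hy RE) linearZ /= trmxK.
- have := H h R^T hy; rewrite /trr trmxK => /(_ RE) E.
  by apply: trmx_inj; rewrite trmx_mul E linearZ.
Qed.

Lemma eigV'_tr phi e f g : eigV' phi 1 e f g <-> eigU (trl (trr phi)) 1 e f^T g^T.
Proof.
split=> H.
- apply/(eigV_tr (trr phi)) => z R gz RE.
  by apply: trmx_inj; rewrite trmx_mul trmxK (H z R^T gz RE) linearZ /= trmxK.
- move/(eigV_tr (trr phi)): H => H z R gz RE.
  have := H z R^T gz; rewrite /trr trmxK => /(_ RE) E.
  by apply: trmx_inj; rewrite trmx_mul E linearZ.
Qed.

Lemma letter_trr phi e x f y : letter (trr phi) e f^T x^T y -> letter phi e x f y.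
Proof. by move=> H d sd; have := H d sd; rewrite /trr outer_tr !trmxK. Qed.

Lemma letterU' phi e x f y : pres phi -> sgn e -> y != 0 -> br f x = 1 ->
  eigU' phi 1 e f y -> letter phi e x f y.
Proof.
move=> hphi se y0 fx /eigU'_tr H; apply: letter_trr.
by apply: (letterU hn (presr hphi)) => //; rewrite br_tr.
Qed.
Lemma letterV phi e x f g : pres phi -> sgn e -> g != 0 -> br f x = 1 ->
  eigV phi 1 e x g -> letter (trl phi) e x f g^T.
Proof.
move=> hphi se g0 fx /eigV_tr H.
by apply: (letterU hn (presl hphi)) => //; rewrite trmx_eq0.
Qed.
Lemma letterV' phi e x f g : pres phi -> sgn e -> g != 0 -> br f x = 1 ->
  eigV' phi 1 e f g -> letter (trl phi) e x f g^T.
Proof.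
move=> hphi se g0 fx /eigV'_tr H; apply: letter_trr.
by apply: (letterU hn (presl (presr hphi))) => //; rewrite ?trmx_eq0 // br_tr.
Qed.

Lemma eig_tri' phi y g R f e : pres phi -> sgn e -> br g y = 1 -> phi R = 1 *: (y *m g) ->
  f != 0 -> f *m R = e *: f -> eigU' phi 1 e f y \/ eigV' phi 1 e f g.
Proof.
move=> hphi se gy RE f0 fR.
have [|||H|H] := @eig_tri F n hn _ (presr hphi) y g R^T f^T e se gy.
- by rewrite /trr trmxK.
- by rewrite trmx_eq0.
- by rewrite -trmx_mul fR linearZ.
- by left; apply/eigU'_tr.
- by right; apply/eigV'_tr/eigV_tr.
Qed.

Lemma eigU'_of phi e f y : pres phi -> sgn e -> f != 0 ->
  (forall x h, br f x = 1 -> br h y = 1 -> jrel (phi (e *: (x *m f))) (1 *: (y *m h))) ->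
  eigU' phi 1 e f y.
Proof.
move=> hphi se f0 H; apply/eigU'_tr; apply: (eigU_of (presr hphi) (sgn1 F) se).
  by rewrite trmx_eq0.
move=> k h fk hy; rewrite /trr outer_tr trmxK; apply: H => //.
by rewrite -br_tr trmxK.
Qed.

Lemma irr_target phi e x f (W : 'M[F]_n -> Prop) : pres phi -> sgn e -> br f x = 1 -> affine W ->
  (forall A, W A -> jrel (phi (e *: (x *m f))) A) -> (forall A, W A -> exists T, phi T = A) ->
  [\/ forall A, W A -> forall f', br f' x = 1 -> jrel (phi (e *: (x *m f'))) A,
      forall A, W A -> forall x', br f x' = 1 -> jrel (phi (e *: (x' *m f))) A |
      forall A, W A -> jrel (phi (- e *: (x *m f))) A].
Proof.
move=> hphi se fx aW H ex; apply: irreducible => //.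
- by apply: lclosed_all => ?; apply: lclosed_imp => ?; apply: lclosed_rel.
- by apply: lclosed_all => ?; apply: lclosed_imp => ?; apply: lclosed_rel.
- exact: lclosed_rel.
move=> A WA; have [T TA] := ex _ WA; have := H _ WA; rewrite -TA => /(rel_pre hphi).
case/(rel_outerP _ fx se) => [E|E|E].
- by apply: Or31 => f' f'x; apply: (rel_im hphi); apply: rel_rowP.
- by apply: Or32 => x' fx'; apply: (rel_im hphi); apply: rel_colP.
- by apply: Or33; apply: (rel_im hphi); apply/rel_outerP; [|exact: sgnN|exact: Or33].
Qed.

(** On the range of [D] the matrix [R] acts as the involution [S = R D]. For one sign [e] the matrix
    [D + e S] is nonzero; it is twice the projection onto the eigenspace for [e], and a column and a
    row are cut out of it. *)
Lemma ex_eigenpair R D : D *m D = D -> R *m D = D *m R -> R *m R *m D = D -> D != 0 ->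
  exists e x f, [/\ sgn e, br f x = 1, R *m x = e *: x, f *m R = e *: f &
    D *m x = x /\ f *m D = f].
Proof.
move=> DD RD RRD D0; set S := R *m D in RD.
have SS : S *m S = D by rewrite {2}RD /S -mulmxA [D *m (D *m R)]mulmxA DD -RD /S mulmxA.
have DS : D *m S = S by rewrite RD mulmxA DD.
have SD : S *m D = S by rewrite /S -mulmxA DD.
have RS : R *m S = D by rewrite /S mulmxA.
have SR : S *m R = D by rewrite {1}/S -mulmxA -RD.
have [e [se P0]] : exists e, sgn e /\ D + e *: S != 0.
  have [E|E] := eqVneq (D + S) 0; last by exists 1; rewrite scale1r; split=> //; exact: sgn1.
  exists (-1); split; first exact: sgnN (sgn1 F).
  apply: contra_neq D0 => E'; rewrite scaleN1r in E'.
  have : D + D = 0 by mlc2 E E'.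
  by move=> /addrr_inj0.
have ee := sgn_sq se; set P := D + e *: S in P0.
have PP : P *m P = 2%:R *: P.
  rewrite /P mulmxDl !mulmxDr -!scalemxAl -!scalemxAr DD DS SD SS scalerA ee scale1r; mring.
have RP : R *m P = e *: P by rewrite /P mulmxDr -scalemxAr RS scalerDr scalerA ee scale1r addrC.
have PR : P *m R = e *: P.
  by rewrite /P mulmxDl -scalemxAl SR scalerDr scalerA ee scale1r addrC -RD.
have DP : D *m P = P by rewrite /P mulmxDr -scalemxAr DD DS.
have PD : P *m D = P by rewrite /P mulmxDl -scalemxAl DD SD.
have [v Pv] := ex_mulr_neq0 P0; have [u uP] := ex_br1 Pv.
exists e, (P *m v), (2%:R^-1 *: (u *m P)); split=> //.
- rewrite brZl brA mulmxA PP -scalemxAl brZr uP mulr1 mulVf //; exact: two_neq0.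
- by rewrite mulmxA RP -scalemxAl.
- by rewrite -scalemxAl -mulmxA PR -scalemxAr; mring.
- by rewrite mulmxA DP -scalemxAl -mulmxA PD.
Qed.

(** The choice [Z = -(R - R^3)] relates [R^3 = e1 x1 f1 + e2 x2 f2] to all preimages [T] of [y h].
    The first summand contributes [2 x1 f1], orthogonal to the rest, so [e2 x2 f2] alone is related
    to every [T]. The second pair then also belongs to [y], against [letter_conflict]. *)
Lemma two_pair_aux phi y g R e1 x1 f1 e2 x2 f2 : pres phi -> sgn e1 -> sgn e2 ->
  br g y = 1 -> phi R = 1 *: (y *m g) ->
  br f1 x1 = 1 -> br f2 x2 = 1 -> br f1 x2 = 0 -> br f2 x1 = 0 ->
  R *m x1 = e1 *: x1 -> f1 *m R = e1 *: f1 -> R *m x2 = e2 *: x2 -> f2 *m R = e2 *: f2 ->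
  R *m R = x1 *m f1 + x2 *m f2 ->
  eigU phi 1 e1 x1 y -> eigU' phi 1 e1 f1 y ->
  (forall Z, ant R Z -> row_rel phi 1 y (R + Z)) -> False.
Proof.
move=> hphi s1 s2 gy RE f1x1 f2x2 f1x2 f2x1 Rx1 f1R Rx2 f2R RR U1 U1' H.
have s := sgn1 F; have y0 := br1_neq0r gy.
have R4 : R *m R *m (R *m R) = R *m R.
  have [C CE] := onto hphi (sgnN s) gy.
  by have [] := opp_structure hn hphi s gy RE CE.
have R3 : R *m R *m R = e1 *: (x1 *m f1) + e2 *: (x2 *m f2).
  by rewrite RR mulmxDl -!mulmxA f1R f2R -!scalemxAr.
have aN : ant R (- (R - R *m R *m R)).
  by rewrite /ant jpNr /jp mulmxBr mulmxBl cub_RR3 // cub_R3R // subrr addr0 oppr0.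
have relT h T : br h y = 1 -> phi T = 1 *: (y *m h) -> jrel (e2 *: (x2 *m f2)) T.
  move=> hy TE; have Tx1 := U1 _ _ hy TE; have f1T := U1' _ _ hy TE.
  have := H _ aN _ _ hy TE; rewrite /jrel (jpC _ T).
  have -> : R - (R - R *m R *m R) = R *m R *m R by mring.
  rewrite R3 jpDr; set K := jp T (e2 *: _).
  have -> : jp T (e1 *: (x1 *m f1)) = 2%:R *: (x1 *m f1).
    rewrite jpZr /jp mulmxA Tx1 -mulmxA f1T -scalemxAl -scalemxAr scalerDr scalerA sgn_sq //.
    by rewrite scale1r scaler_nat.
  have KE : K = e2 *: (x2 *m (f2 *m T) + (T *m x2) *m f2) by rewrite /K jpC outer_jp.
  have aK : x1 *m f1 *m K = 0.
    by rewrite KE -scalemxAr mulmxDr !mul_crcr f1x2 -brA f1T brZl f1x2 mulr0 !scale0r addr0 scaler0.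
  have Ka : K *m (x1 *m f1) = 0.
    by rewrite KE -scalemxAl mulmxDl !mul_crcr f2x1 brA Tx1 brZr f2x1 mulr0 !scale0r addr0 scaler0.
  have KJ : jp T (e2 *: (x2 *m f2)) = K by [].
  clearbody K; rewrite mulmxDl !mulmxDr -!scalemxAl -!scalemxAr aK Ka mul_crcr f1x1 scale1r => E.
  by mlc E.
pose W A := exists2 h, br h y = 1 & A = 1 *: (y *m h).
have x20 := br1_neq0r f2x2; have f20 := br1_neq0l f2x2.
case: (@irr_target phi e2 x2 f2 W hphi s2 f2x2).
- exact: affine_row.
- by move=> A [h hy ->]; have [T TE] := onto hphi s hy; rewrite -TE; apply: (rel_im hphi); apply: relT hy TE.
- by move=> A [h hy ->]; apply: onto.
- move=> K; have U2 : eigU phi 1 e2 x2 y.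
    by apply: (eigU_of hphi) => // f h fx hy; apply: K => //; exists h.
  exact: (letter_conflict hphi y0 s1 f1x1 f1x2 f2x1 (letterU hn hphi s1 y0 f1x1 U1) (letterU hn hphi s2 y0 f2x2 U2)).
- move=> K; have U2 : eigU' phi 1 e2 f2 y.
    by apply: eigU'_of => // x h fx hy; apply: K => //; exists h.
  exact: (letter_conflict hphi y0 s1 f1x1 f1x2 f2x1 (letterU hn hphi s1 y0 f1x1 U1) (letterU' hphi s2 y0 f2x2 U2)).
- move=> /(_ _ (ex_intro2 _ _ g gy erefl)).
  rewrite -RE => /(rel_pre hphi) /(rel_eig x20) K.
  have := K (- e2) e2; rewrite -scalemxAl mul_crc f2x2 scale1r => /(_ erefl Rx2).
  by rewrite mulNr sgn_sq // eqxx.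
Qed.

(** For [Z] anticommuting with [R], the matrix [R + Z] is related to [R], as [Z] drops out of the
    product. This affine family follows one alternative: the first moves the second pair to [y], the
    second moves the first pair to [g], and the third relates [R] to a preimage of [-y g]. *)
Lemma two_pair phi y g R e1 x1 f1 e2 x2 f2 : pres phi -> sgn e1 -> sgn e2 ->
  br g y = 1 -> phi R = 1 *: (y *m g) ->
  br f1 x1 = 1 -> br f2 x2 = 1 -> br f1 x2 = 0 -> br f2 x1 = 0 ->
  R *m x1 = e1 *: x1 -> f1 *m R = e1 *: f1 -> R *m x2 = e2 *: x2 -> f2 *m R = e2 *: f2 ->
  R *m R = x1 *m f1 + x2 *m f2 ->
  eigU phi 1 e1 x1 y -> eigU' phi 1 e1 f1 y -> eigV phi 1 e2 x2 g -> eigV' phi 1 e2 f2 g ->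
  False.
Proof.
move=> hphi s1 s2 gy RE f1x1 f2x2 f1x2 f2x1 Rx1 f1R Rx2 f2R RR U1 U1' V2 V2'.
have s := sgn1 F; have R4 : R *m R *m (R *m R) = R *m R.
  have [C CE] := onto hphi (sgnN s) gy.
  by have [] := opp_structure hn hphi s gy RE CE.
pose W A := exists2 Z, ant R Z & A = R + Z.
case: (rel_irr (U := W) hphi s gy RE).
- move=> A B t [Z aZ ->] [Z' aZ' ->]; exists (Z + t *: (Z' - Z)); last by mring.
  exact: affine_ant.
- move=> A [Z aZ ->]; rewrite /jrel jpDr aZ addr0 /jp.
  by rewrite mulmxDl !mulmxDr R4; mring.
- move=> H; apply: (two_pair_aux hphi s1 s2 gy RE f1x1 f2x2 f1x2 f2x1) => //.
  by move=> Z aZ; apply: H; exists Z.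
- move=> H; have := @two_pair_aux (trl phi) g^T y^T R e2 x2 f2 e1 x1 f1 (presl hphi) s2 s1.
  apply=> //; rewrite ?br_tr //.
  + by rewrite /trl RE outer_tr1.
  + by rewrite addrC.
  + exact/eigV_tr.
  + by apply/eigU'_tr/eigV'_tr.
  + move=> Z aZ h T hg TE; apply: (H (R + Z) _ h^T).
    * by exists Z.
    * by rewrite -br_tr trmxK.
    * by apply: trmx_inj; rewrite -[LHS]/(trl phi T) TE outer_tr1 trmxK.
- move=> H; have [C CE] := onto hphi (sgnN s) gy.
  have : jrel C R by apply: H CE; exists 0; rewrite /ant ?jp0r ?addr0.
  move/(rel_im hphi)/relC; rewrite RE CE => /(rel_opp s gy gy) [E _].
  by move: gy; rewrite E => /eqP; rewrite eq_sym oner_eq0.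
Qed.

(** Biorthogonal eigenpairs are split off the idempotent [R^2]. Each belongs to [y] or to [g], and
    two of them cannot belong to the same one, so three pairs are impossible; [two_pair] excludes
    two. *)
Lemma rank_one phi y g R : pres phi -> br g y = 1 -> phi R = 1 *: (y *m g) ->
  exists e x f, [/\ sgn e, br f x = 1, R *m x = e *: x, f *m R = e *: f & R *m R = x *m f].
Proof.
move=> hphi gy RE; have s := sgn1 F; have y0 := br1_neq0r gy; have g0 := br1_neq0l gy.
have gT0 : g^T != 0 by rewrite trmx_eq0.
have [R4 R20] : R *m R *m (R *m R) = R *m R /\ R *m R != 0.
  have [C CE] := onto hphi (sgnN s) gy.
  by have [] := opp_structure hn hphi s gy RE CE.
have RRR : R *m (R *m R) = R *m R *m R by rewrite mulmxA.
have [e1 [x1 [f1 [s1 f1x1 Rx1 f1R [Px1 f1P]]]]] := ex_eigenpair R4 RRR R4 R20.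
have [E1|E1] := eqVneq (R *m R - x1 *m f1) 0.
  exists e1, x1, f1; split=> //; by move/eqP: E1; rewrite subr_eq0 => /eqP.
have pk e x f : R *m x = e *: x -> f *m R = e *: f -> R *m (x *m f) = (x *m f) *m R.
  by move=> Rx fR; rewrite mulmxA Rx -[RHS]mulmxA fR -scalemxAl -scalemxAr.
have pkP e x f : sgn e -> R *m x = e *: x -> R *m R *m (x *m f) = x *m f.
  by move=> se Rx; rewrite mulmxA (eig_sq se Rx).
set D1 := R *m R - x1 *m f1 in E1.
have D1x : D1 *m x1 = 0 by rewrite mulmxBl Px1 mul_crc f1x1 scale1r subrr.
have f1D : f1 *m D1 = 0 by rewrite mulmxBr f1P mul_rcr f1x1 scale1r subrr.
have D1D1 : D1 *m D1 = D1.
  by rewrite {2}/D1 mulmxBr [D1 *m (x1 *m f1)]mulmxA D1x mul0mx subr0 mulmxBl R4 -mulmxA f1P.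
have RD1 : R *m D1 = D1 *m R by rewrite mulmxBr mulmxBl RRR (pk e1).
have RRD1 : R *m R *m D1 = D1 by rewrite mulmxBr R4 (pkP e1).
have [e2 [x2 [f2 [s2 f2x2 Rx2 f2R [Px2 f2P]]]]] := ex_eigenpair D1D1 RD1 RRD1 E1.
have f1x2 : br f1 x2 = 0 by rewrite -Px2 -brA f1D br0l.
have f2x1 : br f2 x1 = 0 by rewrite -f2P brA D1x br0r.
have nY e x f e' x' f' : sgn e -> br f x = 1 -> br f x' = 0 -> br f' x = 0 ->
    letter phi e x f y -> letter phi e' x' f' y -> False.
  by move=> se; apply: letter_conflict.
have nG e x f e' x' f' : sgn e -> br f x = 1 -> br f x' = 0 -> br f' x = 0 ->
    letter (trl phi) e x f g^T -> letter (trl phi) e' x' f' g^T -> False.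
  by move=> se; apply: letter_conflict => //; apply: presl.
have tri e x f : sgn e -> br f x = 1 -> R *m x = e *: x -> f *m R = e *: f ->
    (eigU phi 1 e x y \/ eigV phi 1 e x g) /\ (eigU' phi 1 e f y \/ eigV' phi 1 e f g).
  move=> se fx Rx fR; split; first exact: (eig_tri hn hphi se gy RE (br1_neq0r fx) Rx).
  exact: (eig_tri' hphi se gy RE (br1_neq0l fx) fR).
have lU e x f : sgn e -> br f x = 1 -> eigU phi 1 e x y -> letter phi e x f y by move=> *; apply: letterU.
have lU' e x f : sgn e -> br f x = 1 -> eigU' phi 1 e f y -> letter phi e x f y by move=> *; apply: letterU'.
have lV e x f : sgn e -> br f x = 1 -> eigV phi 1 e x g -> letter (trl phi) e x f g^T by move=> *; apply: letterV.
have lV' e x f : sgn e -> br f x = 1 -> eigV' phi 1 e f g -> letter (trl phi) e x f g^T by move=> *; apply: letterV'.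
have lett e x f : sgn e -> br f x = 1 -> R *m x = e *: x -> f *m R = e *: f ->
    letter phi e x f y \/ letter (trl phi) e x f g^T.
  move=> se fx Rx fR; case: (tri e x f se fx Rx fR) => [[H|H] _]; [left|right].
    exact: lU.
  exact: lV.
have onlyG e x f : sgn e -> br f x = 1 -> R *m x = e *: x -> f *m R = e *: f ->
    ~ letter phi e x f y -> eigV phi 1 e x g /\ eigV' phi 1 e f g.
  move=> se fx Rx fR nl; case: (tri e x f se fx Rx fR) => H H'; split.
    by case: H => // /lU L; case: nl; apply: L.
  by case: H' => // /lU' L; case: nl; apply: L.
have onlyY e x f : sgn e -> br f x = 1 -> R *m x = e *: x -> f *m R = e *: f ->
    ~ letter (trl phi) e x f g^T -> eigU phi 1 e x y /\ eigU' phi 1 e f y.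
  move=> se fx Rx fR nl; case: (tri e x f se fx Rx fR) => H H'; split.
    by case: H => // /lV L; case: nl; apply: L.
  by case: H' => // /lV' L; case: nl; apply: L.
have [E2|E2] := eqVneq (D1 - x2 *m f2) 0.
  exfalso; have RR : R *m R = x1 *m f1 + x2 *m f2 by mlc E2.
  case: (lett e1 x1 f1 s1 f1x1 Rx1 f1R) => L1.
  - have [V2 V2'] := onlyG _ _ _ s2 f2x2 Rx2 f2R (nY _ _ _ _ _ _ s1 f1x1 f1x2 f2x1 L1).
    have [U1 U1'] := onlyY _ _ _ s1 f1x1 Rx1 f1R (nG _ _ _ _ _ _ s2 f2x2 f2x1 f1x2 (lV _ _ _ s2 f2x2 V2)).
    exact: (two_pair hphi s1 s2 gy RE f1x1 f2x2).
  - have [U2 U2'] := onlyY _ _ _ s2 f2x2 Rx2 f2R (nG _ _ _ _ _ _ s1 f1x1 f1x2 f2x1 L1).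
    have [V1 V1'] := onlyG _ _ _ s1 f1x1 Rx1 f1R (nY _ _ _ _ _ _ s2 f2x2 f2x1 f1x2 (lU _ _ _ s2 f2x2 U2)).
    by apply: (two_pair hphi s2 s1 gy RE f2x2 f1x1) => //; rewrite addrC.
exfalso; set D2 := D1 - x2 *m f2 in E2.
have D2x : D2 *m x2 = 0 by rewrite mulmxBl Px2 mul_crc f2x2 scale1r subrr.
have f2D : f2 *m D2 = 0 by rewrite mulmxBr f2P mul_rcr f2x2 scale1r subrr.
have D2x1 : D2 *m x1 = 0 by rewrite mulmxBl D1x mul_crc f2x1 scale0r subrr.
have f1D2 : f1 *m D2 = 0 by rewrite mulmxBr f1D mul_rcr f1x2 scale0r subrr.
have D2D2 : D2 *m D2 = D2.
  by rewrite {2}/D2 mulmxBr [D2 *m (x2 *m f2)]mulmxA D2x mul0mx subr0 mulmxBl D1D1 -mulmxA f2P.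
have RD2 : R *m D2 = D2 *m R by rewrite mulmxBr mulmxBl RD1 (pk e2).
have RRD2 : R *m R *m D2 = D2 by rewrite mulmxBr RRD1 (pkP e2).
have [e3 [x3 [f3 [s3 f3x3 Rx3 f3R [Px3 f3P]]]]] := ex_eigenpair D2D2 RD2 RRD2 E2.
have f1x3 : br f1 x3 = 0 by rewrite -Px3 -brA f1D2 br0l.
have f3x1 : br f3 x1 = 0 by rewrite -f3P brA D2x1 br0r.
have f2x3 : br f2 x3 = 0 by rewrite -Px3 -brA f2D br0l.
have f3x2 : br f3 x2 = 0 by rewrite -f3P brA D2x br0r.
case: (lett _ _ _ s1 f1x1 Rx1 f1R) => L1; case: (lett _ _ _ s2 f2x2 Rx2 f2R) => L2;
  case: (lett _ _ _ s3 f3x3 Rx3 f3R) => L3.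
- exact: nY L1 L2.
- exact: nY L1 L2.
- exact: nY L1 L3.
- exact: nG L2 L3.
- exact: nY L2 L3.
- exact: nG L1 L3.
- exact: nG L1 L2.
- exact: nG L1 L2.
Qed.
End Duality.

(** * Which factor determines the eigencolumn and the eigenrow *)

Section Kinds.
Variables (F : numClosedFieldType) (n : nat).
Hypothesis hn : (2 < n)%N.
Implicit Types (A B C D R S T M N X Z : 'M[F]_n) (x y z u v w : 'cV[F]_n) (f g h r : 'rV[F]_n) (d e : F).
Implicit Types phi : 'M[F]_n -> 'M[F]_n.

Lemma trrK phi : trr (trr phi) = phi.
Proof. by apply: funext => X; rewrite /trr trmxK. Qed.

Lemma par phi y g R x e x' e' : pres phi -> br g y = 1 -> phi R = 1 *: (y *m g) ->
  sgn e -> sgn e' -> x != 0 -> x' != 0 -> R *m x = e *: x -> R *m x' = e' *: x' ->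
  e' = e /\ exists2 a, a != 0 & x' = a *: x.
Proof.
move=> hphi gy RE se se' x0 x'0 Rx Rx'.
have [e1 [x1 [f1 [s1 fx Rx1 f1R RR]]]] := rank_one hn hphi gy RE.
have prop z d : sgn d -> z != 0 -> R *m z = d *: z -> d = e1 /\ exists2 a, a != 0 & z = a *: x1.
  move=> sd z0 Rz; have E : z = br f1 z *: x1.
    by rewrite -[LHS](eig_sq sd Rz) RR mul_crc.
  have b0 : br f1 z != 0 by apply: contraNneq z0 => b0; rewrite E b0 scale0r.
  split; last by exists (br f1 z).
  by apply: (mulIf b0); rewrite -brZr -Rz -brA f1R brZl.
have [-> [a a0 ->]] := prop _ _ se x0 Rx; have [-> [b b0 ->]] := prop _ _ se' x'0 Rx'.
by split=> //; exists (b / a); rewrite ?mulf_neq0 ?invr_eq0 // scalerA divfK.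
Qed.

Lemma par' phi y g R f e f' e' : pres phi -> br g y = 1 -> phi R = 1 *: (y *m g) ->
  sgn e -> sgn e' -> f != 0 -> f' != 0 -> f *m R = e *: f -> f' *m R = e' *: f' ->
  e' = e /\ exists2 a, a != 0 & f' = a *: f.
Proof.
move=> hphi gy RE se se' f0 f'0 fR f'R.
have [|||||||E [a a0 Ea]] := @par _ y g R^T f^T e f'^T e' (presr hphi) gy => //.
- by rewrite /trr trmxK.
- by rewrite trmx_eq0.
- by rewrite trmx_eq0.
- by rewrite -trmx_mul fR linearZ.
- by rewrite -trmx_mul f'R linearZ.
by split=> //; exists a => //; apply: trmx_inj; rewrite Ea linearZ.
Qed.

Lemma eigV_unique phi e x g e' k : pres phi -> sgn e -> sgn e' -> x != 0 -> g != 0 -> k != 0 ->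
  eigV phi 1 e x g -> eigV phi 1 e' x k -> exists a, k = a *: g.
Proof.
move=> hphi se se' x0 g0 k0 /eigV_tr H /eigV_tr H'.
have [||a E] := eigU_unique hn (presl hphi) se se' x0 _ H H'; rewrite ?trmx_eq0 //.
by exists a; apply: trmx_inj; rewrite E linearZ.
Qed.
Lemma eigU'_unique phi e f y e' w : pres phi -> sgn e -> sgn e' -> f != 0 -> y != 0 -> w != 0 ->
  eigU' phi 1 e f y -> eigU' phi 1 e' f w -> exists a, w = a *: y.
Proof.
move=> hphi se se' f0 y0 w0 /eigU'_tr H /eigU'_tr H'.
by apply: (eigU_unique hn (presr hphi) se se' _ y0 H H') => //; rewrite trmx_eq0.
Qed.
Lemma eigV'_unique phi e f g e' k : pres phi -> sgn e -> sgn e' -> f != 0 -> g != 0 -> k != 0 ->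
  eigV' phi 1 e f g -> eigV' phi 1 e' f k -> exists a, k = a *: g.
Proof.
move=> hphi se se' f0 g0 k0 /eigV'_tr H /eigV'_tr H'.
have [|||a E] := eigU_unique hn (presl (presr hphi)) se se' _ _ H H'; rewrite ?trmx_eq0 //.
by exists a; apply: trmx_inj; rewrite E linearZ.
Qed.

Lemma eigV_scaler phi e x g a : eigV phi 1 e x g -> eigV phi 1 e (a *: x) g.
Proof. by move=> /eigV_tr H; apply/eigV_tr; apply: eigU_scaler. Qed.
Lemma eigU'_scaler phi e f y a : eigU' phi 1 e f y -> eigU' phi 1 e (a *: f) y.
Proof. by move=> /eigU'_tr H; apply/eigU'_tr; rewrite linearZ; apply: eigU_scaler. Qed.
Lemma eigV'_scaler phi e f g a : eigV' phi 1 e f g -> eigV' phi 1 e (a *: f) g.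
Proof. by move=> /eigV'_tr H; apply/eigV'_tr; rewrite linearZ; apply: eigU_scaler. Qed.
Lemma eigU'_scale phi e f y a : a != 0 -> eigU' phi 1 e f y -> eigU' phi 1 e f (a *: y).
Proof. by move=> a0 /eigU'_tr H; apply/eigU'_tr; apply: eigU_scale. Qed.
Lemma eigV'_scale phi e f g a : a != 0 -> eigV' phi 1 e f g -> eigV' phi 1 e f (a *: g).
Proof. by move=> a0 /eigV'_tr H; apply/eigV'_tr; rewrite linearZ; apply: eigU_scale. Qed.

Lemma reach phi e x f y : pres phi -> sgn e -> br f x = 1 -> y != 0 -> letter phi e x f y ->
  exists g, br g y = 1 /\ (eigV phi 1 e x g \/ eigV' phi 1 e f g).
Proof.
move=> hphi se fx y0 L; have s := sgn1 F; set B := phi (e *: (x *m f)).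
have By : B *m y = y by have := L 1 s; rewrite mul1r scale1r.
have By' : phi (- e *: (x *m f)) *m y = - y by have := L (-1) (sgnN s); rewrite mulN1r scaleN1r.
have B4 : B *m B *m (B *m B) = B *m B.
  apply: rel_self; apply: (rel_im hphi); apply: rel_rowP => //.
  by rewrite -scalemxAl mul_crc fx scale1r.
have BBy : B *m B *m y = y by rewrite -mulmxA !By.
have BBBy : B *m B *m B *m y = y by rewrite -mulmxA By.
(* [(B^2 + B^3) / 2] is the spectral projection of [B] for the eigenvalue [1], so [g] is a left
   eigenrow, normalized on [y]. *)
have [l ly] := ex_br1 y0; pose g := 2%:R^-1 *: (l *m (B *m B + B *m B *m B)).
have gB : g *m B = g.
  by rewrite /g -scalemxAl -[l *m _ *m B]mulmxA mulmxDl cub_R3R // addrC.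
have gy : br g y = 1.
  rewrite /g brZl brA mulmxDl BBy BBBy brDr ly -[1 + 1]/(2%:R) mulVf //; exact: two_neq0.
exists g; split=> //; have x0 := br1_neq0r fx; have f0 := br1_neq0l fx.
pose W A := exists2 z, br g z = 1 & A = 1 *: (z *m g).
have R0 z R : br g z = 1 -> phi R = 1 *: (z *m g) -> R <> 0.
  move=> gz RE R0; move: RE; rewrite R0 (pres0 hphi) => /esym/eqP.
  by rewrite (negPf (sgn_scale_neq0 s gz)).
case: (@irr_target F n phi e x f W hphi se fx).
- exact: affine_col.
- by move=> A [z gz ->]; apply/relC; apply: rel_colP => //; rewrite scale1r.
- by move=> A [z gz ->]; apply: onto.
- move=> H; left=> z R gz RE; case: (@rel_row F n x R e x0 se) => // [f' f'x|/(R0 z R gz RE)//].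
  by apply: (rel_pre hphi); apply: H => //; exists z.
- move=> H; right=> z R gz RE; case: (@rel_col F n f R e f0 se) => // [x' fx'|/(R0 z R gz RE)//].
  by apply: (rel_pre hphi); apply: H => //; exists z.
- move=> H; exfalso.
  case: (@rel_col F n g (phi (- e *: (x *m f))) 1 (br1_neq0l gy) s) => [z gz|E|E].
  + by apply/relC; apply: H; exists z.
  + have := congr1 (fun k : 'rV[F]_n => br k y) E.
    rewrite brA By' brNr scale1r gy => /eqP.
    by rewrite -subr_eq0 -opprD oppr_eq0 -mulr2n mulrn_eq0 oner_eq0.
  + by move: By'; rewrite E mul0mx => /esym/eqP; rewrite oppr_eq0 (negPf y0).
Qed.

(** By uniqueness [x] and [f] serve at most one row [h t] each, so one of [t = 1, 2, 3] is free of
    both. For this [t] the eigenpair of a preimage of [t^-1 w (h t)] depends on [w] alone. The row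
    [g] given by [reach] makes [x] or [f] an eigenvector for [w g] too, so it serves both [y] and
    [w], which are independent. *)
Lemma no_YY phi e x f y : pres phi -> sgn e -> br f x = 1 -> y != 0 ->
  eigU phi 1 e x y -> eigU' phi 1 e f y -> False.
Proof.
move=> hphi se fx y0 U1 U1'; have s := sgn1 F.
have x0 := br1_neq0r fx; have f0 := br1_neq0l fx.
have [g [gy Vg]] := reach hphi se fx y0 (letterU hn hphi se y0 fx U1).
have [p [p0 gp _]] := ex_col_kill hn g g.
pose w := y + p; have gw : br g w = 1 by rewrite /w brDr gp addr0.
have w0 := br1_neq0r gw.
have wy a : w <> a *: y.
  move=> E; have a1 : a = 1 by move: gw; rewrite E brZr gy mulr1.
  by move/eqP: p0; apply; move: E; rewrite a1 /w scale1r => E; mlc E.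
clearbody w.
have [hb [hby hbw]] : exists h, br h y = 0 /\ br h w = 1 by apply: ex_sep => a; apply: wy.
have [ha [haw hay]] : exists h, br h w = 0 /\ br h y = 1.
  apply: ex_sep => a E; have a0 : a != 0 by apply: contraNneq y0 => a0; rewrite E a0 scale0r.
  by apply: (wy a^-1); rewrite E scalerA mulVf // scale1r.
pose h t := ha + t *: hb.
have hy t : br (h t) y = 1 by rewrite /h !brE hay hby mulr0 addr0.
have hw t : br (h t) w = t by rewrite /h !brE haw hbw mulr1 add0r.
have hinj t t' a : h t = a *: h t' -> t = t'.
  move=> E; have a1 : a = 1 by have := hy t; rewrite E brZl hy mulr1.
  by have := hw t; rewrite E a1 scale1r hw.
pose P t := exists2 e', sgn e' & eigV phi 1 e' x (h t).
pose P' t := exists2 e', sgn e' & eigV' phi 1 e' f (h t).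
have Pinj t t' : P t -> P t' -> t = t'.
  move=> [e1 s1 V1] [e2 s2 V2].
  have [a E] := eigV_unique hphi s2 s1 x0 (br1_neq0l (hy t')) (br1_neq0l (hy t)) V2 V1.
  exact: hinj E.
have P'inj t t' : P' t -> P' t' -> t = t'.
  move=> [e1 s1 V1] [e2 s2 V2].
  have [a E] := eigV'_unique hphi s2 s1 f0 (br1_neq0l (hy t')) (br1_neq0l (hy t)) V2 V1.
  exact: hinj E.
have natinj (i j : nat) : i%:R = j%:R :> F -> i = j.
  by move/eqP; rewrite eqr_nat => /eqP.
have [t [t0 nP nP']] : exists t, [/\ t != 0, ~ P t & ~ P' t].
  apply: contrapT => no.
  have alt (i : nat) : (0 < i)%N -> P i%:R \/ P' i%:R.
    move=> i0; apply: contrapT => nPP; apply: no; exists i%:R; split.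
    - by rewrite pnatr_eq0 -lt0n.
    - by move=> ?; apply: nPP; left.
    - by move=> ?; apply: nPP; right.
  case: (alt 1%N isT) => [a1|a1]; case: (alt 2%N isT) => [a2|a2]; case: (alt 3%N isT) => [a3|a3];
    first [by have := natinj _ _ (Pinj _ _ a1 a2) | by have := natinj _ _ (Pinj _ _ a1 a3)
      | by have := natinj _ _ (Pinj _ _ a2 a3) | by have := natinj _ _ (P'inj _ _ a1 a2)
      | by have := natinj _ _ (P'inj _ _ a1 a3) | by have := natinj _ _ (P'inj _ _ a2 a3)].
have hq : br (h t) (t^-1 *: w) = 1 by rewrite brZr hw mulVf.
have [R RE] := onto hphi s hq.
have [e1 [x1 [f1 [s1 fx1 Rx1 f1R _]]]] := rank_one hn hphi hq RE.
have x10 := br1_neq0r fx1; have f10 := br1_neq0l fx1.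
have tw : t *: (t^-1 *: w) = w by rewrite scalerA mulfV // scale1r.
have [T TE] := onto hphi s (hy t).
have U2 : eigU phi 1 e1 x1 w.
  case: (eig_tri hn hphi s1 hq RE x10 Rx1) => [H|H]; first by rewrite -tw; apply: eigU_scale.
  exfalso; apply: nP; exists e1 => //.
  have [_ [a a0 E]] := par hphi (hy t) TE s1 se x10 x0 (H _ _ (hy t) TE) (U1 _ _ (hy t) TE).
  by rewrite E; apply: eigV_scaler.
have U2' : eigU' phi 1 e1 f1 w.
  case: (eig_tri' hn hphi s1 hq RE f10 f1R) => [H|H]; first by rewrite -tw; apply: eigU'_scale.
  exfalso; apply: nP'; exists e1 => //.
  have [_ [a a0 E]] := par' hphi (hy t) TE s1 se f10 f0 (H _ _ (hy t) TE) (U1' _ _ (hy t) TE).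
  by rewrite E; apply: eigV'_scaler.
have [S SE] := onto hphi s gw.
case: Vg => V.
- have [_ [a a0 E]] := par hphi gw SE s1 se x10 x0 (U2 _ _ gw SE) (V _ _ gw SE).
  have U3 : eigU phi 1 e1 x w by rewrite E; apply: eigU_scaler.
  by have [b] := eigU_unique hn hphi se s1 x0 y0 U1 U3 w0; apply: wy.
- have [_ [a a0 E]] := par' hphi gw SE s1 se f10 f0 (U2' _ _ gw SE) (V _ _ gw SE).
  have U3 : eigU' phi 1 e1 f w by rewrite E; apply: eigU'_scaler.
  by have [b] := eigU'_unique hphi se s1 f0 y0 w0 U1' U3; apply: wy.
Qed.

Lemma no_GG phi e x f g : pres phi -> sgn e -> br f x = 1 -> g != 0 ->
  eigV phi 1 e x g -> eigV' phi 1 e f g -> False.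
Proof.
move=> hphi se fx g0 /eigV_tr V1 /eigV'_tr V1'.
apply: (no_YY (presl hphi) se fx (y := g^T)) => //; first by rewrite trmx_eq0.
exact/eigU'_tr.
Qed.

Definition kind1 phi e y g := exists x f, [/\ br f x = 1, eigU phi 1 e x y & eigV' phi 1 e f g].

Lemma kind1_row phi e y g h : pres phi -> sgn e -> br h y = 1 -> kind1 phi e y g -> kind1 phi e y h.
Proof.
move=> hphi se hy [x [f [fx U1 _]]]; have s := sgn1 F.
have y0 := br1_neq0r hy; have x0 := br1_neq0r fx.
have [R RE] := onto hphi s hy.
have [e1 [x1 [f1 [s1 fx1 Rx1 f1R _]]]] := rank_one hn hphi hy RE.
have [ee [a a0 E]] := par hphi hy RE se s1 x0 (br1_neq0r fx1) (U1 _ _ hy RE) Rx1.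
have U2 : eigU phi 1 e x1 y by rewrite E; apply: eigU_scaler.
rewrite ee in s1 Rx1 f1R.
case: (eig_tri' hn hphi se hy RE (br1_neq0l fx1) f1R) => H; last by exists x1, f1.
by case: (no_YY hphi se fx1 y0 U2 H).
Qed.

Lemma kind1_col phi e y g z : pres phi -> sgn e -> br g z = 1 -> kind1 phi e y g -> kind1 phi e z g.
Proof.
move=> hphi se gz [x [f [fx _ V1]]]; have s := sgn1 F.
have g0 := br1_neq0l gz; have f0 := br1_neq0l fx.
have [R RE] := onto hphi s gz.
have [e1 [x1 [f1 [s1 fx1 Rx1 f1R _]]]] := rank_one hn hphi gz RE.
have [ee [a a0 E]] := par' hphi gz RE se s1 f0 (br1_neq0l fx1) (V1 _ _ gz RE) f1R.
have V2 : eigV' phi 1 e f1 g by rewrite E; apply: eigV'_scaler.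
rewrite ee in s1 Rx1 f1R.
case: (eig_tri hn hphi se gz RE (br1_neq0r fx1) Rx1) => H; first by exists x1, f1.
by case: (no_GG hphi se fx1 g0 H V2).
Qed.

(** Pairs sharing a row or a column are linked by [kind1_row] and [kind1_col]. For independent [y]
    and [z] the row [h1 + h2], equal to [1] on both, makes the link. *)
Lemma kind1_all phi e y g : pres phi -> sgn e -> br g y = 1 -> kind1 phi e y g ->
  forall z k, br k z = 1 -> kind1 phi e z k.
Proof.
move=> hphi se gy K z k kz; have z0 := br1_neq0r kz; have y0 := br1_neq0r gy.
have [[c E]|nzy] := pselect (exists c, z = c *: y).
  have c0 : c != 0 by apply: contraNneq z0 => c0; rewrite E c0 scale0r.
  have [|x [f [fx U1 V1]]] := kind1_row hphi se (_ : br (c *: k) y = 1) K.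
    by rewrite brZl -brZr -E.
  exists x, f; split=> //; first by rewrite E; apply: eigU_scale.
  have -> : k = c^-1 *: (c *: k) by rewrite scalerA mulVf // scale1r.
  by apply: eigV'_scale => //; rewrite invr_eq0.
have [h1 [h1y h1z]] : exists h, br h y = 0 /\ br h z = 1.
  by apply: ex_sep => a E; apply: nzy; exists a.
have [h2 [h2z h2y]] : exists h, br h z = 0 /\ br h y = 1.
  apply: ex_sep => a E; apply: nzy; exists (a^-1).
  rewrite E scalerA mulVf ?scale1r //.
  by apply: contraNneq y0 => a0; rewrite E a0 scale0r.
have hy : br (h1 + h2) y = 1 by rewrite brDl h1y h2y add0r.
have hz : br (h1 + h2) z = 1 by rewrite brDl h1z h2z addr0.
exact: (kind1_row hphi se kz (kind1_col hphi se hz (kind1_row hphi se hy K))).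
Qed.

Theorem kind_total phi : pres phi -> exists2 e, sgn e &
  (forall y g, br g y = 1 -> kind1 phi e y g) \/ (forall y g, br g y = 1 -> kind1 (trr phi) e y g).
Proof.
move=> hphi; have s := sgn1 F.
have [p [p0 _ _]] := ex_row_kill hn (0 : 'cV[F]_n) 0; have [y py] := ex_br1l p0.
have [R RE] := onto hphi s py.
have [e [x [f [se fx Rx fR _]]]] := rank_one hn hphi py RE.
exists e => //.
case: (eig_tri hn hphi se py RE (br1_neq0r fx) Rx) => H;
case: (eig_tri' hn hphi se py RE (br1_neq0l fx) fR) => H'.
- by case: (no_YY hphi se fx (br1_neq0r py) H H').
- by left; apply: (kind1_all hphi se py _); exists x, f.
- right; apply: (kind1_all (presr hphi) se py _); exists f^T, x^T; split.
  + by rewrite br_tr.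
  + exact/eigU'_tr.
  + by apply/eigV'_tr; rewrite trrK trmxK; apply/eigV_tr.
- by case: (no_GG hphi se fx (br1_neq0l py) H H').
Qed.
End Kinds.

(** * Vanishing of the nilpotent part *)

Section Exact.
Variables (F : numClosedFieldType) (n : nat).
Hypothesis hn : (2 < n)%N.
Implicit Types (A B C D R S T M N X Z : 'M[F]_n) (x y z u v w : 'cV[F]_n) (f g h r : 'rV[F]_n) (d e b : F).
Implicit Types phi : 'M[F]_n -> 'M[F]_n.

Lemma two_inj (V : lmodType F) (u v : V) : 2%:R *: u = 2%:R *: v -> u = v.
Proof. by apply: scalerI; rewrite two_neq0. Qed.

Lemma nil_part_col N X x f x' f' b : br f x = 1 -> f *m N = 0 -> N *m x = 0 -> N *m N = 0 ->
  X *m X = x' *m f' -> br f' x = 0 ->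
  jrel (x *m f + N) X -> jrel (- (x *m f) + b *: N) X ->
  [/\ br f (X *m x) = 0, X *m (N *m (X *m x)) = 2%:R *: (X *m x) & (b - 1) *: (X *m x) = 0].
Proof.
move=> fx fN Nx NN XX f'x H1 H2; set u := X *m x.
have Xu : X *m u = 0 by rewrite mulmxA XX mul_crc f'x scale0r.
pose a := N *m u; pose v := X *m a; pose w := N *m v.
pose s := br f u; pose c := br f v.
have Na : N *m a = 0 by rewrite mulmxA NN mul0mx.
have Nw : N *m w = 0 by rewrite mulmxA NN mul0mx.
have fa : br f a = 0 by rewrite -brA fN br0l.
have fw : br f w = 0 by rewrite -brA fN br0l.
have act d e z : (d *: (x *m f) + e *: N) *m z = (d * br f z) *: x + e *: (N *m z).
  by rewrite mulmxDl -!scalemxAl mul_crc scalerA.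
(* Both hypotheses are instances, for [(d, e)] equal to [(1, 1)] and [(-1, b)], evaluated on the
   column [x]. Applying [f] to them gives [F1] and [F2], applying [N] gives [N1] and [N2]. *)
have key d e : jrel (d *: (x *m f) + e *: N) X ->
    (d * d * (s * s)) *: x + (d * e * s) *: a + (e * (d * c)) *: x + (e * e) *: w +
    (d * d * (2%:R * s)) *: u + (d * e) *: v = 2%:R *: ((d * s) *: x + e *: a + d *: u).
  rewrite /jrel => E; have := congr1 (mulmx^~ x) E.
  have Px z : jp (d *: (x *m f) + e *: N) X *m z =
      (d * br f (X *m z)) *: x + e *: (N *m (X *m z)) + X *m ((d * br f z) *: x + e *: (N *m z)).
    by rewrite /jp mulmxDl -!mulmxA !act.
  have PPx : jp (d *: (x *m f) + e *: N) X *m x = (d * s) *: x + e *: a + d *: u.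
    by rewrite Px -/u -/s -/a fx Nx mulr1 scaler0 addr0 -scalemxAr -/u.
  rewrite -mulmxA -scalemxAl PPx => {}E; rewrite -E Px.
  have -> : X *m ((d * s) *: x + e *: a + d *: u) = (d * s) *: u + e *: v.
    by rewrite !mulmxDr -!scalemxAr Xu scaler0 addr0.
  have -> : N *m ((d * s) *: u + e *: v) = (d * s) *: a + e *: w.
    by rewrite mulmxDr -!scalemxAr.
  have -> : N *m ((d * s) *: x + e *: a + d *: u) = d *: a.
    by rewrite !mulmxDr -!scalemxAr Nx Na !scaler0 !add0r.
  rewrite mulmxDr -!scalemxAr -/v -/u !brE fx fa -/s -/c; mring.
have E1 := key 1 1; have E2 := key (-1) b.
rewrite !scale1r in E1; rewrite scaleN1r in E2.
move: (E1 H1) (E2 H2) => {}E1 {}E2.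
have F1 : 3%:R * (s * s) + 2%:R * c = 4%:R * s.
  have := congr1 (br f) E1; rewrite !brE fx fa fw -/s -/c => E; lc E.
have F2 : 3%:R * (s * s) - 2%:R * (b * c) = - (4%:R * s).
  have := congr1 (br f) E2; rewrite !brE fx fa fw -/s -/c => E; lc E.
have N1 : w = (2%:R - 2%:R * s) *: a.
  have := congr1 (mulmx N) E1; rewrite !mulmxDr -!scalemxAr !mulmxDr -!scalemxAr Nx Na Nw.
  rewrite -/a -/w => E; mlc E.
have N2 : b *: w = (2%:R + 2%:R * s) *: a.
  have := congr1 (mulmx N) E2; rewrite !mulmxDr -!scalemxAr !mulmxDr -!scalemxAr Nx Na Nw.
  rewrite -/a -/w => E; mlcN E.
have [s0 c0] : s = 0 /\ c = 0.
  have [a0|a0] := eqVneq a 0.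
    have c0 : c = 0 by rewrite /c /v a0 mulmx0 br0r.
    split=> //; have /eqP : 8%:R * s = 0.
      by rewrite c0 in F1 F2; lc2 (esym F1) F2.
    by rewrite mulf_eq0 pnatr_eq0 => /eqP.
  have Eb : s * (1 + b) = b - 1.
    move/eqP: N2; rewrite N1 scalerA -subr_eq0 -scalerBl scaler_eq0 (negPf a0) orbF => /eqP E.
    have e2 := two_neq0 F; apply: (mulfI e2); lcN E.
  have /eqP : s * s * (1 + b) = 0.
    have E : (4%:R * s) * (s * (1 + b)) = (4%:R * s) * (b - 1) by rewrite Eb.
    have E' : b * (3%:R * (s * s) + 2%:R * c) = b * (4%:R * s) by rewrite F1.
    have E3 := etrans (congr2 +%R E' F2) (erefl _).
    by lc2 E (esym E3).
  rewrite !mulf_eq0 orbb => /orP [/eqP s0|/eqP b1].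
    split=> //; have /eqP : 2%:R * c = 0 by rewrite s0 in F1; lc F1.
    by rewrite mulf_eq0 (negPf (two_neq0 F)) => /eqP.
  have b1' : b = -1 by lc b1.
  exfalso; have := two_neq0 F; move/eqP; apply; rewrite b1 mulr0 in Eb; rewrite b1' in Eb.
  by lc Eb.
rewrite s0 in N1 N2 E1 E2; rewrite c0 in E1 E2.
have vu : v = 2%:R *: u by rewrite N1 in E1; mlc E1.
split; [exact: s0|exact: vu|].
have ba : b *: a = a.
  by apply: two_inj; move: N2; rewrite N1 => E; mlc E.
apply: two_inj; rewrite scaler0; move: E2; rewrite N1 vu => E2.
have bba : b *: (b *: a) = b *: a by rewrite ba.
have bba2 : (2%:R * 1) *: (b *: (b *: a)) = (2%:R * 1) *: (b *: a) by rewrite !ba.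
by mlc2 bba2 (esym E2).
Qed.

Lemma nil_part_row N X x f x' f' b : br f x = 1 -> f *m N = 0 -> N *m x = 0 -> N *m N = 0 ->
  X *m X = x' *m f' -> br f x' = 0 ->
  jrel (x *m f + N) X -> jrel (- (x *m f) + b *: N) X ->
  f *m X *m N *m X = 2%:R *: (f *m X) /\ (b - 1) *: (f *m X) = 0.
Proof.
move=> fx fN Nx NN XX fx' H1 H2.
have [||||||||_ E1 E2] := @nil_part_col N^T X^T f^T x^T f'^T x'^T b.
- by rewrite br_tr.
- by rewrite -trmx_mul Nx trmx0.
- by rewrite -trmx_mul fN trmx0.
- by rewrite -trmx_mul NN trmx0.
- by rewrite -!trmx_mul XX.
- by rewrite br_tr.
- by rewrite -trmx_mul -linearD /=; apply/rel_tr.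
- by rewrite -trmx_mul -linearN -linearZ -linearD /=; apply/rel_tr.
split; apply: trmx_inj.
- by rewrite !trmx_mul E1 -trmx_mul linearZ.
- by rewrite linearZ /= trmx_mul E2 trmx0.
Qed.

(** If [b <> 1], then [u = X x] and [r = f X] vanish and [x f] drops out. If [b = 1], adding the two
    relations gives [G^2 = 2G - u r] for [G = jp N X], which commutes with [N]. So [N] commutes with
    [u r]; were this nonzero, [N u] would be a multiple of [u], hence zero, against [X N u = 2u]. *)
Lemma nil_part_rel N X x f x' f' b : br f x = 1 -> f *m N = 0 -> N *m x = 0 -> N *m N = 0 ->
  X *m X = x' *m f' -> br f x' = 0 -> br f' x = 0 ->
  jrel (x *m f + N) X -> jrel (- (x *m f) + b *: N) X -> jrel N X.
Proof.
move=> fx fN Nx NN XX fx' f'x H1 H2.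
have [U0 U1 U2] := nil_part_col fx fN Nx NN XX f'x H1 H2.
have [V1 V2] := nil_part_row fx fN Nx NN XX fx' H1 H2.
set u := X *m x in U1 U2; set r := f *m X in V1 V2.
have mE : jp (x *m f) X = x *m r + u *m f by rewrite /jp !mulmxA.
have [b1|b1] := eqVneq (b - 1) 0; last first.
  have u0 : u = 0 by move/eqP: U2; rewrite scaler_eq0 (negPf b1) => /eqP.
  have r0 : r = 0 by move/eqP: V2; rewrite scaler_eq0 (negPf b1) => /eqP.
  by move: H1; rewrite /jrel jpDl mE u0 r0 mulmx0 mul0mx addr0 add0r.
have bE : b = 1 by move/eqP: b1; rewrite subr_eq0 => /eqP.
rewrite bE scale1r in H2.
have NG : N *m jp N X = jp N X *m N.
  by rewrite /jp mulmxDr mulmxDl !mulmxA NN mul0mx add0r -!mulmxA NN !mulmx0 addr0.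
move: H1 H2; rewrite /jrel !jpDl jpNl mE; set G := jp N X in NG *; set m0 := x *m r + u *m f => H1 H2.
have ru : br r u = 0.
  by rewrite /r brA /u mulmxA XX mul_crc f'x scale0r br0r.
have rx : br r x = 0 by rewrite /r brA.
have mm : m0 *m m0 = u *m r.
  rewrite /m0 mulmxDl !mulmxDr !mul_crcr rx ru fx U0 !scale0r scale1r; mring.
have GG : G *m G = 2%:R *: G - u *m r.
  clearbody m0 G; apply: two_inj.
  move: H1 H2; rewrite !mulmxDl !mulmxDr !mulmxN !mulNmx opprK mm => H1 H2.
  mlc2 H1 H2.
have GG0 : u *m r = 0 -> G *m G = 2%:R *: G by rewrite GG => ->; rewrite subr0.
have [u0|u0] := eqVneq u 0; first by apply: GG0; rewrite u0 mul0mx.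
have [r0|r0] := eqVneq r 0; first by apply: GG0; rewrite r0 mulmx0.
exfalso; have [v rv] := ex_br1l r0.
have comm : N *m (u *m r) = u *m r *m N.
  have -> : u *m r = 2%:R *: G - G *m G by rewrite GG; mring.
  by rewrite mulmxBr mulmxBl -scalemxAr -scalemxAl NG mulmxA NG -!mulmxA NG.
have Nu : N *m u = br (r *m N) v *: u.
  have := congr1 (mulmx^~ v) comm; rewrite mulmxA mul_crc rv scale1r => ->.
  by rewrite -[u *m r *m N]mulmxA mul_crc.
have Nu0 : N *m u = 0.
  have := congr1 (mulmx N) Nu; rewrite mulmxA NN mul0mx -scalemxAr {1}Nu => /esym/eqP.
  by rewrite !scaler_eq0 (negPf u0) orbF orbb => /eqP k0; rewrite Nu k0 scale0r.
by move/eqP: U1; rewrite Nu0 mulmx0 eq_sym scaler_eq0 (negPf u0) (negPf (two_neq0 F)).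
Qed.

Lemma sq_opp R X b : R *m R *m (R *m R) = R *m R ->
  X = - (R *m R *m R) + b *: (R - R *m R *m R) -> X *m X = R *m R.
Proof.
move=> R4 E; set R3 := R *m R *m R in E; set N := R - R3 in E.
have R3R3 : R3 *m R3 = R *m R by rewrite {1}/R3 -mulmxA cub_RR3 // R4.
have RN : R *m N = 0 by rewrite mulmxBr cub_RR3 // subrr.
have NR : N *m R = 0 by rewrite mulmxBl cub_R3R // subrr.
have R3N : R3 *m N = 0 by rewrite /R3 -mulmxA RN mulmx0.
have NR3 : N *m R3 = 0 by rewrite /R3 !mulmxA NR !mul0mx.
have NN : N *m N = 0 by rewrite {1}/N mulmxBl RN R3N subrr.
clearbody N R3; rewrite E mulmxDl !mulmxDr !mulNmx !mulmxN -!scalemxAl -!scalemxAr.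
by rewrite R3R3 R3N NR3 NN !scaler0 !oppr0 opprK !addr0.
Qed.

Section Kind1.
Variable phi : 'M[F]_n -> 'M[F]_n.
Hypothesis hphi : pres phi.
Hypothesis hk : forall y g, br g y = 1 -> kind1 phi 1 y g.

Lemma kind1_eig y g R : br g y = 1 -> phi R = 1 *: (y *m g) ->
  exists x f, [/\ br f x = 1, R *m R = x *m f, R *m x = x, f *m R = f &
    eigU phi 1 1 x y /\ eigV' phi 1 1 f g].
Proof.
move=> gy RE; have s := sgn1 F; have [x [f [fx U1 V1]]] := hk gy.
have [e [x0 [f0 [se fx0 Rx0 f0R RR]]]] := rank_one hn hphi gy RE.
have Rx : R *m x = 1 *: x by apply: U1 gy RE.
have fR : f *m R = 1 *: f by apply: V1 gy RE.
have Ex : x = br f0 x *: x0 by rewrite -[LHS](eig_sq s Rx) RR mul_crc.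
have fRR : f *m (R *m R) = f by rewrite mulmxA fR -scalemxAl fR !scale1r.
have Ef : f = br f x0 *: f0 by rewrite -[LHS]fRR RR mul_rcr.
have cc : br f x0 * br f0 x = 1.
  by rewrite -fx [in RHS]Ex brZr mulrC.
exists x, f; split; rewrite ?Rx ?fR ?scale1r //.
by rewrite RR {1}Ex {1}Ef -scalemxAl -scalemxAr scalerA mulrC cc scale1r.
Qed.

Lemma kind1_sq d y g X : sgn d -> br g y = 1 -> phi X = d *: (y *m g) ->
  exists x f, [/\ br f x = 1, X *m X = x *m f, eigU phi 1 1 x y & eigV' phi 1 1 f g].
Proof.
move=> sd gy XE; have s := sgn1 F; case: sd XE => -> XE.
  by have [x [f [fx XX _ _ [U1 V1]]]] := kind1_eig gy XE; exists x, f.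
have [R RE] := onto hphi s gy; have [x [f [fx RR _ _ [U1 V1]]]] := kind1_eig gy RE.
have [R4 _ [b E]] := opp_structure hn hphi s gy RE XE.
by exists x, f; split=> //; rewrite -RR; apply: sq_opp E.
Qed.

(** If [g y] is nonzero, a preimage of the normalized [y g] has [x] and [f] as its eigenpair up to
    scalars, so [f x] is nonzero. Conversely, if [f x] is nonzero, [reach] gives a row [k] with
    [k y = 1], which must be a multiple of [g]. *)
Lemma kind1_orth x y f g : x != 0 -> y != 0 -> f != 0 -> g != 0 ->
  eigU phi 1 1 x y -> eigV' phi 1 1 f g -> (br f x == 0) = (br g y == 0).
Proof.
move=> x0 y0 f0 g0 U1 V1; have s := sgn1 F; apply/eqP/eqP => [fx|gy]; apply: contrapT => /eqP ne.
- have gy : br g ((br g y)^-1 *: y) = 1 by rewrite brZr mulVf.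
  have [R RE] := onto hphi s gy.
  have U2 : eigU phi 1 1 x ((br g y)^-1 *: y) by apply: eigU_scale => //; rewrite invr_eq0.
  have [x1 [f1 [fx1 _ Rx1 f1R _]]] := kind1_eig gy RE.
  have x10 := br1_neq0r fx1; have f10 := br1_neq0l fx1.
  rewrite -[RHS]scale1r in Rx1; rewrite -[RHS]scale1r in f1R.
  have [_ [a a0 Ea]] := par hn hphi gy RE s s x0 x10 (U2 _ _ gy RE) Rx1.
  have [_ [b b0 Eb]] := par' hn hphi gy RE s s f0 f10 (V1 _ _ gy RE) f1R.
  by move: fx1; rewrite Ea Eb brZl brZr fx !mulr0 => /eqP; rewrite eq_sym oner_eq0.
- pose x1 := (br f x)^-1 *: x; have fx1 : br f x1 = 1 by rewrite brZr mulVf.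
  have U2 : eigU phi 1 1 x1 y by apply: eigU_scaler.
  have [k [ky [V2|V2]]] := reach hphi s fx1 y0 (letterU hn hphi s y0 fx1 U2).
  + have [x2 [f2 [fx2 U3 V3]]] := hk ky; have [R RE] := onto hphi s ky.
    have [_ [a a0 Ea]] := par hn hphi ky RE s s (br1_neq0r fx1) (br1_neq0r fx2) (U2 _ _ ky RE) (U3 _ _ ky RE).
    apply: (no_GG hn hphi s fx2 (br1_neq0l ky) _ V3).
    by rewrite Ea; apply: eigV_scaler.
  + have [a E] := eigV'_unique hn hphi s s f0 g0 (br1_neq0l ky) V1 V2.
    by move: ky; rewrite E brZl gy mulr0 => /eqP; rewrite eq_sym oner_eq0.
Qed.

(** The remainder [N] vanishes because [phi N] does. It kills [y] since [N] anticommutes with [R]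
    and [C]; it kills each [y'] with [g y' = 0] since [nil_part_rel] relates [N] to the preimages of
    both [y' g'] and [-y' g']. *)
Lemma kind1_exact y g R C : br g y = 1 -> phi R = 1 *: (y *m g) -> phi C = -1 *: (y *m g) ->
  exists x f, [/\ br f x = 1, R = x *m f, C = - (x *m f),
    eigU phi 1 1 x y & eigV' phi 1 1 f g].
Proof.
move=> gy RE CE; have s := sgn1 F; have y0 := br1_neq0r gy; have g0 := br1_neq0l gy.
have [x [f [fx RR Rx fR [U1 V1]]]] := kind1_eig gy RE.
have x0 := br1_neq0r fx; have f0 := br1_neq0l fx.
have [R4 R20 [b E]] := opp_structure hn hphi s gy RE CE.
have R3 : R *m R *m R = x *m f by rewrite RR -mulmxA fR.
rewrite R3 in E; set N := R - x *m f in E.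
have RE' : R = x *m f + N by rewrite /N addrC subrK.
have fN : f *m N = 0 by rewrite mulmxBr fR mul_rcr fx scale1r subrr.
have Nx : N *m x = 0 by rewrite mulmxBl Rx mul_crc fx scale1r subrr.
have RN : R *m N = 0 by rewrite mulmxBr RR mulmxA Rx subrr.
have NR : N *m R = 0 by rewrite mulmxBl RR -mulmxA fR subrr.
have NN : N *m N = 0 by rewrite {1}/N mulmxBl RN -mulmxA fN mulmx0 subrr.
clearbody N.
have aRN : jrel R N by apply: ant_rel; rewrite /ant /jp RN NR addr0.
have aCN : jrel C N.
  apply: ant_rel; rewrite /ant /jp E mulmxDl mulmxDr !mulNmx !mulmxN -!scalemxAl -!scalemxAr.
  by rewrite NN -mulmxA fN mulmx0 mulmxA Nx mul0mx !scaler0 !oppr0 !addr0.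
suff N0 : N = 0.
  by exists x, f; split=> //; [rewrite RE' N0 addr0|rewrite E N0 scaler0 addr0].
apply: (pres_eq0 hphi).
have [By gB] : phi N *m y = 0 /\ g *m phi N = 0.
  apply: (pm_eq0 hphi s gy); rewrite -?RE -?CE; exact: rel_im.
have relN d y' g' : sgn d -> br g' y' = 1 -> br g y' = 0 -> br g' y = 0 ->
    jrel (d *: (y' *m g')) (phi N).
  move=> sd g'y' gy' g'y; have [X XE] := onto hphi sd g'y'.
  rewrite -XE; apply/relC; apply: (rel_im hphi).
  have [x' [f' [fx' XX U2 V2]]] := kind1_sq sd g'y' XE.
  have x'0 := br1_neq0r fx'; have f'0 := br1_neq0l fx'.
  have y'0 := br1_neq0r g'y'; have g'0 := br1_neq0l g'y'.
  apply: (nil_part_rel (b := b) fx fN Nx NN XX).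
  + by apply/eqP; rewrite (kind1_orth x'0 y'0 f0 g0 U2 V1) gy'.
  + by apply/eqP; rewrite (kind1_orth x0 y0 f'0 g'0 U1 V2) g'y.
  + rewrite -RE'; apply: (rel_pre hphi); rewrite RE XE.
    exact: rel_orth.
  + rewrite -E; apply: (rel_pre hphi); rewrite CE XE.
    by apply: rel_orth => //; apply: sgnN.
apply: col_ext => v; rewrite mul0mx.
have -> : v = br g v *: y + (v - br g v *: y) by mring.
rewrite mulmxDr -scalemxAr By scaler0 add0r.
set y' := v - _; have gy' : br g y' = 0 by rewrite /y' !brE gy mulr1 subrr.
have [->|y'0] := eqVneq y' 0; first by rewrite mulmx0.
have [h hy'] := ex_br1 y'0; pose g' := h - br h y *: g.
have g'y' : br g' y' = 1 by rewrite /g' brDl brNl brZl gy' mulr0 subr0.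
have g'y : br g' y = 0 by rewrite /g' brDl brNl brZl gy mulr1 subrr.
by apply: (pm_eq0 hphi s g'y' _ _).1; apply: relN => //; apply: sgnN.
Qed.
End Kind1.
End Exact.

(** * The field automorphism *)

Section Coordinates.
Variables (F : numClosedFieldType) (n : nat).
Hypothesis hn : (2 < n)%N.
Implicit Types (A B C D R S T M N X Z : 'M[F]_n) (x y z u v w : 'cV[F]_n) (f g h r : 'rV[F]_n).

Definition ecol i : 'cV[F]_n := delta_mx i 0.
Definition erow i : 'rV[F]_n := delta_mx 0 i.

Lemma br_erow i x : br (erow i) x = x i 0.
Proof. by rewrite /br -rowE mxE. Qed.
Lemma br_ecol f i : br f (ecol i) = f 0 i.
Proof. by rewrite /br -colE mxE. Qed.
Lemma ecolE i j : ecol i j 0 = (i == j)%:R.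
Proof. by rewrite mxE eqxx andbT eq_sym. Qed.
Lemma erowE i j : erow i 0 j = (i == j)%:R.
Proof. by rewrite mxE eqxx /= eq_sym. Qed.
Lemma ecol_neq0 i : ecol i != 0.
Proof. by apply/eqP=> /colP /(_ i); rewrite ecolE eqxx mxE => /eqP; rewrite oner_eq0. Qed.
Lemma erow_neq0 i : erow i != 0.
Proof. by apply/eqP=> /rowP /(_ i); rewrite erowE eqxx mxE => /eqP; rewrite oner_eq0. Qed.

Lemma row_supp2 f i j : i != j -> (forall k, k != i -> k != j -> f 0 k = 0) ->
  f = f 0 i *: erow i + f 0 j *: erow j.
Proof.
move=> ij H; apply/rowP=> k; rewrite !entE !erowE.
have [<-|ki] := eqVneq i k; first by rewrite eq_sym (negPf ij) mulr1 mulr0 addr0.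
have [<-|kj] := eqVneq j k; first by rewrite mulr0 mulr1 add0r.
by rewrite !mulr0 addr0 H // eq_sym.
Qed.

Lemma ex_third (i j : 'I_n) : exists k, k != i /\ k != j.
Proof.
apply: contrapT => no.
have : (#|'I_n| <= #|[set i; j]|)%N.
  apply: subset_leq_card; apply/fintype.subsetP=> k _; apply: contrapT => /negP kij; apply: no; exists k.
  by move: kij; rewrite !inE negb_or => /andP.
by rewrite card_ord cards2 leqNgt (leq_trans _ hn) // ltnS; case: (i != j).
Qed.

Section Frame.
Variable phi : 'M[F]_n -> 'M[F]_n.
Hypothesis hphi : pres phi.
Hypothesis hk : forall y g, br g y = 1 -> kind1 phi 1 y g.
Hypothesis he : forall i, eigU phi 1 1 (ecol i) (ecol i).
Hypothesis hone : eigU phi 1 1 (const_mx 1) (const_mx 1).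

Lemma ex_colU y : y != 0 -> exists2 x, x != 0 & eigU phi 1 1 x y.
Proof.
move=> /ex_br1 [h /hk [x [f [fx U1 _]]]]; exists x => //; exact: br1_neq0r fx.
Qed.
Lemma ex_rowV g : g != 0 -> exists2 f, f != 0 & eigV' phi 1 1 f g.
Proof.
move=> /ex_br1l [h /hk [x [f [fx _ V1]]]]; exists f => //; exact: br1_neq0l fx.
Qed.

Lemma row_coord f g i : f != 0 -> g != 0 -> eigV' phi 1 1 f g -> (f 0 i == 0) = (g 0 i == 0).
Proof.
move=> f0 g0 V1; rewrite -(br_ecol f) -(br_ecol g).
by apply: (kind1_orth hn hphi hk (ecol_neq0 i) (ecol_neq0 i) f0 g0 (@he i) V1).
Qed.

Lemma erowV i : eigV' phi 1 1 (erow i) (erow i).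
Proof.
have [f f0 V1] := ex_rowV (erow_neq0 i).
have fE : f = f 0 i *: erow i.
  apply/rowP=> k; rewrite entE erowE; have [<-|ik] := eqVneq i k; first by rewrite mulr1.
  rewrite mulr0; apply/eqP; rewrite (row_coord _ f0 (erow_neq0 i) V1) erowE (negPf ik) //.
have fi : f 0 i != 0 by apply: contraNneq f0 => fi; rewrite fE fi scale0r.
have E : erow i = (f 0 i)^-1 *: f by rewrite {2}fE scalerA mulVf // scale1r.
by rewrite {1}E; apply: eigV'_scaler.
Qed.

Lemma col_coord x y i : x != 0 -> y != 0 -> eigU phi 1 1 x y -> (x i 0 == 0) = (y i 0 == 0).
Proof.
move=> x0 y0 U1; rewrite -(br_erow i x) -(br_erow i y).
by apply: (kind1_orth hn hphi hk x0 y0 (erow_neq0 i) (erow_neq0 i) U1 (@erowV i)).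
Qed.

(** The hyperplane of columns with this ratio is the kernel of [g], whose partner [f] is again
    supported on [i] and [j]. The guard [i != j] stands under the existential so that [c] can be
    chosen for all pairs of indices. *)
Lemma ratio i j (t : F) : exists c, i != j -> forall x y, x != 0 -> y != 0 ->
  eigU phi 1 1 x y -> y j 0 = t * y i 0 -> x j 0 = c * x i 0.
Proof.
have [ij|ij] := boolP (i == j); first by exists 0.
pose g := t *: erow i - erow j.
have gj : g 0 j = -1 by rewrite /g !entE !erowE (negPf ij) eqxx /=; ring.
have g0 : g != 0.
  by apply/eqP=> g0; move/eqP: gj; rewrite g0 mxE eq_sym oppr_eq0 oner_eq0.
have [f f0 V1] := ex_rowV g0.
have fj : f 0 j != 0 by rewrite (row_coord _ f0 g0 V1) gj oppr_eq0 oner_eq0.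
have fE : f = f 0 i *: erow i + f 0 j *: erow j.
  apply: row_supp2 => // k ki kj; apply/eqP; rewrite (row_coord _ f0 g0 V1) /g !entE !erowE.
  by rewrite (eq_sym i) (negPf ki) (eq_sym j) (negPf kj) mulr0 subr0.
exists (- f 0 i / f 0 j) => _ x y x0 y0 U1 yj.
have : br f x = 0.
  apply/eqP; rewrite (kind1_orth hn hphi hk x0 y0 f0 g0 U1 V1) /g !brE !br_erow yj; apply/eqP; ring.
have -> : br f x = f 0 i * x i 0 + f 0 j * x j 0 by rewrite {1}fE !brE !br_erow.
move=> E; apply: (mulfI fj); rewrite mulrA (mulrC (f 0 j) (_ / _)) divfK //.
by lc E.
Qed.

Lemma ex_tau : exists tau : F -> F,
  [/\ {morph tau : s t / s * t}, tau 1 = 1, tau 0 = 0 &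
   forall i j x y t, x != 0 -> y != 0 -> eigU phi 1 1 x y -> y j 0 = t * y i 0 ->
     x j 0 = tau t * x i 0].
Proof.
pose tau i j t := projT1 (cid (ratio i j t)).
have T i j (ij : i != j) x y t : x != 0 -> y != 0 -> eigU phi 1 1 x y -> y j 0 = t * y i 0 ->
    x j 0 = tau i j t * x i 0.
  by rewrite /tau; case: cid => c H /=; apply: H.
have n0 : (0 < n)%N by apply: ltn_trans hn.
have one0 : const_mx 1 != 0 :> 'cV[F]_n.
  by apply/eqP=> /colP /(_ (Ordinal n0)); rewrite !mxE => /eqP; rewrite oner_eq0.
have tau1 i j : i != j -> tau i j 1 = 1.
  move=> ij; have := T i j ij _ _ 1 one0 one0 hone; rewrite !mxE !mulr1.
  by move/(_ erefl).
have tau0 i j : i != j -> tau i j 0 = 0.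
  move=> ij; have := T i j ij _ _ 0 (ecol_neq0 i) (ecol_neq0 i) (@he i).
  by rewrite !ecolE eqxx (negPf ij) !mulr1 => /(_ erefl).
(* The column with entries [1], [s], [t s] at [i], [j], [k] computes one ratio in two ways. With
   [tau i j 1 = 1] this identifies all the functions [tau i j]. *)
have mult i j k s t : i != j -> i != k -> j != k -> tau i k (t * s) = tau j k t * tau i j s.
  move=> ij ik jk; pose y := ecol i + s *: ecol j + (t * s) *: ecol k.
  have yi : y i 0 = 1.
    by rewrite /y !entE !ecolE eqxx (eq_sym j) (negPf ij) (eq_sym k) (negPf ik) /=; ring.
  have yj : y j 0 = s.
    by rewrite /y !entE !ecolE eqxx (negPf ij) (eq_sym k) (negPf jk) /=; ring.
  have yk : y k 0 = t * s.
    by rewrite /y !entE !ecolE eqxx (negPf ik) (negPf jk) /=; ring.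
  have y0 : y != 0 by apply/eqP=> E; move/eqP: yi; rewrite E mxE eq_sym oner_eq0.
  have [x x0 U1] := ex_colU y0.
  have xi : x i 0 != 0 by rewrite (col_coord _ x0 y0 U1) yi oner_eq0.
  apply: (mulIf xi); rewrite -(T i k ik x y (t * s) x0 y0 U1) ?yk ?yi ?mulr1 //.
  rewrite -mulrA -(T i j ij x y s x0 y0 U1) ?yj ?yi ?mulr1 //.
  by rewrite -(T j k jk x y t x0 y0 U1) // yk yj.
have left_ i j k : i != k -> j != k -> tau i k = tau j k.
  have [->//|ij] := eqVneq i j.
  by move=> ik jk; apply: funext => t; rewrite -[t]mulr1 (mult i j k) // tau1 // !mulr1.
have right_ i j k : i != j -> i != k -> tau i j = tau i k.
  have [->//|jk] := eqVneq j k.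
  by move=> ij ik; apply: funext => t; rewrite -[in RHS](mul1r t) (mult i j k) // tau1 // mul1r.
have all_ i j k l : i != j -> k != l -> tau i j = tau k l.
  move=> ij kl; have [m [mi mk]] := ex_third i k.
  rewrite (right_ i j m) // 1?eq_sym // (left_ i k m) 1?eq_sym //.
  by apply: right_ => //; rewrite eq_sym.
pose i0 := Ordinal n0; have [i1 [i10 _]] := ex_third i0 i0; have [i2 [i20 i21]] := ex_third i0 i1.
have i01 : i0 != i1 by rewrite eq_sym.
exists (tau i0 i1); split.
- move=> s t; rewrite mulrC [RHS]mulrC -{1}(all_ i0 i2) // 1?eq_sym //.
  rewrite (mult i0 i1 i2) // 1?eq_sym //; congr (_ * _).
  by rewrite (all_ i1 i2 i0 i1) // eq_sym.
- exact: tau1.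
- exact: tau0.
- move=> i j x y t x0 y0 U1; have [<-|ij] := eqVneq i j; last first.
    by rewrite (all_ i0 i1 i j) //; apply: T ij _ _ _ x0 y0 U1.
  have [yi|yi] := eqVneq (y i 0) 0.
    by move=> _; move/eqP: yi; rewrite -(col_coord _ x0 y0 U1) => /eqP ->; rewrite mulr0.
  rewrite -[X in X = _]mul1r => /(mulIf yi) <-; by rewrite tau1 ?mul1r.
Qed.

Lemma rmorphism_of (tau : F -> F) : {morph tau : a b / a + b} -> {morph tau : a b / a * b} ->
  tau 1 = 1 -> exists s : {rmorphism F -> F}, s =1 tau.
Proof.
move=> tD tM t1.
have tB : zmod_morphism tau.
  move=> a b; have := tD (a - b) b; rewrite subrK => E; lc (esym E).
have tMM : monoid_morphism tau by [].
pose zB := GRing.isZmodMorphism.Build F F tau tB.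
pose mB := GRing.isMonoidMorphism.Build F F tau tMM.
by exists (HB.pack tau zB mB : {rmorphism F -> F}).
Qed.

Lemma ex_rmorphism : exists tau : {rmorphism F -> F},
  (forall x y, x != 0 -> y != 0 -> eigU phi 1 1 x y ->
     exists2 c, c != 0 & x = c *: map_mx tau y) /\
  (forall f g, f != 0 -> g != 0 -> eigV' phi 1 1 f g ->
     exists2 c, c != 0 & f = c *: map_mx tau g).
Proof.
have [tau [tM t1 t0 T]] := ex_tau.
have n0 : (0 < n)%N by apply: ltn_trans hn.
have tV a : a != 0 -> tau a^-1 * tau a = 1 by move=> a0; rewrite -tM mulVf.
have colE x y : x != 0 -> y != 0 -> eigU phi 1 1 x y ->
     exists2 c, c != 0 & x = c *: map_mx tau y.
  move=> x0 y0 U1; have [i [k]] := neq0_ent y0; rewrite ord1 => yi.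
  have xi : x i 0 != 0 by rewrite (col_coord _ x0 y0 U1).
  have xE : x = (tau (y i 0)^-1 * x i 0) *: map_mx tau y.
    apply/colP=> j; rewrite entZ mxE (T i j x y (y j 0 / y i 0)) ?divfK // tM; ring.
  exists (tau (y i 0)^-1 * x i 0) => //.
  by apply: contraNneq x0 => c0; rewrite xE c0 scale0r.
pose i0 := Ordinal n0; have [i1 [i10 _]] := ex_third i0 i0; have [i2 [i20 i21]] := ex_third i0 i1.
(* If [tau (-1)] were [1], the columns [e0 + e1] and [e0 - e1] would have proportional partners,
   against [eigU_unique]. *)
have tN1 : tau (-1) = -1.
  have sq : tau (-1) * tau (-1) = 1 by rewrite -tM mulrNN mulr1.
  have /eqP : (tau (-1) - 1) * (tau (-1) + 1) = 0 by lc sq.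
  rewrite mulf_eq0 subr_eq0 addr_eq0.
  case/orP=> /eqP // tN; exfalso.
  pose y := ecol i0 + ecol i1; pose w := ecol i0 - ecol i1.
  have yi0 : y i0 0 = 1 by rewrite /y !entE !ecolE eqxx (negPf i10) addr0.
  have wi0 : w i0 0 = 1 by rewrite /w !entE !ecolE eqxx (negPf i10) subr0.
  have yi1 : y i1 0 = 1 by rewrite /y !entE !ecolE eqxx eq_sym (negPf i10) add0r.
  have wi1 : w i1 0 = -1 by rewrite /w !entE !ecolE eqxx eq_sym (negPf i10) sub0r.
  have y0 : y != 0 by apply/eqP=> E; move/eqP: yi0; rewrite E mxE eq_sym oner_eq0.
  have w0 : w != 0 by apply/eqP=> E; move/eqP: wi0; rewrite E mxE eq_sym oner_eq0.
  have yw : map_mx tau y = map_mx tau w.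
    apply/colP=> j; rewrite [LHS]mxE [RHS]mxE /y /w !entE !ecolE.
    have [<-|j0] := eqVneq i0 j; first by rewrite (negPf i10) addr0 subr0.
    by have [_|_] := eqVneq i1 j; rewrite /= ?addr0 ?subr0 ?add0r ?sub0r ?t1 ?tN.
  have [x x0 U1] := ex_colU y0; have [x' x'0 U2] := ex_colU w0.
  have [c c0 xE] := colE _ _ x0 y0 U1; have [c' c'0 x'E] := colE _ _ x'0 w0 U2.
  have U3 : eigU phi 1 1 x w.
    have -> : x = (c / c') *: x' by rewrite x'E scalerA divfK // xE yw.
    exact: eigU_scaler.
  have [a E] := eigU_unique hn hphi (sgn1 F) (sgn1 F) x0 y0 U1 U3 w0.
  have a1 : a = 1 by move: wi0; rewrite E mxE yi0 mulr1.
  by move: wi1; rewrite E mxE yi1 a1 mulr1 => /eqP; rewrite -subr_eq0 opprK -mulr2n mulrn_eq0 oner_eq0.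
have tN a : tau (- a) = - tau a by rewrite -mulN1r tM tN1 mulN1r.
have rowE f g : f != 0 -> g != 0 -> eigV' phi 1 1 f g ->
     exists2 c, c != 0 & f = c *: map_mx tau g.
  move=> f0 g0 V1; have [k [i gi]] := neq0_ent g0; rewrite ord1 in gi.
  have fi : f 0 i != 0 by rewrite (row_coord _ f0 g0 V1).
  suff fE : f = (tau (g 0 i)^-1 * f 0 i) *: map_mx tau g.
    exists (tau (g 0 i)^-1 * f 0 i) => //.
    by apply: contraNneq f0 => c0; rewrite fE c0 scale0r.
  apply/rowP=> j; rewrite entZ mxE.
  have [<-|ij] := eqVneq i j; first by rewrite mulrAC tV ?mul1r.
  pose y := g 0 j *: ecol i - g 0 i *: ecol j.
  have y0 : y != 0.
    apply/eqP=> /colP /(_ j); rewrite !entE !ecolE eqxx (negPf ij) mulr0 mulr1 add0r => /eqP.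
    by rewrite oppr_eq0 (negPf gi).
  have [x x0 U1] := ex_colU y0; have [c c0 xE] := colE _ _ x0 y0 U1.
  have ty : map_mx tau y = tau (g 0 j) *: ecol i - tau (g 0 i) *: ecol j.
    apply/colP=> l; rewrite [LHS]mxE /y !entE !ecolE.
    have [<-|il] := eqVneq i l; first by rewrite eq_sym (negPf ij) !mulr1 !mulr0 !subr0.
    have [_|jl] := eqVneq j l; first by rewrite !mulr1 !mulr0 !sub0r tN.
    by rewrite !mulr0 subr0 t0.
  have : br f x = 0.
    apply/eqP; rewrite (kind1_orth hn hphi hk x0 y0 f0 g0 U1 V1) /y !brE !br_ecol.
    by apply/eqP; ring.
  rewrite xE ty !brE !br_ecol => /eqP; rewrite mulf_eq0 (negPf c0) /= subr_eq0 => /eqP E.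
  rewrite -[LHS]mul1r -(tV _ gi); lcs (- tau (g 0 i)^-1) E.
(* The column [y] is orthogonal to the all-ones row, whose partner is proportional to itself;
   incidence of the partners is the required identity. *)
have tD1 s : tau (1 + s) = 1 + tau s.
  pose y := ecol i0 + s *: ecol i1 - (1 + s) *: ecol i2.
  have yi0 : y i0 0 = 1.
    by rewrite /y !entE !ecolE eqxx (negPf i10) (negPf i20) /=; ring.
  have y0 : y != 0 by apply/eqP=> E; move/eqP: yi0; rewrite E mxE eq_sym oner_eq0.
  have [x x0 U1] := ex_colU y0; have [c c0 xE] := colE _ _ x0 y0 U1.
  have one0 : const_mx 1 != 0 :> 'rV[F]_n.
    by apply/eqP=> /rowP /(_ i0); rewrite !mxE => /eqP; rewrite oner_eq0.
  have [f f0 V1] := ex_rowV one0; have [c' c'0 fE] := rowE _ _ f0 one0 V1.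
  have te : map_mx tau (const_mx 1) = const_mx 1 :> 'rV[F]_n.
    by apply/rowP=> l; rewrite !mxE t1.
  have ty : map_mx tau y = ecol i0 + tau s *: ecol i1 - tau (1 + s) *: ecol i2.
    apply/colP=> l; rewrite [LHS]mxE /y !entE !ecolE.
    have [<-|l0] := eqVneq i0 l; first by rewrite (negPf i10) (negPf i20) /= !mulr0 !addr0 !subr0 t1.
    have [<-|l1] := eqVneq i1 l; first by rewrite (negPf i21) /= !mulr0 !subr0 !mulr1 !add0r.
    have [_|l2] := eqVneq i2 l; first by rewrite /= !mulr0 !mulr1 !add0r tN.
    by rewrite /= !mulr0 !addr0 subr0 t0.
  have : br f x = 0.
    apply/eqP; rewrite (kind1_orth hn hphi hk x0 y0 f0 one0 U1 V1) /y !brE !br_ecol !mxE.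
    by apply/eqP; ring.
  rewrite xE fE te ty !brE !br_ecol !mxE => /eqP; rewrite !mulf_eq0 (negPf c0) (negPf c'0) /=.
  by move/eqP=> E; lcN E.
have tD : {morph tau : a b / a + b}.
  move=> a b; have [->|a0] := eqVneq a 0; first by rewrite t0 !add0r.
  have -> : a + b = a * (1 + b / a) by rewrite mulrDr mulr1 mulrC divfK.
  by rewrite tM tD1 mulrDr mulr1 -tM mulrC divfK.
have [s sE] := rmorphism_of tD tM t1.
have mE p q (A : 'M[F]_(p, q)) : map_mx s A = map_mx tau A by apply/matrixP=> i j; rewrite !mxE sE.
by exists s; split=> [x y|f g]; rewrite mE; [apply: colE|apply: rowE].
Qed.

Lemma ex_frame : exists tau : {rmorphism F -> F}, bijective tau /\
  forall d y g R, sgn d -> br g y = 1 -> phi R = d *: (y *m g) -> R = d *: map_mx tau (y *m g).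
Proof.
have [tau [cE rE]] := ex_rmorphism; exists tau.
have H d y g R : sgn d -> br g y = 1 -> phi R = d *: (y *m g) -> R = d *: map_mx tau (y *m g).
  move=> sd gy RE; have y0 := br1_neq0r gy; have g0 := br1_neq0l gy; have s := sgn1 F.
  have main R1 C1 : phi R1 = 1 *: (y *m g) -> phi C1 = -1 *: (y *m g) ->
      R1 = map_mx tau (y *m g) /\ C1 = - map_mx tau (y *m g).
    move=> E1 E2; have [x [f [fx -> -> U1 V1]]] := kind1_exact hn hphi hk gy E1 E2.
    have [c c0 xE] := cE _ _ (br1_neq0r fx) y0 U1; have [c' c'0 fE] := rE _ _ (br1_neq0l fx) g0 V1.
    have bt : br (map_mx tau g) (map_mx tau y) = 1.
      by rewrite /br -map_mxM mxE -/(br g y) gy rmorph1.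
    move: fx; rewrite xE fE !brE bt mulr1 => cc.
    by rewrite -scalemxAl -scalemxAr scalerA mulrC cc scale1r map_mxM.
  have [P PE] := onto hphi s gy; have [Q QE] := onto hphi (sgnN s) gy.
  case: sd => dE; rewrite dE in RE *.
    by have [-> _] := main R Q RE QE; rewrite scale1r.
  by have [_ ->] := main P R PE RE; rewrite scaleN1r.
split=> //.
(* The idempotent [E] with column [e0 + s e1] and row [e0] is shown to have image [z e0] with [z]
   normalized; the formula for preimages then exhibits [s] as the value of [tau] at an entry of
   [z]. *)
suff surj s : exists t, tau t = s.
  have [sg sgE] := choice surj; exists sg => // t.
  by apply: (fmorph_inj tau); rewrite sgE.
have n0 : (0 < n)%N by apply: ltn_trans hn.
have s1 := sgn1 F.
pose i0 := Ordinal n0; have [i1 [i10 _]] := ex_third i0 i0.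
pose E := (ecol i0 + s *: ecol i1) *m erow i0; pose B := phi E.
have mt x : br (erow i0) (map_mx tau x) = tau (x i0 0) by rewrite br_erow mxE.
have e0E : br (erow i0) (ecol i0 + s *: ecol i1) = 1.
  by rewrite br_erow !entE !ecolE eqxx (negPf i10) mulr0 addr0.
have me : map_mx tau (erow i0) = erow i0 by rewrite /erow map_delta_mx.
have e0B : erow i0 *m B = erow i0.
  case: (@rel_col F n (erow i0) B 1 (erow_neq0 i0) s1) => [y ey|->|B0].
  - have [R RE] := onto hphi s1 ey; rewrite -RE; apply: (rel_im hphi).
    rewrite (H _ _ _ _ s1 ey RE) map_mxM me; apply: rel_colP => //.
      by rewrite mt -br_erow ey rmorph1.
    by rewrite /E mul_rcr e0E.
  - by rewrite scale1r.
  - have E0 := pres_eq0 hphi B0; have := congr1 (fun M : 'M[F]_n => M i0 i0) E0.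
    rewrite /E entO -br_erow e0E erowE eqxx mulr1 mxE => /eqP; by rewrite oner_eq0.
have kill y g : br g y = 1 -> y i0 0 = 0 -> g 0 i0 = 0 -> g 0 i1 = 0 -> B *m y = 0 /\ g *m B = 0.
  move=> gy y0 g0 g1; have rE' d : sgn d -> jrel (d *: (y *m g)) B.
    move=> sd; have [R RE] := onto hphi sd gy; rewrite -RE; apply: (rel_im hphi).
    rewrite (H _ _ _ _ sd gy RE) map_mxM; apply: ant_rel; rewrite /ant jpZl /jp /E !mul_crcr.
    rewrite !brE !br_ecol mt y0 !mxE g0 g1 !rmorph0; mring.
  by apply: (pm_eq0 hphi s1 gy); apply: rE' => //; apply: sgnN.
have colB k : k != i0 -> B *m ecol k = 0.
  have base l : l != i0 -> l != i1 -> B *m ecol l = 0.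
    move=> l0 l1; apply: (kill _ (erow l) _ _ _ _).1.
    + by rewrite br_ecol erowE eqxx.
    + by rewrite ecolE (negPf l0).
    + by rewrite erowE (negPf l0).
    + by rewrite erowE (negPf l1).
  (* [kill] asks for a row normalized on the column and zero at [i0] and [i1]. The basis column at
     [i1] admits none, so it is obtained from its sum with a third one. *)
  move=> k0; have [->|k1] := eqVneq k i1; last exact: base.
  have [l [l0 l1]] := ex_third i0 i1.
  have : B *m (ecol i1 + ecol l) = 0.
    apply: (kill _ (erow l) _ _ _ _).1.
    + by rewrite brDr !br_ecol !erowE eqxx (negPf l1) add0r.
    + by rewrite !entE !ecolE (negPf l0) (negPf i10) /= addr0.
    + by rewrite erowE (negPf l0).
    + by rewrite erowE (negPf l1).
  by rewrite mulmxDr (base l) // addr0.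
have rowB k : k != i0 -> k != i1 -> erow k *m B = 0.
  move=> k0 k1; apply: (kill (ecol k) _ _ _ _ _).2.
  + by rewrite br_ecol erowE eqxx.
  + by rewrite ecolE (negPf k0).
  + by rewrite erowE (negPf k0).
  + by rewrite erowE (negPf k1).
have BE : B = 1 *: ((B *m ecol i0) *m erow i0).
  rewrite scale1r; apply/matrixP=> a b; rewrite entO erowE -colE [RHS]mulrC.
  have [<-|b0] := eqVneq i0 b; first by rewrite mul1r mxE.
  rewrite mul0r; have := colB b; rewrite eq_sym b0 => /(_ isT).
  by rewrite -colE => /colP /(_ a); rewrite !mxE.
have e0z : br (erow i0) (B *m ecol i0) = 1 by rewrite -brA e0B br_ecol erowE eqxx.
have EE := H _ _ _ _ s1 e0z BE; exists ((B *m ecol i0) i1 0).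
have := congr1 (fun M : 'M[F]_n => M i1 i0) EE.
rewrite /E scale1r map_mxM me !entO !entE !ecolE !erowE !eqxx eq_sym (negPf i10) !mulr1 add0r.
by move/esym; rewrite mxE.
Qed.
End Frame.
End Coordinates.

(** * Preservers fixing the rank-one idempotents *)

Section RankOneFixed.
Variables (F : numClosedFieldType) (n : nat).
Hypothesis hn : (2 < n)%N.
Implicit Types (A B C D R S T M N X Z : 'M[F]_n) (x y z u v w : 'cV[F]_n) (f g h l r : 'rV[F]_n).

Lemma jrel_scale A B (a : F) : jrel (a *: A) B <-> jrel A (a *: B).
Proof. by rewrite /jrel jpZl jpZr. Qed.

Lemma unit_rank_eq (V : lmodType F) (v : V) (a b : F) : v != 0 -> a *: v = b *: v -> a = b.
Proof. by move=> v0 /eqP; rewrite -subr_eq0 -scalerBl scaler_eq0 (negPf v0) orbF subr_eq0 => /eqP. Qed.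

Lemma ex_sep2 x z y : (forall a b, y <> a *: x + b *: z) ->
  exists f, [/\ br f x = 0, br f z = 0 & br f y = 1].
Proof.
move=> yx; apply: contrapT => H.
have y0 : y != 0 by apply/eqP=> y0; apply: (yx 0 0); rewrite !scale0r addr0.
have [|a [b E]] := @mul_rowsub0 F n x y z y0; last by apply: (yx a b).
move=> f fx fz; apply: contrapT => /eqP fy; apply: H.
by exists ((br f y)^-1 *: f); rewrite !brZl fx fz mulr0 mulVf.
Qed.
Lemma ex_sep2l f g h : (forall a b, h <> a *: f + b *: g) ->
  exists x, [/\ br f x = 0, br g x = 0 & br h x = 1].
Proof.
move=> hfg; have [|k [k1 k2 k3]] := @ex_sep2 f^T g^T h^T.
  by move=> a b E; apply: (hfg a b); apply: trmx_inj; rewrite E linearD !linearZ.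
by exists k^T; rewrite -(br_tr f) -(br_tr g) -(br_tr h) trmxK.
Qed.
Lemma ex_sepl f g : (forall a, g <> a *: f) -> exists x, br f x = 0 /\ br g x = 1.
Proof.
move=> gf; have [|x [x1 _ x2]] := @ex_sep2l f 0 g; last by exists x.
by move=> a b; rewrite scaler0 addr0; apply: gf.
Qed.

Section Fixing.
Variable psi : 'M[F]_n -> 'M[F]_n.
Hypothesis hpsi : forall A B, jrel A B <-> jrel (psi A) (psi B).
Hypothesis hfix : forall d y g, sgn d -> br g y = 1 -> psi (d *: (y *m g)) = d *: (y *m g).

Lemma fixing_pres : pres psi.
Proof. by split=> // d y g sd gy; exists (d *: (y *m g)); apply: hfix. Qed.
Let hp := fixing_pres.

Lemma kill_test B y g : br g y = 1 -> B *m y = 0 -> g *m B = 0 ->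
  psi B *m y = 0 /\ g *m psi B = 0.
Proof.
move=> gy By gB; apply: (pm_eq0 hp (sgn1 F) gy).
  rewrite -(hfix (sgn1 F) gy); apply: (rel_im hp).
  by apply/rel_outerP => //; [exact: sgn1|exact: Or33].
rewrite -(hfix (sgnN (sgn1 F)) gy); apply: (rel_im hp).
by apply/rel_outerP => //; [exact: sgnN (sgn1 F)|exact: Or33].
Qed.

Lemma outer_of_ker B y f v : br f v = 1 ->
  (forall z, br f z = 0 -> B *m z = 0) -> (forall h, br h y = 0 -> h *m B = 0) ->
  exists c, B = c *: (y *m f).
Proof.
move=> fv kz kh.
have BE : B = (B *m v) *m f.
  apply: col_ext => z; rewrite mul_crc.
  have -> : z = br f z *: v + (z - br f z *: v) by mring.
  rewrite mulmxDr (kz (z - _)) ?addr0; last by rewrite brDr brNr brZr fv mulr1 subrr.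
  by rewrite -scalemxAr -[in RHS](addrC (z - _)) subrK.
have [[c E]|nE] := pselect (exists c, B *m v = c *: y).
  by exists c; rewrite {1}BE E scalemxAl.
have [|h [hy hB]] := @ex_sep F n y (B *m v); first by move=> a E; apply: nE; exists a.
by move: hB; rewrite -brA (kh h hy) br0l => /eqP; rewrite eq_sym oner_eq0.
Qed.

Lemma psi_proj a y g : br g y = 1 -> exists b, psi (a *: (y *m g)) = b *: (y *m g).
Proof.
move=> gy; have y0 := br1_neq0r gy; have g0 := br1_neq0l gy.
apply: (@outer_of_ker _ y g y) => //.
- move=> z gz; have [->|z0] := eqVneq z 0; first by rewrite mulmx0.
  have [|h [hy hz]] := @ex_sep F n y z.
    move=> c E; move: gz; rewrite E brZr gy mulr1 => c0.
    by move/eqP: z0; apply; rewrite E c0 scale0r.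
  apply: (kill_test hz _ _).1.
  + by rewrite -scalemxAl mul_crc gz scale0r scaler0.
  + by rewrite -scalemxAr mul_rcr hy scale0r scaler0.
- move=> h hy; have [->|h0] := eqVneq h 0; first by rewrite mul0mx.
  have [|z [gz hz]] := @ex_sepl g h.
    move=> c E; move: hy; rewrite E brZl gy mulr1 => c0.
    by move/eqP: h0; apply; rewrite E c0 scale0r.
  apply: (kill_test hz _ _).2.
  + by rewrite -scalemxAl mul_crc gz scale0r scaler0.
  + by rewrite -scalemxAr mul_rcr hy scale0r scaler0.
Qed.

Lemma psi_nil x f : x != 0 -> f != 0 -> br f x = 0 -> exists c, psi (x *m f) = c *: (x *m f).
Proof.
move=> x0 f0 fx; have [v fv] := ex_br1l f0.
have base z : br f z = 0 -> (forall c, z <> c *: x) -> psi (x *m f) *m z = 0.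
  move=> fz zx; have [h [hx hz]] := ex_sep zx.
  apply: (kill_test hz _ _).1; first by rewrite mul_crc fz scale0r.
  by rewrite mul_rcr hx scale0r.
have basel h : br h x = 0 -> (forall c, h <> c *: f) -> h *m psi (x *m f) = 0.
  move=> hx hf; have [z [fz hz]] := ex_sepl hf.
  apply: (kill_test hz _ _).2; first by rewrite mul_crc fz scale0r.
  by rewrite mul_rcr hx scale0r.
apply: (@outer_of_ker _ x f v) => //.
(* [base] does not reach the multiples of [x]; a column of the kernel of [f] killed by [p] is a
   difference of two kernel columns on which [p] is nonzero. *)
- have [p [px py pv]] : exists p, [/\ p != 0, br p x = 0 & br p v = 0] by apply: ex_row_kill.
  have [w pw] := ex_br1l px.
  pose z1 := w - br f w *: v.
  have fz1 : br f z1 = 0 by rewrite /z1 !brE fv mulr1 subrr.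
  have pz1 : br p z1 = 1 by rewrite /z1 !brE pw pv mulr0 subr0.
  clearbody z1.
  have ind z c : br p z != 0 -> z <> c *: x.
    by move=> pz E; move/eqP: pz; apply; rewrite E brZr py mulr0.
  move=> z fz; have [pz|pz] := eqVneq (br p z) 0; last by apply: base => // c; apply: ind.
  have -> : z = (z + z1) - z1 by rewrite addrK.
  rewrite mulmxBr (base (z + z1)) ?(base z1) ?subr0 ?brDr ?fz ?fz1 ?addr0 //.
  + by move=> c; apply: ind; rewrite pz1 oner_neq0.
  + by move=> c; apply: ind; rewrite brDr pz pz1 add0r oner_neq0.
- have [k kx] := ex_br1 x0.
  have [p [p0 fp kp]] := ex_col_kill hn f k.
  have [w wp] := ex_br1 p0; pose h1 := w - br w x *: k.
  have h1x : br h1 x = 0 by rewrite /h1 !brE kx mulr1 subrr.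
  have h1p : br h1 p = 1 by rewrite /h1 !brE wp kp mulr0 subr0.
  clearbody h1.
  have ind h c : br h p != 0 -> h <> c *: f.
    by move=> hp' E; move/eqP: hp'; apply; rewrite E brZl fp mulr0.
  move=> h hx; have [hp0|hp0] := eqVneq (br h p) 0; last by apply: basel => // c; apply: ind.
  have -> : h = (h + h1) - h1 by rewrite addrK.
  rewrite mulmxBl (basel (h + h1)) ?(basel h1) ?subr0 ?brDl ?hx ?h1x ?addr0 //.
  + by move=> c; apply: ind; rewrite h1p oner_neq0.
  + by move=> c; apply: ind; rewrite brDl hp0 h1p add0r oner_neq0.
Qed.

Lemma rel_eigcol a y B k : a != 0 -> br k y = 1 -> B *m y = a *: y -> jrel (a^-1 *: (y *m k)) B.
Proof.
move=> a0 ky By; apply/jrel_scale; rewrite -[y *m k]scale1r; apply: rel_rowP => //; first exact: sgn1.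
by rewrite -scalemxAl By scalerA mulVf.
Qed.

(** Every [a y k] is related to every [a^-1 y h], which makes the scalars of their images inverse to
    each other; hence all [k] share one scalar. *)
Lemma proj_scalar a y : a != 0 -> y != 0 -> exists2 b, b != 0 &
  forall g, br g y = 1 -> psi (a *: (y *m g)) = b *: (y *m g).
Proof.
move=> a0 y0; have [g gy] := ex_br1 y0.
have yk0 k : br k y = 1 -> y *m k != 0.
  move=> ky; apply/eqP=> /outer_eq0 [] E; move: ky; rewrite E brE => /eqP; rewrite eq_sym oner_eq0 //.
have inv k h b c : br k y = 1 -> br h y = 1 -> psi (a *: (y *m k)) = b *: (y *m k) ->
    psi (a^-1 *: (y *m h)) = c *: (y *m h) -> b * c = 1.
  move=> ky hy kE hE.
  have c0 : c != 0.
    apply/eqP=> c0; move: hE; rewrite c0 scale0r => /(pres_eq0 hp) /eqP.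
    by rewrite scaler_eq0 invr_eq0 (negPf a0) (negPf (yk0 h hy)).
  have b0 : b != 0.
    apply/eqP=> b0; move: kE; rewrite b0 scale0r => /(pres_eq0 hp) /eqP.
    by rewrite scaler_eq0 (negPf a0) (negPf (yk0 k ky)).
  have : jrel (a^-1 *: (y *m h)) (a *: (y *m k)).
    by apply: rel_eigcol => //; rewrite -scalemxAl mul_crc ky scale1r.
  move/(rel_im hp); rewrite kE hE => /jrel_scale; rewrite scalerA -[y *m h]scale1r.
  case/(rel_outerP _ hy (sgn1 F)) => [E|E|[E _]].
  - by move: E; rewrite -scalemxAl mul_crc ky scale1r -[RHS]scale1r => /(unit_rank_eq y0) E; rewrite mulrC -[RHS]E.
  - have := congr1 (fun l : 'rV[F]_n => br l y) E.
    by rewrite -scalemxAr mul_rcr hy scale1r !brZl ky hy !mulr1 mulrC.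
  - move/eqP: E; rewrite -scalemxAl mul_crc ky scale1r scaler_eq0 mulf_eq0.
    by rewrite (negPf b0) (negPf c0) (negPf y0).
have [c cE] := psi_proj a^-1 gy; have [b bE] := psi_proj a gy.
have bc := inv g g b c gy gy bE cE.
have c0 : c != 0 by apply/eqP=> c0; move: bc; rewrite c0 mulr0 => /eqP; rewrite eq_sym oner_eq0.
exists b.
  by apply/eqP=> b0; move: bc; rewrite b0 mul0r => /eqP; rewrite eq_sym oner_eq0.
move=> h hy; have [b' b'E] := psi_proj a hy; rewrite b'E.
by have := inv h g b' c hy gy b'E cE; rewrite -bc => /(mulIf c0) ->.
Qed.

(** A projection and a nilpotent, both multiplied by [m^-1], receive the same scalar. The link is
    [A = m (y g - z h)]: its image is found from its eigenvectors, and it is related to the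
    nilpotent. With [m = 1] this fixes nilpotents, and these in turn fix the multiples of
    projections, through general [m]. *)
Lemma fix_pair y z g h m : br g y = 1 -> br h z = 1 -> br g z = 0 -> br h y = 0 -> m != 0 ->
  exists b, [/\ b != 0, forall k, br k y = 1 -> psi (m^-1 *: (y *m k)) = b *: (y *m k) &
    psi (m^-1 *: ((y + z) *m (g - h))) = b *: ((y + z) *m (g - h))].
Proof.
move=> gy hz gz hy m0; have y0 := br1_neq0r gy; have z0 := br1_neq0r hz.
have mi0 : m^-1 != 0 by rewrite invr_eq0.
have [b b0 bE] := proj_scalar mi0 y0.
have ni0 : (- m)^-1 != 0 by rewrite invr_eq0 oppr_eq0.
have [b' b'0 b'E] := proj_scalar ni0 z0.
exists b; split=> //; pose A := m *: (y *m g - z *m h); set B := psi A.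
have Ay : A *m y = m *: y.
  by rewrite -scalemxAl mulmxBl !mul_crc gy hy scale0r subr0 scale1r.
have Az : A *m z = (- m) *: z.
  by rewrite -scalemxAl mulmxBl !mul_crc gz hz scale0r sub0r scale1r scalerN scaleNr.
have A0 : A != 0.
  by apply: contraNneq y0 => E; move/eqP: Ay; rewrite E mul0mx eq_sym scaler_eq0 (negPf m0).
have B0 : B != 0 by apply: pres_neq0.
have eig (a c : F) v : a != 0 -> c != 0 -> v != 0 -> A *m v = a *: v ->
    (forall k, br k v = 1 -> psi (a^-1 *: (v *m k)) = c *: (v *m k)) -> B *m v = c^-1 *: v.
  move=> a0 c0 v0 Av cE; case: (@rel_row F n v (c *: B) 1 v0 (sgn1 F)) => [k kv|E|/eqP].
  - rewrite scale1r; apply/jrel_scale; rewrite -cE //; apply: (rel_im hp).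
    exact: rel_eigcol.
  - by rewrite -[LHS]scale1r -(mulVf c0) -scalerA scalemxAl E scale1r.
  - by rewrite scaler_eq0 (negPf c0) (negPf B0).
have By : B *m y = b^-1 *: y by apply: (eig m).
have Bz : B *m z = b'^-1 *: z by apply: (eig (- m)) => //; rewrite oppr_eq0.
have BE : B = b^-1 *: (y *m g) + b'^-1 *: (z *m h).
  apply: col_ext => v; rewrite mulmxDl -!scalemxAl !mul_crc.
  have -> : v = br g v *: y + br h v *: z + (v - (br g v *: y + br h v *: z)) by mring.
  set w := v - _; have gw : br g w = 0 by rewrite /w !brE gy gz; ring.
  have hw : br h w = 0 by rewrite /w !brE hy hz; ring.
  have Bw : B *m w = 0.
    have [->|w0] := eqVneq w 0; first by rewrite mulmx0.
    have [|k [ky kz kw]] := @ex_sep2 y z w.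
      move=> a c E; move: gw hw; rewrite E !brE gy gz hy hz !mulr0 !mulr1 addr0 add0r => a0 c0.
      by move/eqP: w0; apply; rewrite E a0 c0 !scale0r addr0.
    apply: (kill_test kw _ _).1.
      by rewrite -scalemxAl mulmxBl !mul_crc gw hw !scale0r subr0 scaler0.
    by rewrite -scalemxAr mulmxBr !mul_rcr ky kz !scale0r subr0 scaler0.
  clearbody w; rewrite !mulmxDr -!scalemxAr By Bz Bw !brE gy gz hy hz gw hw.
  mring.
have yz0 : y + z != 0.
  apply/eqP=> E; have : br g (y + z) = 0 by rewrite E br0r.
  by rewrite brDr gy gz addr0 => /eqP; rewrite oner_eq0.
have gh0 : g - h != 0.
  apply/eqP=> E; have : br (g - h) y = 0 by rewrite E br0l.
  by rewrite !brE gy hy subr0 => /eqP; rewrite oner_eq0.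
have [|||c cE] := @psi_nil (m^-1 *: (y + z)) (g - h).
- by rewrite scaler_eq0 negb_or mi0.
- by [].
- by rewrite !brE gy gz hy hz; ring.
move: cE; rewrite -scalemxAl scalerA; set e := c * _ => cE; rewrite cE.
congr (_ *: _); set N := (y + z) *m (g - h) in cE *.
have N0 : N != 0 by apply/eqP=> /outer_eq0 [] /eqP; [rewrite (negPf yz0)|rewrite (negPf gh0)].
have e0 : e != 0.
  apply/eqP=> e0; have : psi (m^-1 *: N) != 0.
    by apply: (pres_neq0 hp); rewrite scaler_eq0 negb_or mi0.
  by rewrite cE e0 scale0r eqxx.
have Ny : N *m y = y + z by rewrite mul_crc !brE gy hy subr0 scale1r.
have gN : g *m N = g - h by rewrite mul_rcr !brE gy gz addr0 scale1r.
have hN : h *m N = g - h by rewrite mul_rcr !brE hy hz add0r scale1r.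
have Nz : N *m z = - (y + z) by rewrite mul_crc !brE gz hz sub0r scaleN1r.
have rA : jrel (m^-1 *: N) A.
  apply/jrel_scale; rewrite scalerA mulVf // scale1r.
  have E : jp N (y *m g - z *m h) = 2%:R *: (y *m g + z *m h).
    rewrite /jp mulmxBr mulmxBl [N *m _]mulmxA [N *m (z *m h)]mulmxA Ny Nz.
    rewrite -[y *m g *m N]mulmxA -[z *m h *m N]mulmxA gN hN; moring.
  rewrite /jrel E -scalemxAl -scalemxAr; congr (_ *: _).
  by rewrite mulmxDl !mulmxDr !mul_crcr gy gz hy hz !scale0r !scale1r addr0 add0r.
have rB : jrel (psi (m^-1 *: N)) B := rel_im hp rA.
rewrite cE in rB.
clearbody N; clearbody B.
have Jy : jp (e *: N) B *m y = e *: ((2%:R * b^-1) *: y + (b^-1 + b'^-1) *: z).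
  rewrite jpZl -scalemxAl /jp mulmxDl -!mulmxA By Ny -scalemxAr Ny mulmxDr By Bz; mring.
have Jz : jp (e *: N) B *m z = e *: (- (b^-1 + b'^-1) *: y - (2%:R * b'^-1) *: z).
  rewrite jpZl -scalemxAl /jp mulmxDl -!mulmxA Bz Nz -scalemxAr Nz mulmxN mulmxDr By Bz; mring.
move: rB Jy Jz; rewrite /jrel; set J := jp _ _; clearbody J => rB Jy Jz.
have E : J *m (J *m y) = 2%:R *: (J *m y) by rewrite mulmxA rB -scalemxAl.
rewrite Jy -scalemxAr mulmxDr -!scalemxAr Jy Jz in E.
pose p := e * b^-1; pose q := e * b'^-1.
have E1 : 4%:R * (p * p) - (p + q) * (p + q) = 4%:R * p.
  have := congr1 (br g) E; rewrite !brE gy gz /p /q => E'; lc E'.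
have E2 : (p + q) * (p - q - 1) = 0.
  have := congr1 (br h) E; rewrite !brE hy hz /p /q => E'.
  by apply: (mulfI (two_neq0 F)); lc E'.
have p0 : p != 0 by rewrite mulf_neq0 ?invr_eq0.
have pE : p = e * b^-1 by [].
clearbody p q.
have p1 : p = 1.
  move/eqP: E2; rewrite mulf_eq0 => /orP [/eqP E2|/eqP E2].
    have /eqP : 4%:R * p * (p - 1) = 0 by rewrite E2 mulr0 subr0 in E1; lc E1.
    by rewrite !mulf_eq0 pnatr_eq0 (negPf p0) /= subr_eq0 => /eqP.
  exfalso; have qE : q = p - 1 by lcN E2.
  rewrite qE in E1; have one : 1 = 0 :> F by lcN E1.
  by move/eqP: one; rewrite oner_eq0.
by rewrite -[LHS](divfK b0) -pE p1 mul1r.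
Qed.

Lemma nil_split x f : x != 0 -> f != 0 -> br f x = 0 -> exists y z g h,
  [/\ br g y = 1, br h z = 1, br g z = 0 & br h y = 0] /\ x = y + z /\ f = g - h.
Proof.
move=> x0 f0 fx; have [y fy] := ex_br1l f0.
have [k [ky kx]] : exists k, br k y = 0 /\ br k x = 1.
  apply: ex_sep => a E; move: fx; rewrite E brZr fy mulr1 => a0.
  by move/eqP: x0; apply; rewrite E a0 scale0r.
pose g := k + f; exists y, (x - y), g, (g - f).
rewrite /g !brE ky kx fy fx; split; first by split; ring.
by split; mring.
Qed.

Lemma fix_nil x f : x != 0 -> f != 0 -> br f x = 0 -> psi (x *m f) = x *m f.
Proof.
move=> x0 f0 fx; have [y [z [g [h [[gy hz gz hy] [-> ->]]]]]] := nil_split x0 f0 fx.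
have [b [b0 bE]] := fix_pair gy hz gz hy (oner_neq0 F).
rewrite invr1 !scale1r => ->.
have := bE g gy; rewrite invr1 (hfix (sgn1 F) gy) => /(unit_rank_eq _) <-; first by rewrite scale1r.
by apply/eqP=> /outer_eq0 [] E; move: gy; rewrite E brE => /eqP; rewrite eq_sym oner_eq0.
Qed.

Lemma fix_proj a y g : br g y = 1 -> psi (a *: (y *m g)) = a *: (y *m g).
Proof.
move=> gy; have [->|a0] := eqVneq a 0; first by rewrite scale0r (pres0 hp).
have y0 := br1_neq0r gy; have g0 := br1_neq0l gy.
have [z [z0 gz _]] := ex_col_kill hn g g.
have [h [hy hz]] : exists h, br h y = 0 /\ br h z = 1.
  apply: ex_sep => c E; move: gz; rewrite E brZr gy mulr1 => c0.
  by move/eqP: z0; apply; rewrite E c0 scale0r.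
have ai0 : a^-1 != 0 by rewrite invr_eq0.
have [b [b0 bE]] := fix_pair gy hz gz hy ai0.
rewrite invrK in bE *; rewrite (bE _ gy) => nE.
have yz0 : y + z != 0.
  by apply/eqP=> E; have := congr1 (br g) E; rewrite !brE gy gz addr0 => /eqP; rewrite oner_eq0.
have gh0 : g - h != 0.
  apply/eqP=> E; have := congr1 (fun l : 'rV[F]_n => br l y) E.
  by rewrite !brE gy hy subr0 => /eqP; rewrite oner_eq0.
have fE : psi ((a *: (y + z)) *m (g - h)) = (a *: (y + z)) *m (g - h).
  by apply: fix_nil => //; [rewrite scaler_eq0 negb_or a0|rewrite !brE gy gz hy hz; ring].
rewrite -!scalemxAl nE in fE.
have N0 : (y + z) *m (g - h) != 0.
  by apply/eqP=> /outer_eq0 [] /eqP; [rewrite (negPf yz0)|rewrite (negPf gh0)].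
by rewrite (unit_rank_eq N0 fE).
Qed.

Lemma fix_outer x f : psi (x *m f) = x *m f.
Proof.
have [->|x0] := eqVneq x 0; first by rewrite mul0mx (pres0 hp).
have [->|f0] := eqVneq f 0; first by rewrite mulmx0 (pres0 hp).
have [fx|fx] := eqVneq (br f x) 0; first exact: fix_nil.
have E : x *m f = br f x *: (((br f x)^-1 *: x) *m f).
  by rewrite -scalemxAl scalerA mulfV // scale1r.
by rewrite E fix_proj // brZr mulVf.
Qed.
End Fixing.
End RankOneFixed.

(** * Matrices with the same rank-one relations *)

Section KernelRelation.
Variables (F : numClosedFieldType) (n : nat).
Hypothesis hn : (2 < n)%N.
Implicit Types (A B C D R S T M N X Z : 'M[F]_n) (x y z u v w : 'cV[F]_n) (f g h l r : 'rV[F]_n) (a b c : F).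

(* [A] and [B] are related to the same matrices of rank one; the goal is to recover
   [A] from this and from a few test matrices of higher rank. *)
Definition eqK A B := forall x f, jrel (x *m f) A <-> jrel (x *m f) B.

Lemma eqK_sym A B : eqK A B -> eqK B A.
Proof. by move=> H x f; rewrite H. Qed.
Lemma eqK_tr A B : eqK A B -> eqK A^T B^T.
Proof.
move=> H x f; rewrite -[x]trmxK -[f]trmxK -trmx_mul; split=> /rel_tr K; apply/rel_tr; exact/H.
Qed.

Lemma eqK_eq0 A : eqK A 0 -> A = 0.
Proof.
move=> H; apply: rel0_eq0 => d y g sd gy; rewrite scalemxAl; apply/H; exact: rel0r.
Qed.

Lemma eqK_eig_neq0 A B x a : eqK A B -> a != 0 -> A *m x = a *: x -> B *m x = a *: x.
Proof.
move=> H a0 Ax; have [->|x0] := eqVneq x 0; first by rewrite mulmx0 scaler0.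
case: (@rel_row F n x (a^-1 *: B) 1 x0 (sgn1 F)) => [f fx|E|/eqP].
- rewrite scale1r; apply/jrel_scale; rewrite scalemxAl; apply/H; rewrite -scalemxAl.
  exact: rel_eigcol.
- by rewrite -[LHS]scale1r -(mulfV a0) -scalerA scalemxAl E scale1r.
- rewrite scaler_eq0 invr_eq0 (negPf a0) /= => /eqP B0.
  have A0 : A = 0 by apply: eqK_eq0; rewrite -B0.
  by move/eqP: Ax; rewrite A0 mul0mx eq_sym scaler_eq0 (negPf a0) (negPf x0).
Qed.

Lemma ex_left_ker A x : x != 0 -> A *m x = 0 -> exists2 l : 'rV[F]_n, l != 0 & l *m A = 0.
Proof.
move=> x0 Ax; have : kermx A != 0.
  apply/negP=> /eqP /eqP; rewrite kermx_eq0 row_free_unit => uA.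
  by move/eqP: x0; apply; rewrite -[x](mulKmx uA) Ax mulmx0.
by case/rowV0Pn=> l /sub_kermxP lA l0; exists l.
Qed.

(** For [a = 0], a left kernel row [l] makes all multiples of [x l] anticommute with [A], so they
    are related to [B] and anticommute with it. This gives [B x = b x], and a nonzero [b] would pass
    back to [A]. *)
Lemma eqK_eig A B x a : eqK A B -> A *m x = a *: x -> B *m x = a *: x.
Proof.
move=> H; have [->|a0] := eqVneq a 0; last exact: eqK_eig_neq0.
rewrite scale0r => Ax; have [->|x0] := eqVneq x 0; first by rewrite mulmx0.
have [l l0 lA] := ex_left_ker x0 Ax; have [v lv] := ex_br1l l0.
have rt t : jrel (x *m (t *: l)) B.
  by apply/H/ant_rel; rewrite /ant /jp mulmxA -mulmxA -!scalemxAl lA Ax scaler0 mulmx0 mul0mx addr0.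
have : ant B (x *m l).
  apply: rel_ant; first by apply/relC; have := rt 1; rewrite scale1r.
  by apply/relC; rewrite scalemxAr.
rewrite /ant jpC /jp mulmxA -mulmxA => E.
have Bx : B *m x = (- br (l *m B) v) *: x.
  have := congr1 (mulmx^~ v) E; rewrite mulmxDl mul0mx !mul_crc lv scale1r addrC => /eqP.
  by rewrite addr_eq0 scaleNr => /eqP.
have [b0|b0] := eqVneq (- br (l *m B) v) 0; first by rewrite Bx b0 scale0r.
have := eqK_eig_neq0 (eqK_sym H) b0 Bx; rewrite Ax => /esym/eqP.
by rewrite scaler_eq0 (negPf b0) (negPf x0).
Qed.

Lemma eqK_eigl A B f a : eqK A B -> f *m A = a *: f -> f *m B = a *: f.
Proof.
move=> H fA; apply: trmx_inj; rewrite trmx_mul linearZ /=.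
by apply: (eqK_eig (eqK_tr H)); rewrite -trmx_mul fA linearZ.
Qed.

Lemma jp_outer A x f : jp A (x *m f) = (A *m x) *m f + x *m (f *m A).
Proof. by rewrite /jp !mulmxA. Qed.

Lemma rel_outer_nil A x f : br f x = 0 -> br f (A *m (A *m x)) = 0 -> br f (A *m x) = 2%:R ->
  jrel (x *m f) A.
Proof.
move=> fx fAAx fAx; apply/relC; rewrite /jrel jp_outer.
rewrite mulmxDl !mulmxDr !mul_crcr !brA fx fAx fAAx; mring.
Qed.

Lemma rel_outer_nil_inv A x f : x != 0 -> f != 0 -> br f x = 0 -> jrel (x *m f) A ->
  br f (A *m x) = 2%:R \/ exists b, A *m x = b *: x.
Proof.
move=> x0 f0 fx /relC; rewrite /jrel jp_outer => E.
set s := br f (A *m x); set t := br f (A *m (A *m x)).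
rewrite mulmxDl !mulmxDr !mul_crcr !brA fx -/s -/t in E.
have /eqP : s * (s - 2%:R) = 0.
  have E' := congr1 (mulmx^~ x) E; rewrite -scalemxAl !mulmxDl -!scalemxAl !mul_crc fx brA -/s in E'.
  apply: (unit_rank_eq x0); mlc E'.
rewrite mulf_eq0 subr_eq0 => /orP [/eqP s0|/eqP]; last by left.
right; have [z fz] := ex_br1l f0; exists (2%:R^-1 * t - br (f *m A) z).
have E' := congr1 (mulmx^~ z) E; rewrite -scalemxAl !mulmxDl -!scalemxAl !mul_crc fz s0 in E'.
apply: two_inj; rewrite scalerA mulrBr mulrA mulfV ?two_neq0 // mul1r; mlcN E'.
Qed.

Section Compare.
Variables A A' : 'M[F]_n.
Hypothesis H : eqK A A'.
Let D := A' - A.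

Lemma A'E x : A' *m x = A *m x + D *m x.
Proof. by rewrite -mulmxDl /D addrC subrK. Qed.

Lemma D_eig x a : A *m x = a *: x -> D *m x = 0.
Proof. by move=> Ax; rewrite mulmxBl (eqK_eig H Ax) Ax subrr. Qed.

Lemma D_test x f : br f x = 0 -> br f (A *m (A *m x)) = 0 -> br f (A *m x) = 2%:R ->
  br f (D *m x) = 0.
Proof.
move=> fx fAAx fAx.
have x0 : x != 0.
  by apply/eqP=> x0; move/eqP: fAx; rewrite x0 mulmx0 br0r eq_sym (negPf (two_neq0 F)).
have f0 : f != 0.
  by apply/eqP=> f0; move/eqP: fAx; rewrite f0 br0l eq_sym (negPf (two_neq0 F)).
have : jrel (x *m f) A' by apply/H; apply: rel_outer_nil.
case/(rel_outer_nil_inv x0 f0 fx) => [E|[b /(eqK_eig (eqK_sym H)) E]].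
  by rewrite mulmxBl brDr brNr E fAx subrr.
by move/eqP: fAx; rewrite E brZr fx mulr0 eq_sym (negPf (two_neq0 F)).
Qed.

(** A row killing [x] and [A^2 x] but not [A x] can be rescaled to satisfy [D_test], so it kills
    [D x]; adding one such row [f] covers those that kill [A x] as well. *)
Lemma D_local x : (forall a b, A *m x <> a *: x + b *: (A *m (A *m x))) ->
  exists a b, D *m x = a *: x + b *: (A *m (A *m x)).
Proof.
move=> nsp; have [Dx|Dx] := eqVneq (D *m x) 0.
  by exists 0, 0; rewrite Dx !scale0r addr0.
have [f [fx fAA fA]] := ex_sep2 nsp.
have test k : br k x = 0 -> br k (A *m (A *m x)) = 0 -> br k (A *m x) != 0 -> br k (D *m x) = 0.
  move=> kx kAA kA; pose c := 2%:R / br k (A *m x).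
  have : br (c *: k) (D *m x) = 0.
    by apply: D_test; rewrite brZl ?kx ?kAA ?mulr0 // divfK.
  rewrite brZl => /eqP; rewrite mulf_eq0 mulf_eq0 invr_eq0 (negPf kA) (negPf (two_neq0 F)).
  by move/eqP.
apply: mul_rowsub0 => // k kx kAA.
have [kA|kA] := eqVneq (br k (A *m x)) 0; last exact: test.
have e1 : br f (D *m x) = 0 by apply: test; rewrite ?fA ?oner_neq0.
have e2 : br (k + f) (D *m x) = 0.
  by apply: test; rewrite brDl ?kx ?kAA ?kA ?fx ?fAA ?fA ?addr0 ?add0r ?oner_neq0.
by move: e2; rewrite brDl e1 addr0.
Qed.

Lemma commX N j : A *m N = N *m A -> A *m N ^+ j = N ^+ j *m A.
Proof.
move=> AN; elim: j => [|j IH]; first by rewrite expr0 mulmx1 mul1mx.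
by rewrite exprS -mulmxE mulmxA AN -mulmxA IH mulmxA.
Qed.

(** [D] takes the same value on [x], [x + v (j+2)] and [x + v (j+1)], as it kills the added columns,
    while [D_local] expresses it through three different columns. The expressions agree only when
    both coefficients vanish. *)
Lemma D_chain a x j : a != 0 -> (A - a%:M) ^+ j.+3 *m x = 0 ->
  (forall v, (A - a%:M) ^+ j.+2 *m v = 0 -> D *m v = 0) -> D *m x = 0.
Proof.
move=> a0 xk IH; set N := A - a%:M in xk IH.
have AN : A *m N = N *m A.
  by rewrite /N mulmxBr mulmxBl mul_mx_scalar mul_scalar_mx.
have AE v : A *m v = a *: v + N *m v.
  by rewrite /N mulmxBl mul_scalar_mx; mring.
pose v i := N ^+ i *m x; clearbody N.
have NXv i p : N ^+ i *m v p = v (i + p)%N by rewrite /v mulmxA exprD.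
have Nv i : N *m v i = v i.+1 by rewrite -[N]expr1 NXv.
have vk i : (j.+2 < i)%N -> v i = 0.
  by move=> ij; rewrite -(subnK ij) -NXv /v xk mulmx0.
have AAE u : A *m (A *m u) = (a * a) *: u + (2%:R * a) *: (N *m u) + N *m (N *m u).
  by rewrite AE !(AE u) mulmxDr -scalemxAr; mring.
have Dv i : (0 < i)%N -> D *m v i = 0.
  by move=> i0; apply: IH; rewrite NXv vk // -addn1 leq_add2l.
have [e0|e0] := eqVneq (v j.+2) 0; first exact: IH.
have x_v : x = v 0%N by rewrite /v expr0 mul1mx.
have loc w : N ^+ j.+2 *m w = v j.+2 -> exists b c, D *m w = b *: w + c *: (A *m (A *m w)).
  (* Multiplying by [N^j] moves the assumed dependence to a chain of length three, where its
     coefficients would satisfy both [2ac = 1] and [c = 0]. *)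
  move=> Nw; apply: D_local => b c E; pose u := N ^+ j *m w.
  have Eu : A *m u = b *: u + c *: (A *m (A *m u)).
    have cm z : A *m (N ^+ j *m z) = N ^+ j *m (A *m z) by rewrite !mulmxA commX.
    by rewrite /u !cm {1}E mulmxDr -!scalemxAr.
  have NNu : N *m (N *m u) = v j.+2 by rewrite /u -Nw !exprS -!mulmxE !mulmxA.
  have Ne : N *m v j.+2 = 0 by rewrite Nv vk.
  rewrite AAE AE NNu in Eu.
  have E2 : (a - b - c * (a * a)) *: v j.+2 = 0.
    have := congr1 (fun z => N *m (N *m z)) Eu.
    rewrite !mulmxDr -!scalemxAr !mulmxDr -!scalemxAr !NNu !Ne !mulmx0 => K; mlc K.
  have r2 : a - b - c * (a * a) = 0.
    by move/eqP: E2; rewrite scaler_eq0 (negPf e0) orbF => /eqP.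
  have E1 : (1 - c * (2%:R * a)) *: v j.+2 = (b + c * (a * a) - a) *: (N *m u).
    have := congr1 (mulmx N) Eu.
    rewrite !mulmxDr -!scalemxAr !mulmxDr -!scalemxAr !NNu !Ne => K; mlc K.
  have r2' : b + c * (a * a) - a = 0 by lcN r2.
  rewrite r2' scale0r in E1.
  have r1 : 1 - c * (2%:R * a) = 0.
    by move/eqP: E1; rewrite scaler_eq0 (negPf e0) orbF => /eqP.
  have E0 : c *: v j.+2 = 0.
    apply/matrixP=> p q; have := congr1 (fun M : 'cV[F]_n => M p q) Eu; rewrite !entE => K.
    lcs3 (-1 : F) K (u p q) r2 ((N *m u) p q) r1.
  have c0 : c = 0 by move/eqP: E0; rewrite scaler_eq0 (negPf e0) orbF => /eqP.
  by move/eqP: r1; rewrite c0 mul0r subr0 oner_eq0.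
have AAv i : A *m (A *m v i) = (a * a) *: v i + (2%:R * a) *: v i.+1 + v i.+2.
  by rewrite AAE !Nv.
have [b [c Dx]] : exists b c, D *m v 0%N = b *: v 0%N + c *: (A *m (A *m v 0%N)).
  by rewrite -x_v; apply: loc.
have loc' i : (0 < i)%N -> exists b c,
    D *m v 0%N = b *: (v 0%N + v i) + c *: (A *m (A *m (v 0%N + v i))).
  move=> i0; have -> : D *m v 0%N = D *m (v 0%N + v i) by rewrite mulmxDr (Dv i) // addr0.
  by apply: loc; rewrite mulmxDr !NXv addn0 (vk (_ + i)%N) ?addr0 //; lia.
have [b1 [c1 D1]] := loc' j.+2 isT; have [b2 [c2 D2]] := loc' j.+1 isT.
rewrite !mulmxDr !AAv in D1; rewrite !mulmxDr !AAv in D2; rewrite AAv in Dx.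
rewrite (vk j.+3) ?(vk j.+4) ?(vk j.+3) in D1 D2; try lia.
have cancel (t : F) : t *: v j.+2 = 0 -> t = 0.
  by move/eqP; rewrite scaler_eq0 (negPf e0) orbF => /eqP.
(* The clause on [p] matters when [j = 0]: then [N^(j+1)] does not kill [v (j+1)]. *)
have red b' c' p q : (b - b' + (c - c') * (a * a)) *: v 0%N + ((c - c') * (2%:R * a)) *: v 1%N +
    (c - c') *: v 2%N = p *: v j.+1 + q *: v j.+2 -> (b - b' + (c - c') * (a * a) = 0 -> p = 0) ->
    [/\ b = b', c = c' & p *: v j.+1 + q *: v j.+2 = 0].
  move=> R p0.
  have E2 : b - b' + (c - c') * (a * a) = 0.
    apply: cancel; have := congr1 (mulmx (N ^+ j.+2)) R.
    rewrite !mulmxDr -!scalemxAr !NXv addn0.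
    rewrite (vk (j.+2 + 1)%N) ?(vk (j.+2 + 2)%N) ?(vk (j.+2 + j.+1)%N) ?(vk (j.+2 + j.+2)%N); try lia.
    by rewrite !scaler0 !addr0.
  have E1 : (c - c') * (2%:R * a) = 0.
    apply: cancel; have := congr1 (mulmx (N ^+ j.+1)) R.
    rewrite E2 (p0 E2) !scale0r !add0r !mulmxDr -!scalemxAr !NXv.
    rewrite (vk (j.+1 + 2)%N) ?(vk (j.+1 + j.+2)%N) ?addn1; try lia.
    by rewrite !scaler0 !addr0.
  have cc : c = c'.
    move/eqP: E1; rewrite !mulf_eq0 (negPf a0) (negPf (two_neq0 F)) !orbF subr_eq0 => /eqP //.
  rewrite cc subrr !mul0r !scale0r !addr0 in R E2.
  by rewrite E2 scale0r in R; split=> //; apply/eqP; rewrite -subr_eq0 E2.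
have [bb cc R1] : [/\ b = b1, c = c1 & 0 *: v j.+1 + (b1 + c1 * (a * a)) *: v j.+2 = 0].
  apply: red => //; rewrite D1 in Dx; mlcN Dx.
rewrite scale0r add0r -bb -cc in R1; move/cancel: R1 => R1.
have [bb2 cc2 R2] : [/\ b = b2, c = c2 &
    (b2 + c2 * (a * a)) *: v j.+1 + (c2 * (2%:R * a)) *: v j.+2 = 0].
  apply: red; first by rewrite D2 in Dx; mlcN Dx.
  by move=> E; lc2 R1 (esym E).
rewrite -bb2 -cc2 R1 scale0r add0r in R2; move/cancel/eqP: R2.
rewrite !mulf_eq0 (negPf a0) (negPf (two_neq0 F)) !orbF => /eqP c0.
have b0 : b = 0 by move: R1; rewrite c0 mul0r addr0.
by rewrite x_v Dx b0 c0 !scale0r addr0.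
Qed.
End Compare.
End KernelRelation.

(** * Decomposition into generalized eigenvectors *)

Section GeneralizedEigen.
Variable F : numClosedFieldType.

(** Starting from the characteristic polynomial, a Bezout relation between [q] and [(X - a)^k]
    splits [v] into a generalized eigenvector and a column annihilated by the smaller polynomial
    [q]. *)
Lemma gen_eig_ind m (A : 'M[F]_m.+1) (P : 'cV[F]_m.+1 -> Prop) :
  (forall u v, P u -> P v -> P (u + v)) ->
  (forall a k v, (A - a%:M) ^+ k *m v = 0 -> P v) -> forall v, P v.
Proof.
move=> PD PE.
suff H s : forall p : {poly F}, (size p <= s)%N -> p != 0 ->
    forall v, horner_mx A p *m v = 0 -> P v.
  move=> v; apply: (H _ (char_poly A) (leqnn _)).
    by rewrite monic_neq0 // char_poly_monic.
  by rewrite Cayley_Hamilton mul0mx.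
elim: s => [|s IH] p ps p0 v pv.
  by move: ps; rewrite leqn0 size_poly_eq0 (negPf p0).
have [sp|sp] := eqVneq (size p) 1%N.
  have /size_poly1P [c c0 pE] : size p == 1%N by apply/eqP.
  move: pv; rewrite pE horner_mx_C mul_scalar_mx => /eqP.
  rewrite scaler_eq0 (negPf c0) => /eqP ->; apply: (PE 0 0%N); exact: mulmx0.
have /closed_rootP [a pa] := sp.
have [k [q]] := multiplicity_XsubC p a; rewrite p0 /= => qa pE.
have q0 : q != 0 by apply: contraNneq p0 => q0; rewrite pE q0 mul0r.
have k0 : (0 < k)%N.
  by case: k pE => // pE; move: pa; rewrite pE expr0 mulr1 (negPf qa).
have sq : (size q <= s)%N.
  have szE : size p = (size q + k)%N.
    by rewrite pE size_Mmonic ?monic_exp ?monicXsubC // size_exp_XsubC addnS.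
  by rewrite -ltnS (leq_trans _ ps) // szE -addn1 leq_add2l.
have cop : coprimep q (('X - a%:P) ^+ k) by apply: coprimep_expr; rewrite coprimep_XsubC.
have /Bezout_eq1_coprimepP [[u w] /= uw] := cop.
have hX : horner_mx A (('X - a%:P) ^+ k) = (A - a%:M) ^+ k.
  by rewrite rmorphXn /= rmorphB /= horner_mx_X horner_mx_C.
have vE : v = horner_mx A (u * q) *m v + horner_mx A (w * ('X - a%:P) ^+ k) *m v.
  by rewrite -mulmxDl -rmorphD /= uw rmorph1 mul1mx.
rewrite vE; apply: PD.
- apply: (PE a k); rewrite -hX mulmxA mulmxE -rmorphM /=.
  have -> : ('X - a%:P) ^+ k * (u * q) = u * p by rewrite pE; ring.
  by rewrite rmorphM /= -mulmxE -mulmxA pv mulmx0.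
- apply: (IH q) => //; rewrite mulmxA mulmxE -rmorphM /=.
  have -> : q * (w * ('X - a%:P) ^+ k) = w * p by rewrite pE; ring.
  by rewrite rmorphM /= -mulmxE -mulmxA pv mulmx0.
Qed.
End GeneralizedEigen.

(** * Rigid test matrices and Jordan blocks of size two *)

Section Rigid.
Variables (F : numClosedFieldType) (n : nat).
Implicit Types (A B C D R S T M N X Z : 'M[F]_n) (x y z u v w : 'cV[F]_n) (f g h r : 'rV[F]_n) (a b c : F).

(** A map that preserves the relation and fixes all matrices of rank one must fix a rigid matrix.
    Such a matrix is therefore an admissible test of higher rank, which is the source of the
    hypothesis [HR] below. *)
Definition rigid B := forall B', eqK B B' -> B' = B.

Lemma rigid_scale B c : c != 0 -> rigid B -> rigid (c *: B).
Proof.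
move=> c0 rB B' H; have E : c^-1 *: B' = B.
  apply: rB => x f; have K := H (c^-1 *: x) f; rewrite -!scalemxAl in K.
  split=> [h|/jrel_scale/K/jrel_scale].
    by apply/jrel_scale/K/jrel_scale; rewrite scalerA mulVf // scale1r.
  by rewrite scalerA mulVf // scale1r.
by rewrite -E scalerA mulfV // scale1r.
Qed.

Section Compare.
Variables A A' : 'M[F]_n.
Hypothesis H : eqK A A'.
Hypothesis HR : forall B, rigid B -> jrel B A -> jrel B A'.
Let D := A' - A.

(* The parameter [k] is chosen so that the restriction to the span of [x] and [z] has
   the two distinct eigenvectors [x + t1 z] and [x + t2 z]. *)
Lemma rigid_two a x z f0 f t1 t2 k c : br f x = 1 -> br f z = 2%:R * a -> br f0 x = 0 -> br f0 z = 1 ->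
  t1 != t2 ->
  (forall t, t = t1 \/ t = t2 -> (1 + 2%:R * a * t) * t = (1 + 2%:R * a * t) * k - t) ->
  rigid (c *: ((x + k *: z) *m f - z *m f0)).
Proof.
move=> fx fz f0x f0z tt Ht B' K; set w := x + k *: z; set B := c *: _ in K *.
have Bv v : B *m v = c *: (br f v *: w - br f0 v *: z).
  by rewrite -scalemxAl mulmxBl !mul_crc.
have eig t : t = t1 \/ t = t2 -> B *m (x + t *: z) = (c * (1 + 2%:R * a * t)) *: (x + t *: z).
  move=> /Ht E; rewrite Bv !brDr !brZr fx fz f0x f0z /w.
  apply/matrixP=> i j; rewrite !entE.
  by lcs (c * z i j) (esym E).
have E1 : B' *m (x + t1 *: z) = B *m (x + t1 *: z).
  by rewrite (eig t1) ?(eqK_eig K (eig t1 _)) //; left.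
have E2 : B' *m (x + t2 *: z) = B *m (x + t2 *: z).
  by rewrite (eig t2) ?(eqK_eig K (eig t2 _)) //; right.
have Ez : B' *m z = B *m z.
  move: E1 E2; rewrite !mulmxDr -!scalemxAr => E1 E2.
  apply: (@scalerI _ _ (t1 - t2)); first by rewrite subr_eq0.
  mlc2 E1 (esym E2).
have Ex : B' *m x = B *m x by move: E1; rewrite !mulmxDr -!scalemxAr Ez => /addIr.
apply: col_ext => v.
have -> : v = (br f v - 2%:R * a * br f0 v) *: x + br f0 v *: z +
    (v - ((br f v - 2%:R * a * br f0 v) *: x + br f0 v *: z)) by mring.
set u := v - _; have fu : br f u = 0 by rewrite /u !brE fx fz; ring.
have f0u : br f0 u = 0 by rewrite /u !brE f0x f0z; ring.
clearbody u; have Bu : B *m u = 0 *: u.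
  by rewrite Bv fu f0u !scale0r subr0 scaler0.
by rewrite !mulmxDr -!scalemxAr Ex Ez Bu (eqK_eig K Bu).
Qed.

(** The row [f = f0 A + a f0] makes [jp B0 A] collapse to [w (a f + f A)], of rank one and trace
    [4a(1 + ak)]; the factor [c] normalizes this trace to [2]. The conclusion is the relation of
    [c B0] to [A'], cleared of [c]. *)
Lemma jordan2_key a x z f0 f t1 t2 k : a != 0 -> A *m x = a *: x + z -> A *m z = a *: z ->
  br f0 x = 0 -> br f0 z = 1 -> f = f0 *m A + a *: f0 -> 1 + a * k != 0 ->
  t1 != t2 ->
  (forall t, t = t1 \/ t = t2 -> (1 + 2%:R * a * t) * t = (1 + 2%:R * a * t) * k - t) ->
  forall M, M = (x + k *: z) *m (a *: f + f *m A') + (D *m x) *m f - z *m (f0 *m D) ->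
  M *m M = (4%:R * a * (1 + a * k)) *: M.
Proof.
move=> a0 Ax Az f0x f0z fE ak tt Ht M; set w := x + k *: z => ME.
have Dz : D *m z = 0 by apply: (D_eig H Az).
have fx : br f x = 1 by rewrite fE brDl brA Ax brZl f0x brDr brZr f0x f0z; ring.
have fz : br f z = 2%:R * a by rewrite fE brDl brA Az brZl brZr f0z; ring.
pose B0 := w *m f - z *m f0; pose c := (2%:R * a * (1 + a * k))^-1.
have c0 : c != 0 by rewrite invr_eq0 !mulf_neq0 ?two_neq0.
have kc : c * (4%:R * a * (1 + a * k)) = 2%:R.
  have -> : 4%:R * a * (1 + a * k) = 2%:R * c^-1 by rewrite invrK; ring.
  by rewrite mulrCA mulfV // mulr1.
have rB : rigid (c *: B0) by exact: (rigid_two fx fz f0x f0z tt Ht).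
have Aw : A *m w = a *: w + z by rewrite /w mulmxDr -scalemxAr Ax Az; mring.
have jA : jp B0 A = w *m (a *: f + f *m A).
  rewrite jpC /jp /B0 mulmxBr mulmxBl !mulmxA Aw Az -[w *m f *m A]mulmxA -[z *m f0 *m A]mulmxA.
  have -> : f0 *m A = f - a *: f0 by rewrite fE; mring.
  move: (f *m A) => fA; moring.
have kw : br (a *: f + f *m A) w = 4%:R * a * (1 + a * k).
  by rewrite brDl brZl brA Aw /w !brDr !brZr !brDr !brZr fx fz; ring.
have rA : jrel (c *: B0) A.
  rewrite /jrel jpZl jA -scalemxAl -scalemxAr mul_crcr kw !scalerA; congr (_ *: _).
  by lcs c kc.
have := HR rB rA; rewrite /jrel jpZl.
have -> : jp B0 A' = M.
  have A'w : A' *m w = a *: w + z + D *m x.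
    by rewrite (A'E A) Aw -/D /w mulmxDr -scalemxAr Dz scaler0 addr0.
  have A'z : A' *m z = a *: z by rewrite (A'E A) Az -/D Dz addr0.
  have f0D : f0 *m D = f0 *m A' - (f - a *: f0).
    by rewrite /D mulmxBr; congr (_ - _); rewrite fE; mring.
  rewrite jpC /jp /B0 ME f0D mulmxBr mulmxBl !mulmxA A'w A'z -[w *m f *m A']mulmxA -[z *m f0 *m A']mulmxA.
  move: (f *m A') (f0 *m A') (D *m x) => p q r'; moring.
rewrite -scalemxAl -scalemxAr !scalerA => E.
apply: (scalerI c0); apply: (scalerI c0); rewrite !scalerA E; congr (_ *: _).
by lcs (- c) kc.
Qed.

(** Here [A x] lies in the span of [x] and [A^2 x], so [D_local] gives nothing. The matrix [M] of
    [jordan2_key] is affine in [k]; its identity at two values of [k] isolates the mixed term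
    [lin]. *)
Lemma D_jordan2 a x z : a != 0 -> A *m x = a *: x + z -> A *m z = a *: z -> D *m x = 0.
Proof.
move=> a0 Ax Az; have [z0|z0] := eqVneq z 0.
  by apply: (D_eig H (a := a)); rewrite Ax z0 addr0.
have zx c : z <> c *: x.
  move=> E; have c0 : c != 0 by apply: contraNneq z0 => c0; rewrite E c0 scale0r.
  have x0 : x != 0 by apply: contraNneq z0 => x0; rewrite E x0 scaler0.
  have := congr1 (mulmx A) E; rewrite Az -scalemxAr Ax E => K.
  have /eqP : (c * c) *: x = 0 by mlcN K.
  by rewrite scaler_eq0 mulf_eq0 (negPf c0) (negPf x0).
have [f0 [f0x f0z]] := ex_sep zx.
pose f := f0 *m A + a *: f0; pose k' := a *: f + f *m A'.
have fx : br f x = 1 by rewrite /f brDl brA Ax brZl f0x brDr brZr f0x f0z; ring.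
have fz : br f z = 2%:R * a by rewrite /f brDl brA Az brZl brZr f0z; ring.
have Dz : D *m z = 0 by apply: (D_eig H Az).
set dl := D *m x; pose e := f0 *m D.
pose M0 := x *m k' + dl *m f - z *m e.
have aa0 : a * a != 0 by rewrite mulf_neq0.
have E0 : M0 *m M0 = (4%:R * a) *: M0.
  have -> : 4%:R * a = 4%:R * a * (1 + a * 0) by ring.
  apply: (@jordan2_key a x z f0 f 0 (- a^-1) 0 a0 Ax Az f0x f0z erefl).
  - by rewrite mulr0 addr0 oner_neq0.
  - by rewrite eq_sym oppr_eq0 invr_eq0.
  - move=> t [->|->]; first by ring.
    by field.
  - by rewrite scale0r addr0.
have sqD P Q : (P + Q) *m (P + Q) = P *m P + (P *m Q + Q *m P) + Q *m Q :> 'M[F]_n.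
  by rewrite mulmxDl !mulmxDr; mring.
(* The eigenvector parameters are the roots of [2a t^2 + 2(1 - ak) t - k], with discriminant
   [4(1 + (ak)^2)]. The value [ak = 3/4] makes it a square, by the triple 3, 4, 5, so that the roots
   are explicit. *)
pose k := 3%:R / (4%:R * a).
have k0 : k != 0 by rewrite mulf_neq0 ?invr_eq0 ?mulf_neq0 ?pnatr_eq0.
have E1 : (M0 + k *: (z *m k')) *m (M0 + k *: (z *m k')) =
    (4%:R * a * (1 + a * k)) *: (M0 + k *: (z *m k')).
  apply: (@jordan2_key a x z f0 f (2%:R * a)^-1 (- (3%:R / (4%:R * a))) k a0 Ax Az f0x f0z erefl).
  - have -> : 1 + a * k = 7%:R / 4%:R by rewrite /k; field.
    by rewrite mulf_neq0 ?invr_eq0 ?pnatr_eq0.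
  - rewrite -subr_eq0; have -> : (2%:R * a)^-1 - - (3%:R / (4%:R * a)) = 5%:R / (4%:R * a) by field.
    by rewrite mulf_neq0 ?invr_eq0 ?mulf_neq0 ?pnatr_eq0.
  - by move=> t [->|->]; rewrite /k; field.
  - by rewrite /M0 -/k' mulmxDl -scalemxAl -/dl -/e; mring.
have k'z : br k' z = 4%:R * (a * a).
  by rewrite /k' brDl brZl brA (A'E A) Az -/D Dz addr0 brZr fz; ring.
pose s := br f dl.
have k'x : br k' x = 4%:R * a + s.
  by rewrite /k' brDl brZl brA (A'E A) Ax -/D -/dl !brDr brZr fx fz /s; ring.
have ez : br e z = 0 by rewrite /e brA Dz br0r.
have M0z : M0 *m z = (4%:R * (a * a)) *: x + (2%:R * a) *: dl.
  by rewrite /M0 mulmxBl mulmxDl !mul_crc k'z fz ez scale0r subr0.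
have kM0 : k' *m M0 = (4%:R * a + s) *: k' + br k' dl *: f - (4%:R * (a * a)) *: e.
  by rewrite /M0 mulmxBr mulmxDr !mul_rcr k'x k'z.
have zz : z *m k' *m (z *m k') = (4%:R * (a * a)) *: (z *m k') by rewrite mul_crcr k'z.
have lin : M0 *m (z *m k') + z *m k' *m M0 = (4%:R * (a * a)) *: M0 + (4%:R * a) *: (z *m k').
  apply: (scalerI k0); move: E1; rewrite sqD -!scalemxAl -!scalemxAr E0 zz => E1.
  mlc E1.
move: lin; rewrite mulmxA M0z -[z *m k' *m M0]mulmxA kM0 /M0 => lin.
have E : (s *: z + (2%:R * a) *: dl) *m (k' - (2%:R * a) *: f) =
   - (2%:R * a * s + br k' dl) *: (z *m f).
  move: lin; clearbody k' f dl e s => lin.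
  apply/matrixP=> i j; have := congr1 (fun X : 'M[F]_n => X i j) lin.
  by rewrite !(entO, entE) => K; lc K.
have kd : br k' dl = - (2%:R * a * s).
  have := congr1 (mulmx^~ z) E; rewrite mul_crc -scalemxAl mul_crc brDl brNl brZl k'z fz => K.
  have /eqP : (2%:R * a * (2%:R * a * s + br k' dl)) *: z = 0.
    have z4 : 4%:R * (a * a) - 2%:R * a * (2%:R * a) = 0 by ring.
    by rewrite z4 scale0r in K; mlc K.
  rewrite scaler_eq0 (negPf z0) orbF !mulf_eq0 (negPf a0) (negPf (two_neq0 F)) /= addrC addr_eq0.
  by move/eqP.
move: E; rewrite kd addrN oppr0 scale0r => /outer_eq0 [E|E].
- have s0 : s = 0.
    have := congr1 (br f) E; rewrite br0r brDr !brZr fz -/s => K.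
    have /eqP : 4%:R * a * s = 0 by lc K.
    by rewrite !mulf_eq0 (negPf a0) pnatr_eq0 => /eqP.
  move/eqP: E; rewrite s0 scale0r add0r scaler_eq0 mulf_eq0 (negPf a0) (negPf (two_neq0 F)).
  by move/eqP.
- exfalso; have fA' : f *m A' = a *: f by move: E; rewrite /k' => E; mlc E.
  have fA := eqK_eigl (eqK_sym H) fA'.
  have := congr1 (fun l : 'rV[F]_n => br l x) fA; rewrite brA Ax brDr brZr brZl fx fz => K.
  have /eqP : 2%:R * a = 0 by lc K.
  by rewrite mulf_eq0 (negPf a0) (negPf (two_neq0 F)).
Qed.
End Compare.
End Rigid.

(** * The generalized kernel *)

Section Nilpotent.
Variables (F : numClosedFieldType) (n : nat).
Implicit Types (A B C D R S T M N X Z : 'M[F]_n) (x y z u v w : 'cV[F]_n) (f g h m : 'rV[F]_n) (a b c : F).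

Lemma ex_stable A : exists K, forall v : 'cV[F]_n, A ^+ K.+1 *m v = 0 -> A ^+ K *m v = 0.
Proof.
pose P r := `[< exists K, \rank (A ^+ K) = r >].
have exP : exists r, P r by exists (\rank (A ^+ 0)); apply/asboolP; exists 0%N.
case: (ex_minnP exP) => r /asboolP [K Kr] minr; exists K => v vK.
have sub : (A ^+ K.+1 <= A ^+ K)%MS by rewrite exprS -mulmxE submxMl.
have : (A ^+ K <= A ^+ K.+1)%MS.
  rewrite -(mxrank_leqif_sup sub) eqn_leq mxrankS // Kr; apply: minr.
  by apply/asboolP; exists K.+1.
by case/submxP=> C ->; rewrite -mulmxA vK mulmx0.
Qed.

Lemma ex_sep_mx S y : (forall c : 'cV[F]_n, y <> S *m c) -> exists m, m *m S = 0 /\ br m y = 1.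
Proof.
move=> nS; have : ~~ (y^T <= S^T)%MS.
  apply/negP=> /submxP [w E]; apply: (nS w^T); apply: trmx_inj.
  by rewrite E trmx_mul trmxK.
rewrite submxE => /neq0_ent [i [j]]; rewrite ord1 => yj.
pose m0 := (cokermx S^T *m delta_mx j (0 : 'I_1))^T.
have m0S : m0 *m S = 0.
  by apply: trmx_inj; rewrite trmx_mul /m0 trmxK mulmxA mulmx_coker mul0mx trmx0.
have m0y : br m0 y != 0.
  by rewrite -br_tr /m0 trmxK /br mulmxA -colE mxE.
exists ((br m0 y)^-1 *: m0); rewrite -scalemxAl m0S scaler0 brZl mulVf //.
Qed.

Section Compare.
Variables A A' : 'M[F]_n.
Hypothesis H : eqK A A'.
Hypothesis HR : forall B, rigid B -> jrel B A -> jrel B A'.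
Let D := A' - A.

Lemma mulXX i x : A *m (A ^+ i *m x) = A ^+ i.+1 *m x.
Proof. by rewrite exprS -mulmxE mulmxA. Qed.
Lemma mulXA i x : A ^+ i *m (A *m x) = A ^+ i.+1 *m x.
Proof. by rewrite exprSr -mulmxE mulmxA. Qed.
Lemma mulXn i j x : A ^+ i *m (A ^+ j *m x) = A ^+ (i + j) *m x.
Proof. by rewrite mulmxA exprD. Qed.

Lemma D_ker x : A *m x = 0 -> D *m x = 0.
Proof. by move=> Ax; apply: (D_eig H (a := 0)); rewrite Ax scale0r. Qed.

Lemma Xge p i x : A ^+ p *m x = 0 -> (p <= i)%N -> A ^+ i *m x = 0.
Proof. by move=> px pi; rewrite -(subnK pi) -mulXn px mulmx0. Qed.

Lemma D_nil_local p x : (0 < p)%N -> A ^+ p *m x != 0 -> A ^+ p.+1 *m x = 0 ->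
  exists b c, D *m x = b *: x + c *: (A *m (A *m x)).
Proof.
move=> p0 px px1; apply: (D_local H) => b c E.
have b0 : b = 0.
  have := congr1 (mulmx (A ^+ p)) E; rewrite mulmxDr -!scalemxAr.
  rewrite !mulXA px1 (@Xge p.+1 p.+2) // scaler0 addr0.
  by move/esym/eqP; rewrite scaler_eq0 (negPf px) orbF => /eqP.
have := congr1 (mulmx (A ^+ p.-1)) E; rewrite b0 scale0r add0r -scalemxAr.
rewrite !mulXA prednK // px1.
by rewrite scaler0 => /eqP; rewrite (negPf px).
Qed.

Lemma D_nil1 x : A *m (A *m x) = 0 -> D *m x = 0.
Proof.
move=> AAx; have [/D_ker//|Ax] := eqVneq (A *m x) 0.
have loc w : A *m w = A *m x -> exists b, D *m w = b *: w.
  move=> Aw; have [||b [c E]] := @D_nil_local 1 w isT.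
  - by rewrite expr1 Aw.
  - by rewrite -mulXX expr1 Aw AAx.
  by exists b; rewrite E Aw AAx scaler0 addr0.
have [b Dx] := loc x erefl.
have [|b' D1] := loc (x + A *m x); first by rewrite mulmxDr AAx addr0.
rewrite mulmxDr (D_ker AAx) addr0 Dx in D1.
have bb : b = b'.
  apply: (unit_rank_eq Ax); have := congr1 (mulmx A) D1.
  by rewrite -!scalemxAr mulmxDr AAx addr0.
have /eqP : b' *: (A *m x) = 0 by rewrite bb in D1; mlcN D1.
by rewrite scaler_eq0 (negPf Ax) orbF Dx bb => /eqP ->; rewrite scale0r.
Qed.

Lemma D_nil k x : A ^+ k *m x = 0 -> exists c, D *m x = c *: (A *m (A *m x)).
Proof.
move=> kx; have ex : exists k, A ^+ k *m x == 0 by exists k; apply/eqP.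
case: (ex_minnP ex) => {kx}k /eqP kx mink.
have top i : (i < k)%N -> A ^+ i *m x != 0.
  by move=> ik; apply/negP=> /mink; rewrite leqNgt ik.
have [k2|k2] := leqP k 2.
  exists 0; rewrite scale0r; apply: D_nil1.
  by have := Xge kx k2; rewrite expr2 -mulmxE -mulmxA.
case: k k2 kx top {mink} => // -[//|[//|p]] _ kx top.
have px : A ^+ p.+2 *m x != 0 by apply: top.
pose v i := A ^+ i *m x.
have Av i : A *m v i = v i.+1 by apply: mulXX.
have vX i j : A ^+ i *m v j = v (i + j)%N by apply: mulXn.
have v0 i : (p.+2 < i)%N -> v i = 0 by apply: Xge kx.
have xv : x = v 0%N by rewrite /v expr0 mul1mx.
have loc w : A ^+ p.+2 *m w = v p.+2 -> exists b c, D *m w = b *: w + c *: (A *m (A *m w)).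
  move=> Ew; apply: (@D_nil_local p.+2) => //; first by rewrite Ew.
  by rewrite -mulXX Ew Av v0.
have [b [c Dx]] := loc x erefl.
suff b0 : b = 0 by exists c; rewrite Dx b0 scale0r add0r.
have cancel (t : F) : t *: v p.+2 = 0 -> t = 0.
  by move/eqP; rewrite scaler_eq0 (negPf px) orbF => /eqP.
have loc' i : (0 < i)%N -> D *m v i = 0 -> exists b c,
    D *m x = b *: (v 0%N + v i) + c *: (v 2%N + v i.+2).
  move=> i0 Dv; have [|b1 [c1 E]] := loc (v 0%N + v i).
    by rewrite mulmxDr !vX addn0 (v0 (_ + i)%N) ?addr0 //; lia.
  by exists b1, c1; move: E; rewrite mulmxDr Dv addr0 -xv !mulmxDr {3}xv !Av.
rewrite {2 3}xv !Av in Dx.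
(* The comparison adds to [x] a column killed by [D]. In a chain of length three the last column is
   [A^2 x], which already occurs in the local expression, so [A x] is added instead. *)
case: p => [|p] in px v0 kx top loc cancel loc' *.
- have [||b1 [c1 D1]] := loc' 1%N; [by []| |].
    by apply: D_nil1; rewrite !Av v0.
  rewrite (v0 3%N) // addr0 Dx in D1.
  have bb : b = b1.
    apply/eqP; rewrite -subr_eq0; apply/eqP/cancel.
    have := congr1 (mulmx (A ^+ 2)) D1.
    by rewrite !mulmxDr -!scalemxAr !mulmxDr !vX !addn0 (v0 (2 + 1)%N) // (v0 (2 + 2)%N) // => E; mlc E.
  have := congr1 (mulmx A) D1; rewrite !mulmxDr -!scalemxAr !mulmxDr !Av !(v0 3%N) // bb => E.
  by apply: cancel; mlcN E.
- have [||b1 [c1 D1]] := loc' p.+3; [by []| |].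
    by apply: D_ker; rewrite Av v0.
  rewrite (v0 p.+4.+1) ?addr0 in D1; last by lia.
  rewrite Dx in D1.
  have bb : b = b1.
    apply/eqP; rewrite -subr_eq0; apply/eqP/cancel.
    have := congr1 (mulmx (A ^+ p.+3)) D1.
    rewrite !mulmxDr -!scalemxAr !mulmxDr !vX !addn0 (v0 (p.+3 + 2)%N) ?(v0 (p.+3 + p.+3)%N); try lia.
    by move=> E; mlc E.
  have cc : c = c1.
    apply/eqP; rewrite -subr_eq0; apply/eqP/cancel.
    have := congr1 (mulmx (A ^+ p.+1)) D1.
    rewrite bb !mulmxDr -!scalemxAr !mulmxDr !vX (v0 (p.+1 + p.+3)%N) ?addn2; try lia.
    by move=> E; mlc E.
  by apply: cancel; rewrite bb cc in D1 *; mlcN D1.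
Qed.

Section Chain.
Variables (K : nat) (xi : 'cV[F]_n) (m : 'rV[F]_n).
Hypothesis xiK : A ^+ K *m xi = 0.
Hypothesis mK : m *m A ^+ K = 0.
Hypothesis K2 : (2 < K)%N.
Hypothesis mxi : forall i, (i < K)%N -> br m (A ^+ i *m xi) = (i == K.-1)%:R.

(* [Z] is [(-1)^i] on [A^i xi] and kills an [A]-invariant complement of the chain. *)
Let Z := \sum_(i < K) (-1) ^+ i *: ((A ^+ i *m xi) *m (m *m A ^+ (K.-1 - i))).

Lemma mxi0 i : (K <= i)%N -> br m (A ^+ i *m xi) = 0.
Proof. by move=> Ki; rewrite (Xge xiK Ki) br0r. Qed.

Lemma chainZ_mul v : Z *m v = \sum_(i < K) ((-1) ^+ i * br m (A ^+ (K.-1 - i) *m v)) *: (A ^+ i *m xi).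
Proof.
by rewrite /Z mulmx_suml; apply: eq_bigr => i _; rewrite -scalemxAl mul_crc brA scalerA.
Qed.

Lemma chainZ_xi j : (j < K)%N -> Z *m (A ^+ j *m xi) = (-1) ^+ j *: (A ^+ j *m xi).
Proof.
move=> jK; rewrite chainZ_mul (bigD1 (Ordinal jK)) //= big1 ?addr0.
  rewrite mulXn mxi; last by lia.
  by rewrite subnK ?eqxx ?mulr1 //; lia.
move=> i /eqP ij; rewrite mulXn.
have [Ki|Ki] := leqP K (K.-1 - i + j); first by rewrite mxi0 // mulr0 scale0r.
rewrite mxi //; case: eqP => [E|_]; last by rewrite mulr0 scale0r.
by case: ij; apply/val_inj => /=; have := ltn_ord i; lia.
Qed.

Lemma chainZ_ant : ant A Z.
Proof.
pose T i := (-1) ^+ i *: ((A ^+ i *m xi) *m (m *m A ^+ (K - i))).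
have ZA : Z *m A = \sum_(i < K) T i.
  rewrite /Z mulmx_suml; apply: eq_bigr => i _; rewrite /T -scalemxAl -!mulmxA.
  by congr (_ *: (_ *m (_ *m (m *m _)))); rewrite mulmxE -exprSr; congr (_ ^+ _); have := ltn_ord i; lia.
have AZ : A *m Z = - \sum_(i < K) T i.+1.
  rewrite /Z mulmx_sumr -sumrN; apply: eq_bigr => i _; rewrite /T -scalemxAr [A *m _]mulmxA mulXX.
  rewrite [(-1) ^+ i.+1]exprS mulN1r scaleNr opprK; congr (_ *: (_ *m (m *m _ ^+ _))).
  by have := ltn_ord i; lia.
rewrite /ant /jp AZ ZA addrC.
have K0 : (0 < K)%N by lia.
have T0 : T 0%N = 0 by rewrite /T subn0 mK mulmx0 scaler0.
have TK : T K = 0 by rewrite /T xiK mul0mx scaler0.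
have -> : \sum_(i < K) T i = \sum_(i < K.+1) T i by rewrite big_ord_recr /= TK addr0.
by rewrite big_ord_recl /= T0 add0r subrr.
Qed.

(** The eigenvectors of [Z] span: the chain itself, and the columns killed by all rows [m A^l] with
    [l < K]. [eqK_eig] carries each of them over to [B']. *)
Lemma chainZ_rigid : rigid Z.
Proof.
move=> B' E; have Bxi j : (j < K)%N -> B' *m (A ^+ j *m xi) = Z *m (A ^+ j *m xi).
  by move=> jK; rewrite (chainZ_xi jK); apply: (eqK_eig E); apply: chainZ_xi.
apply: col_ext => v.
pose u := \sum_(j < K) br m (A ^+ (K.-1 - j) *m v) *: (A ^+ j *m xi).
have -> : v = u + (v - u) by rewrite addrC subrK.
have Bu : B' *m u = Z *m u.
  rewrite /u !mulmx_sumr; apply: eq_bigr => j _.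
  by rewrite -!scalemxAr Bxi.
rewrite (mulmxDr B' u) (mulmxDr Z u) Bu; congr (_ + _).
have mw l : (l < K)%N -> br m (A ^+ l *m (v - u)) = 0.
  move=> lK; rewrite mulmxDr mulmxN brDr brNr.
  suff -> : br m (A ^+ l *m u) = br m (A ^+ l *m v) by rewrite subrr.
  rewrite /u mulmx_sumr /br mulmx_sumr summxE.
  have jK : (K.-1 - l < K)%N by lia.
  rewrite (bigD1 (Ordinal jK)) //= big1 ?addr0.
    rewrite -scalemxAr -/(br m _) brZr mulXn mxi; last by lia.
    have -> : (l + (K.-1 - l))%N = K.-1 by lia.
    rewrite eqxx mulr1; congr (br m (A ^+ _ *m v)); lia.
  move=> i /eqP il; rewrite -scalemxAr -/(br m _) brZr mulXn.
  have [Ki|Ki] := leqP K (l + i); first by rewrite mxi0 // mulr0.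
  rewrite mxi //; case: eqP => [Ei|_]; last by rewrite mulr0.
  by case: il; apply/val_inj => /=; have := ltn_ord i; lia.
have Zw : Z *m (v - u) = 0 *: (v - u).
  rewrite scale0r chainZ_mul big1 // => i _.
  by rewrite mw ?mulr0 ?scale0r //; lia.
by rewrite Zw; apply: (eqK_eig E).
Qed.

(** As [Z] and [2Z] are both rigid, [A'] anticommutes with [Z], hence so does [D]. But [Z] fixes
    both [xi] and [A^2 xi], so [D xi = c A^2 xi] has to vanish. *)
Lemma D_top : D *m xi = 0.
Proof.
have Zant' : ant A' Z.
  have r1 : jrel Z A' by apply: HR; [exact: chainZ_rigid|apply/relC/ant_rel/chainZ_ant].
  apply: rel_ant; first exact/relC.
  apply/relC; apply: HR; first by apply: rigid_scale; [exact: two_neq0|exact: chainZ_rigid].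
  by apply/relC/ant_rel/antZ/chainZ_ant.
have DZ : jp D Z = 0.
  rewrite /D jpDl jpNl; have -> : jp A' Z = 0 by exact: Zant'.
  have -> : jp A Z = 0 by exact: chainZ_ant.
  by rewrite subr0.
have [c Dx] := D_nil xiK.
have Z0 : Z *m xi = xi.
  have K0 : (0 < K)%N by lia.
  by have := chainZ_xi K0; rewrite !expr0 mul1mx scale1r.
have AA2 : A *m (A *m xi) = A ^+ 2 *m xi by rewrite expr2 -mulmxE mulmxA.
have Z2 : Z *m (A *m (A *m xi)) = A *m (A *m xi).
  by rewrite AA2 (chainZ_xi K2) expr2 mulrNN mulr1 scale1r.
have := congr1 (mulmx^~ xi) DZ; rewrite /jp mulmxDl mul0mx -!mulmxA Z0 Dx -scalemxAr Z2.
exact: addrr_inj0.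
Qed.
End Chain.

(** Subtracting a multiple of [A^(j+1) xi] corrects the pairing at exponent [K - 1 - (j+1)] and
    leaves all higher exponents unchanged. *)
Lemma normalize_chain K m xi : (0 < K)%N -> A ^+ K *m xi = 0 -> br m (A ^+ K.-1 *m xi) = 1 ->
  exists xi', [/\ A ^+ K *m xi' = 0 & forall i, (i < K)%N -> br m (A ^+ i *m xi') = (i == K.-1)%:R].
Proof.
move=> K0 xiK mxi.
suff ex j : (j <= K.-1)%N -> exists xi', A ^+ K *m xi' = 0 /\
    forall i, (K.-1 - j <= i < K)%N -> br m (A ^+ i *m xi') = (i == K.-1)%:R.
  have [xi' [E1 E2]] := ex K.-1 (leqnn _); exists xi'; split=> // i iK.
  by apply: E2; rewrite subnn iK.
elim: j => [_|j IH jK].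
  exists xi; split=> // i iK; have -> : i = K.-1 by lia.
  by rewrite mxi eqxx.
have [|x1 [x1K mx1]] := IH; first by lia.
pose l := (K.-1 - j.+1)%N; pose b := br m (A ^+ l *m x1).
exists (x1 - b *: (A ^+ j.+1 *m x1)); split.
  by rewrite mulmxDr mulmxN -scalemxAr mulXn x1K (Xge x1K) ?scaler0 ?subr0 // leq_addr.
move=> i iK; rewrite mulmxDr mulmxN -scalemxAr mulXn !brE.
have [il|il] := eqVneq i l.
  have -> : (i + j.+1)%N = K.-1 by rewrite il /l; lia.
  rewrite (mx1 K.-1) ?eqxx; last by lia.
  by rewrite il -/b mulr1 subrr; case: eqP => //; rewrite /l; lia.
rewrite (mx1 i); last by move/eqP: il; rewrite /l; lia.
rewrite (Xge x1K) ?br0r ?mulr0 ?subr0 //.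
by move/eqP: il; rewrite /l; lia.
Qed.

(** A chain of maximal length [K] has top [xi] with [D xi = 0]. For another [x], either a multiple
    of [xi] brings [x] into the kernel of [A^2], or comparing [D x] with [D (x + xi)] makes the
    coefficient of [A^2 x] vanish. *)
Lemma D_nilpotent k x : A ^+ k *m x = 0 -> D *m x = 0.
Proof.
move=> kx.
pose P K := `[< forall v : 'cV[F]_n, A ^+ K.+1 *m v = 0 -> A ^+ K *m v = 0 >].
have exP : exists K, P K by have [K HK] := ex_stable A; exists K; apply/asboolP.
case: (ex_minnP exP) => K /asboolP stab minK.
have down j v : A ^+ (K + j) *m v = 0 -> A ^+ K *m v = 0.
  elim: j v => [|j IH] v; first by rewrite addn0.
  by move=> E; apply: IH; rewrite -mulXn; apply: stab; rewrite mulXn addSnnS.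
have xK : A ^+ K *m x = 0.
  have [/(Xge kx)//|Kk] := leqP k K; apply: (down (k - K)%N); rewrite subnKC //; exact: ltnW.
have [K2|K2] := leqP K 2.
  by apply: D_nil1; have := Xge xK K2; rewrite expr2 -mulmxE -mulmxA.
have [xi0 [xi0K xi0top]] : exists v : 'cV[F]_n, A ^+ K *m v = 0 /\ A ^+ K.-1 *m v != 0.
  apply: contrapT => no; have : P K.-1.
    apply/asboolP=> v; rewrite prednK; last by lia.
    by move=> vK; apply: contrapT => /eqP vt; apply: no; exists v.
  by move/minK; lia.
(* If [A^(K-1) xi0] were [A^K c], then [A^(K+1) c = 0], and stability at [K] would give
   [A^K c = 0]. *)
have [|m [mK mtop]] := @ex_sep_mx (A ^+ K) (A ^+ K.-1 *m xi0).
  move=> c E; move/eqP: xi0top; apply; rewrite E; apply: stab.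
  rewrite -mulXX -E mulXX prednK //; lia.
have [|xi [xiK mxi]] := @normalize_chain K m xi0 _ xi0K mtop; first by lia.
have Dxi : D *m xi = 0 := D_top xiK mK K2 mxi.
have xi2 : A *m (A *m xi) != 0.
  rewrite mulmxA -[A *m A]expr2; apply/eqP=> E.
  have := mxi K.-1; rewrite eqxx (Xge E) ?br0r; last by lia.
  move=> /(_ _)/eqP; rewrite eq_sym oner_eq0 => X; have /X : (K.-1 < K)%N by lia.
  by [].
have [c Dx] := D_nil xK.
have [[b E]|nE] := pselect (exists b, A *m (A *m x) = b *: (A *m (A *m xi))).
  have -> : x = (x - b *: xi) + b *: xi by rewrite subrK.
  rewrite mulmxDr -scalemxAr Dxi scaler0 addr0; apply: D_nil1.
  by rewrite !(mulmxDr, mulmxN) -!scalemxAr E subrr.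
have [|c1 D1] := @D_nil K (x + xi); first by rewrite mulmxDr xK xiK addr0.
rewrite !mulmxDr Dxi addr0 Dx in D1.
have E : (c - c1) *: (A *m (A *m x)) = c1 *: (A *m (A *m xi)) by mlc D1.
have [cc|cc] := eqVneq (c - c1) 0.
  move: E; rewrite cc scale0r => /esym/eqP; rewrite scaler_eq0 (negPf xi2) orbF => /eqP c10.
  by rewrite Dx; move/eqP: cc; rewrite subr_eq0 c10 => /eqP ->; rewrite scale0r.
case: nE; exists ((c - c1)^-1 * c1); rewrite -scalerA -E scalerA mulVf // scale1r //.
Qed.
End Compare.
End Nilpotent.

(** * Assembly of the normal form *)

Section Identity.
Variables (F : numClosedFieldType) (m : nat).
Notation n := m.+1.
Hypothesis hn : (2 < n)%N.
Implicit Types (A B C D R X Z : 'M[F]_n) (x y z u v w : 'cV[F]_n) (f g h : 'rV[F]_n) (a b c d e : F).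

Lemma eqK_rigid_eq A A' : eqK A A' -> (forall B, rigid B -> jrel B A -> jrel B A') -> A' = A.
Proof.
move=> H HR; suff D0 v : (A' - A) *m v = 0.
  by apply: col_ext => v; move/eqP: (D0 v); rewrite mulmxBl subr_eq0 => /eqP.
apply: (@gen_eig_ind F m A (fun v => (A' - A) *m v = 0)).
  by move=> u w Du Dw; rewrite mulmxDr Du Dw addr0.
move=> a; have [->|a0] := eqVneq a 0 => k.
  by move=> w; rewrite raddf0 subr0; apply: D_nilpotent.
elim/ltn_ind: k => -[|[|[|k]]] IH w wk.
- by move: wk; rewrite expr0 mul1mx => ->; rewrite mulmx0.
- apply: (D_eig H (a := a)); move: wk; rewrite expr1 mulmxBl mul_scalar_mx => /eqP.
  by rewrite subr_eq0 => /eqP.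
- apply: (@D_jordan2 F n A A' H HR a w ((A - a%:M) *m w)) => //.
    by rewrite mulmxBl mul_scalar_mx; mring.
  move: wk; rewrite expr2 -mulmxE -mulmxA; move: (_ *m w) => z.
  by rewrite mulmxBl mul_scalar_mx => /eqP; rewrite subr_eq0 => /eqP.
- by apply: (D_chain hn H a0 wk) => u; apply: IH.
Qed.

Lemma fixing_id (psi : 'M[F]_n -> 'M[F]_n) :
  (forall A B, jrel A B <-> jrel (psi A) (psi B)) ->
  (forall d y g, sgn d -> br g y = 1 -> psi (d *: (y *m g)) = d *: (y *m g)) ->
  forall A, psi A = A.
Proof.
move=> hpsi hfix.
have K B : eqK B (psi B) by move=> x f; rewrite hpsi (fix_outer hn hpsi hfix).
move=> A; apply: eqK_rigid_eq => // B rB; rewrite hpsi; by rewrite (rB _ (K B)).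
Qed.

Lemma inverse_rmorphism (s : {rmorphism F -> F}) : bijective s ->
  exists t : {rmorphism F -> F}, cancel s t /\ cancel t s.
Proof.
case=> t st ts; have inj := fmorph_inj s.
have [|||t' tE] := @rmorphism_of F t.
- by move=> a b; apply: inj; rewrite rmorphD !ts.
- by move=> a b; apply: inj; rewrite rmorphM !ts.
- by apply: inj; rewrite ts rmorph1.
by exists t'; split=> a; rewrite tE.
Qed.

Definition conj_arg (T : 'M[F]_n) (phi : 'M[F]_n -> 'M[F]_n) := fun X => phi (T *m X *m invmx T).

Lemma conj_jrel T A B : T \in unitmx ->
  jrel A B <-> jrel (T *m A *m invmx T) (T *m B *m invmx T).
Proof.
move=> uT; have inj X Y : T *m X *m invmx T = T *m Y *m invmx T -> X = Y.
  move=> E; have := congr1 (fun M => invmx T *m M *m T) E.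
  by rewrite -!mulmxA !mulVmx // !mulmx1 !mulmxA mulVmx // !mul1mx.
have mulT X Y : T *m X *m invmx T *m (T *m Y *m invmx T) = T *m (X *m Y) *m invmx T.
  by rewrite -!mulmxA; congr (_ *m (_ *m _)); rewrite mulKmx.
have jE : jp (T *m A *m invmx T) (T *m B *m invmx T) = T *m jp A B *m invmx T.
  by rewrite /jp !mulT -mulmxDl -mulmxDr.
rewrite /jrel jE mulT scalemxAl scalemxAr; split=> [->//|]; exact: inj.
Qed.

Section Conj.
Variables (phi : 'M[F]_n -> 'M[F]_n) (T : 'M[F]_n).
Hypothesis uT : T \in unitmx.

Lemma conj_pres : pres phi -> pres (conj_arg T phi).
Proof.
move=> [h1 h2]; split=> [A B|d y g sd gy]; first by rewrite -h1 -conj_jrel.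
have [A E] := h2 d y g sd gy; exists (invmx T *m A *m T); rewrite /conj_arg -E.
by rewrite !mulmxA mulmxV // mul1mx -mulmxA mulmxV // mulmx1.
Qed.
Lemma conj_eigU d e x y : eigU phi d e (T *m x) y -> eigU (conj_arg T phi) d e x y.
Proof.
move=> H h R hy RE; have := H h _ hy RE.
rewrite -!mulmxA mulKmx // scalemxAr => /(congr1 (mulmx (invmx T))).
by rewrite !mulmxA mulVmx // !mul1mx.
Qed.
Lemma conj_eigV' d e f g : eigV' phi d e f g -> eigV' (conj_arg T phi) d e (f *m T) g.
Proof.
move=> H z R gz RE; have := H z _ gz RE => /(congr1 (mulmx^~ T)).
by rewrite -!mulmxA mulVmx // mulmx1 -scalemxAl !mulmxA.
Qed.
Lemma conj_kind1 e y g : kind1 phi e y g -> kind1 (conj_arg T phi) e y g.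
Proof.
move=> [x [f [fx U1 V1]]]; exists (invmx T *m x), (f *m T); split.
- by rewrite brA mulmxA mulmxV // mul1mx.
- by apply: conj_eigU; rewrite mulmxA mulmxV // mul1mx.
- exact: conj_eigV'.
Qed.
End Conj.

Lemma ex_basis phi : pres phi -> (forall y g, br g y = 1 -> kind1 phi 1 y g) ->
  exists2 T : 'M[F]_n, T \in unitmx &
    (forall i, eigU phi 1 1 (T *m ecol F i) (ecol F i)) /\
    eigU phi 1 1 (T *m const_mx 1) (const_mx 1).
Proof.
move=> hphi hk.
have /choice [X HX] : forall i : 'I_n, exists x, x != 0 /\ eigU phi 1 1 x (ecol F i).
  by move=> i; have [x x0 U1] := ex_colU hk (ecol_neq0 F i); exists x.
have /choice [G HG] : forall i : 'I_n, exists f, f != 0 /\ eigV' phi 1 1 f (erow F i).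
  by move=> i; have [f f0 V1] := ex_rowV hk (erow_neq0 F i); exists f.
have one0 : const_mx 1 != 0 :> 'cV[F]_n.
  by apply/eqP=> /colP /(_ ord0); rewrite !mxE => /eqP; rewrite oner_eq0.
have [x1 x10 U1] := ex_colU hk one0.
have orth i x y : x != 0 -> y != 0 -> eigU phi 1 1 x y -> (br (G i) x == 0) = (y i 0 == 0).
  move=> x0 y0 U2; rewrite (kind1_orth hn hphi hk x0 y0 (HG i).1 (erow_neq0 F i) U2 (HG i).2).
  by rewrite br_erow.
have Gx1 i : br (G i) x1 != 0 by rewrite (orth i _ _ x10 one0 U1) mxE oner_eq0.
have GX i j : (br (G i) (X j) == 0) = (i != j).
  rewrite (orth i _ _ (HX j).1 (ecol_neq0 F j) (HX j).2) ecolE (eq_sym j i).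
  by case: (i == j); rewrite ?oner_eq0 ?eqxx.
(* These scalars make [T] send the all-ones column to [x1]; [Q], built from the dual rows [G i], is
   the inverse of [T]. *)
pose c j := br (G j) x1 / br (G j) (X j).
have c0 j : c j != 0 by rewrite mulf_neq0 ?invr_eq0 // GX eqxx.
pose T : 'M[F]_n := \matrix_(i, j) (c j * X j i 0).
pose Q : 'M[F]_n := \matrix_(i, j) ((br (G i) x1)^-1 * G i 0 j).
have Te j : T *m ecol F j = c j *: X j.
  by rewrite -colE; apply/colP=> i; rewrite !mxE.
have Qx i x : (Q *m x) i 0 = (br (G i) x1)^-1 * br (G i) x.
  have -> : br (G i) x = \sum_j G i 0 j * x j 0 by rewrite /br mxE.
  by rewrite mxE mulr_sumr; apply: eq_bigr => j _; rewrite mxE mulrA.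
have QT : Q *m T = 1%:M.
  apply: col_ext => x; rewrite mul1mx; have -> : x = \sum_j x j 0 *: ecol F j.
    apply/colP=> i; rewrite summxE (bigD1 i) //= big1 ?addr0.
      by rewrite entZ ecolE eqxx mulr1.
    by move=> j ji; rewrite entZ ecolE (negPf ji) mulr0.
  rewrite mulmx_sumr; apply: eq_bigr => j _; rewrite -scalemxAr; congr (_ *: _).
  rewrite -mulmxA Te; apply/colP=> i; rewrite Qx brZr ecolE (eq_sym j i).
  have [->|ij] := eqVneq i j; last by have := GX i j; rewrite ij => /eqP ->; rewrite !mulr0.
  by rewrite /c divfK ?mulVf // GX eqxx.
have [uQ uT] := mulmx1_unit QT; exists T => //; split.
  by move=> i; rewrite Te; apply: eigU_scaler; case: (HX i).
have -> : T *m const_mx 1 = x1.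
  have -> : const_mx 1 = Q *m x1.
    by apply/colP=> i; rewrite Qx mxE mulVf.
  by rewrite mulmxA (mulmx1C QT) mul1mx.
exact: U1.
Qed.

Theorem kind1_form phi : pres phi -> (forall y g, br g y = 1 -> kind1 phi 1 y g) ->
  exists (s : {rmorphism F -> F}) (T : 'M[F]_n), [/\ bijective s, T \in unitmx &
    forall X, phi X = T *m map_mx s X *m invmx T].
Proof.
move=> hphi hk; have [T uT [Te T1]] := ex_basis hphi hk.
have hp := conj_pres uT hphi.
have hk' y g : br g y = 1 -> kind1 (conj_arg T phi) 1 y g by move=> /hk; apply: conj_kind1.
have he i : eigU (conj_arg T phi) 1 1 (ecol F i) (ecol F i) by apply: conj_eigU => //; apply: Te.
have h1 : eigU (conj_arg T phi) 1 1 (const_mx 1) (const_mx 1) by apply: conj_eigU.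
have [t [bt Ht]] := ex_frame hn hp hk' he h1.
(* The frame expresses preimages through their images, so precomposing with [map_mx t] fixes every
   [d y g]; the automorphism of the conclusion is the inverse of [t]. *)
pose psi X := conj_arg T phi (map_mx t X).
have inj : injective (map_mx t : 'M[F]_n -> 'M[F]_n) by apply: map_mx_inj; apply: fmorph_inj.
have psi_id : forall A, psi A = A.
  apply: fixing_id => [A B|d y g sd gy].
    rewrite -(relE hp) /jrel /jp -!map_mxM -map_mxD -map_mxM.
    have -> : 2%:R *: map_mx t (A *m B + B *m A) = map_mx t (2%:R *: (A *m B + B *m A)).
      by rewrite map_mxZ rmorph_nat.
    by split=> [->|/inj].
  have [R RE] := onto hp sd gy; rewrite /psi map_mxZ.
  have -> : t d = d by case: sd => ->; rewrite ?rmorphN rmorph1.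
  by rewrite -(Ht _ _ _ _ sd gy RE).
have [s [ts st]] := inverse_rmorphism bt.
have E X : conj_arg T phi X = map_mx s X.
  rewrite -[RHS]psi_id /psi; congr (conj_arg T phi _).
  by apply/matrixP=> i j; rewrite !mxE st.
exists s, (map_mx s (invmx T)); split.
- by exists t.
- by rewrite map_unitmx unitmx_inv.
- move=> X; have -> : phi X = conj_arg T phi (invmx T *m X *m T).
    by rewrite /conj_arg !mulmxA mulmxV // mul1mx -mulmxA mulmxV // mulmx1.
  by rewrite E !map_mxM -map_invmx invmxK.
Qed.

Lemma kind1_opp phi y g : kind1 phi (-1) y g -> kind1 (fun X => phi (- X)) 1 y g.
Proof.
move=> [x [f [fx U1 V1]]]; exists x, f; split=> //.
- by move=> h R hy RE; have := U1 _ _ hy RE; rewrite mulNmx !scaleN1r scale1r => /oppr_inj.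
- by move=> z R gz RE; have := V1 _ _ gz RE; rewrite mulmxN !scaleN1r scale1r => /oppr_inj.
Qed.

Theorem pres_form phi : pres phi ->
  exists (s : {rmorphism F -> F}) (T : 'M[F]_n) (lambda : F),
    [/\ bijective s, T \in unitmx, lambda = 1 \/ lambda = -1 &
      (forall X, phi X = lambda *: (T *m map_mx s X *m invmx T)) \/
      (forall X, phi X = lambda *: (T *m (map_mx s X)^T *m invmx T))].
Proof.
move=> hphi; have form psi e : pres psi -> sgn e ->
    (forall y g, br g y = 1 -> kind1 psi e y g) ->
    exists (s : {rmorphism F -> F}) (T : 'M[F]_n), [/\ bijective s, T \in unitmx &
      forall X, psi X = e *: (T *m map_mx s X *m invmx T)].
  move=> hpsi se hk; case: se hk => -> hk.
    have [s [T [bs uT E]]] := kind1_form hpsi hk.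
    by exists s, T; split=> // X; rewrite scale1r.
  have [|s [T [bs uT E]]] := kind1_form (pres_oppr hpsi).
    by move=> y g /hk; apply: kind1_opp.
  exists s, T; split=> // X; have := E (- X); rewrite opprK => ->.
  by rewrite map_mxN mulmxN mulNmx scaleN1r.
have [e se [hk|hk]] := kind_total hn hphi.
- have [s [T [bs uT E]]] := form _ _ hphi se hk.
  by exists s, T, e; split=> //; left.
- have [s [T [bs uT E]]] := form _ _ (presr hphi) se hk.
  exists s, T, e; split=> //; right=> X; have := E X^T; rewrite /trr trmxK => ->.
  by rewrite map_trmx.
Qed.
End Identity.

(** * Translation between idempotents and the relation *)

Section Bridge.
Variables (F : numClosedFieldType) (n : nat).
Implicit Types (A B : 'M[F]_n) (y : 'cV[F]_n) (g : 'rV[F]_n).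

Lemma idempotent_jordan A B : idempotents F n (jordan_prod A B) <-> jrel A B.
Proof.
rewrite /idempotents /= /idempotent_mx /jordan_prod /jrel -/(jp A B).
have two0 := two_neq0 F; rewrite -scalemxAl -scalemxAr scalerA.
split=> [E|->]; last by rewrite scalerA mulfVK.
have four0 : 2%:R^-1 * 2%:R^-1 != 0 :> F by rewrite mulf_neq0 ?invr_eq0.
by apply: (scalerI four0); rewrite E scalerA mulfVK.
Qed.

Lemma rank1_outer d y g : sgn d -> br g y = 1 -> rank1_pm_idempotents F n (d *: (y *m g)).
Proof.
move=> sd gy; have d0 := sgn_neq0 sd.
have P0 := sgn_scale_neq0 sd gy.
have rk : \rank (d *: (y *m g)) = 1%N.
  apply/eqP; rewrite eqn_leq lt0n mxrank_eq0 P0 andbT.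
  by rewrite scalemxAl (leq_trans (mxrankM_maxr _ _)) // rank_leq_row.
have sq : d *: (y *m g) *m (d *: (y *m g)) = (d * d) *: (y *m g).
  by rewrite -scalemxAl -scalemxAr scalerA mul_crcr gy scale1r.
case: sd sq rk P0 => -> sq rk P0; [left|right]; split=> //.
  by rewrite /idempotent_mx sq mulr1.
split; last exact/eqP.
by rewrite sq mulrNN mulr1 scale1r scaleN1r opprK.
Qed.
End Bridge.

Local Open Scope classical_set_scope.


Theorem theorem2 (R : realType) (n : nat) (hn : (3 <= n)%N)
    (phi : 'M[R[i]]_n -> 'M[R[i]]_n)
    (hrange : rank1_pm_idempotents R[i] n `<=` range phi)
    (hphi : forall A B : 'M[R[i]]_n,
       idempotents R[i] n (jordan_prod A B) <->
       idempotents R[i] n (jordan_prod (phi A) (phi B))) :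
  exists (sigma : {rmorphism R[i] -> R[i]}) (T : 'M[R[i]]_n) (lambda : R[i]),
    [/\ bijective sigma,
        T \in unitmx,
        lambda = 1 \/ lambda = -1 &
        (forall X : 'M[R[i]]_n,
           phi X = lambda *: (T *m map_mx sigma X *m invmx T)) \/
        (forall X : 'M[R[i]]_n,
           phi X = lambda *: (T *m (map_mx sigma X)^T *m invmx T))].
Proof.
case: n hn phi hrange hphi => // m hn0 phi0 hr hp.
apply: (pres_form hn0); split=> [A B|d y g sd gy].
  by rewrite -!idempotent_jordan; apply: hp.
by have [A _ E] := hr _ (rank1_outer sd gy); exists A.
Qed.
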